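(* Let $\gamma>\frac13$, let $X:[0,T]\to\mathcal A_*$ be a $\gamma$-Hölder path in a non-commutative probability space $(\mathcal A,\varphi)$, and assume that we are given a product Lévy area $\mathbf X$ above $X$. For every $\mathbf U\in\mathbf Q(X)$ with decomposition $(\delta\mathbf U)_{st}=(\delta X)_{st}\sharp\mathbb U^{X,1}_s+\mathbb U^{X,2}_s\sharp(\delta X)_{st}+\mathbf U^\flat_{st}$, set $$\mathcal J_{st}(\mathbf U\sharp dX):=(\mathrm{Id}-\Lambda\delta)_{st}(M),\qquad M_{st}:=\mathbf U_s\sharp(\delta X)_{st}+[\mathbf X_{st}\times\mathrm{Id}](\mathbb U^{X,1}_s)+[\mathrm{Id}\times\mathbf X^*_{st}](\mathbb U^{X,2}_s).$$ Then: (i) $\mathcal J(\mathbf U\sharp dX)$ is well-defined as a two-parameter process in $\mathcal C_2^\gamma(\mathcal A)$. (ii) If $X$ is a differentiable process in $\mathcal A$ and $\mathbf X$ is understood in the classical Lebesgue sense, i.e. $\mathbf X_{st}[\mathbf V]=\int_s^t(\mathbf V\sharp(\delta X)_{su})\cdot X'_u\,du$, then $\mathcal J_{st}(\mathbf U\sharp dX)$ coincides with the classical Lebesgue integral $\int_s^t[\mathbf U_u\sharp X'_u]\,du$. (iii) For every $A\in\mathcal A$, there exists a unique process $Z\in\mathcal Q(X)$ such that $Z_0=A$ and $(\delta Z)_{st}=\mathcal J_{st}(\mathbf U\sharp dX)$. (iv) One has, for any interval $I=[\ell_1,\ell_2]$, $$\mathcal N[Z;\mathcal Q(I;X)]\le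 c_X\big\{1+\mathcal N[\mathbf U;\mathcal C_1^0(I;\mathcal A\hat\otimes\mathcal A)]+\|\mathbb U^{X,1}_{\ell_1}\|+\|\mathbb U^{X,2}_{\ell_1}\|+|I|^\gamma\,\mathcal N[\mathbf U;\mathbf Q(I;X)]\big\},$$ where $c_X$ is an affine expression in $(\mathcal N[X;\mathcal C_1^\gamma(\mathcal A)],\mathcal N[\mathbf X;\mathcal C_2^{2\gamma}(\mathcal L(\mathcal A_\to))])$.
   Context: A non-commutative probability space $(\mathcal A,\varphi)$ is a von Neumann algebra $\mathcal A$ with a unital, weakly continuous, positive, faithful, tracial linear functional $\varphi$; $\|\cdot\|$ is the operator norm and $\mathcal A_*$ the real vector space of self-adjoint elements. Tensor products. On the algebraic tensor product: $(U_1\otimes U_2)\cdot(V_1\otimes V_2)=(U_1V_1)\otimes(V_2U_2)$, $(U\otimes V)^*=V^*\otimes U^*$. $\hat\otimes$ is the projective tensor product (completion for the projective norm). $(U_1\otimes U_2)\sharp X:=U_1XU_2$, $X\sharp(U_1\otimes U_2\otimes U_3):=(U_1XU_2)\otimes U_3$, $(U_1\otimes U_2\otimes U_3)\sharp X:=U_1\otimes(U_2XU_3)$, extended by continuity. Hölder spaces. For a Banach space $V$ and an interval $I\subset[0,T]$, $\mathcal C_k(I;V)$ ($k=1,2,3$) is the set of continuous $V$-valued maps on $\{(t_1,\dots,t_k)\in I^k:t_1\le\dots\le t_k\}$ vanishing when two of the times are equal. $(\delta g)_{st}:=g_t-g_s$ for $g\in\mathcal C_1$; $(\delta h)_{sut}:=h_{st}-h_{su}-h_{ut}$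 for $h\in\mathcal C_2$ (also denoted $\delta_2$). $\mathcal C_1^\alpha,\mathcal C_2^\alpha,\mathcal C_3^{(\alpha,\beta)}$ are the subspaces where respectively $\mathcal N[h;\mathcal C_1^\alpha]=\sup_{s<t}\|(\delta h)_{st}\|/|t-s|^\alpha$, $\mathcal N[h;\mathcal C_2^\alpha]=\sup_{s<t}\|h_{st}\|/|t-s|^\alpha$, $\mathcal N[h;\mathcal C_3^{(\alpha,\beta)}]=\sup_{s<u<t}\|h_{sut}\|/(|t-u|^\alpha|u-s|^\beta)$ are finite. $\mathcal N[h;\mathcal C_1^0]:=\sup_s\|h_s\|$. $\mathcal C_3^\mu$ consists of finite sums of elements of $\mathcal C_3^{(\alpha,\mu-\alpha)}$, $0\le\alpha\le\mu$. When $I$ is omitted, $I=[0,T]$. Sewing map: for $\mu>1$ and $h\in\mathcal C_3^\mu([0,T];V)\cap\mathrm{Im}\,\delta_2$, $\Lambda h$ is the unique element of $\mathcal C_2^\mu([0,T];V)$ with $\delta(\Lambda h)=h$. Filtration. $\mathcal A_t$ is the unital subalgebra of $\mathcal A$ generated by $\{X_s\}_{s\in[0,t]}$. A process (resp. biprocess, triprocess) $Y$ is adapted if $Y_t\in\mathcal A_t$ (resp. $\mathcal A_t\hat\otimes\mathcal A_t$, $\mathcal A_t^{\hat\otimes3}$) for all $t$. Product Lévy area. For a family $L=(L_{st})_{0\le s<t\le T}$ with $L_{st}\in\mathcal L(\mathcal A_s\hat\otimes\mathcal A_s,\mathcal A_t)$, $\mathcal N[L;\mathcal C_2^{2\gamma}(\mathcal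 L(\mathcal A_\to))]:=\sup_{s<t,\,0\ne U\in\mathcal A_s\hat\otimes\mathcal A_s}\|L_{st}[U]\|/(|t-s|^{2\gamma}\|U\|)$, and $\mathcal C_2^{2\gamma}(\mathcal L(\mathcal A_\to))$ is the set of $L$ for which this is finite. A product Lévy area above $X$ is $\mathbf X\in\mathcal C_2^{2\gamma}(\mathcal L(\mathcal A_\to))$ with $(\delta\mathbf X)_{sut}[\mathbf V]=(\mathbf V\sharp(\delta X)_{su})\cdot(\delta X)_{ut}$ for all $s<u<t$, $\mathbf V\in\mathcal A_s\hat\otimes\mathcal A_s$. $\mathbf X^*_{st}[\mathbf V]:=\mathbf X_{st}[\mathbf V^*]^*$. $[\mathbf X_{st}\times\mathrm{Id}]$ and $[\mathrm{Id}\times\mathbf X^*_{st}]$ are the continuous extensions of $U_1\otimes U_2\otimes U_3\mapsto\mathbf X_{st}[U_1\otimes U_2]\cdot U_3$ and $U_1\otimes U_2\otimes U_3\mapsto U_1\cdot\mathbf X^*_{st}[U_2\otimes U_3]$. Controlled processes (taken together with their decomposition). $\mathcal Q(X)$: adapted $Y\in\mathcal C_1^\gamma(\mathcal A)$ with $(\delta Y)_{st}=\mathbf Y^X_s\sharp(\delta X)_{st}+Y^\flat_{st}$, $\mathbf Y^X\in\mathcal C_1^\gamma(\mathcal A\hat\otimes\mathcal A)$ adapted, $Y^\flat\in\mathcal C_2^{2\gamma}(\mathcal A)$; $\mathcal N[Y;\mathcal Q(X)]:=\mathcal N[Y;\mathcal C_1^\gamma]+\mathcal N[\mathbf Y^X;\mathcal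 C_1^0]+\mathcal N[\mathbf Y^X;\mathcal C_1^\gamma]+\mathcal N[Y^\flat;\mathcal C_2^{2\gamma}]$. $\mathbf Q(X)$: adapted biprocesses $\mathbf U\in\mathcal C_1^\gamma(\mathcal A\hat\otimes\mathcal A)$ with $(\delta\mathbf U)_{st}=(\delta X)_{st}\sharp\mathbb U^{X,1}_s+\mathbb U^{X,2}_s\sharp(\delta X)_{st}+\mathbf U^\flat_{st}$, $\mathbb U^{X,i}\in\mathcal C_1^\gamma(\mathcal A^{\hat\otimes3})$ adapted triprocesses, $\mathbf U^\flat\in\mathcal C_2^{2\gamma}(\mathcal A\hat\otimes\mathcal A)$; $\mathcal N[\mathbf U;\mathbf Q(X)]:=\mathcal N[\mathbf U;\mathcal C_1^\gamma]+\sum_{i=1,2}\{\mathcal N[\mathbb U^{X,i};\mathcal C_1^0]+\mathcal N[\mathbb U^{X,i};\mathcal C_1^\gamma]\}+\mathcal N[\mathbf U^\flat;\mathcal C_2^{2\gamma}]$. $\mathcal N[\cdot;\mathcal Q(I;X)]$, $\mathcal N[\cdot;\mathbf Q(I;X)]$ are the same quantities with all suprema restricted to $I$; $|I|$ is the length of $I$. The process $Z$ of (iii), (iv) is regarded as an element of $\mathcal Q(X)$ through the decomposition with $\mathbf Z^X=\mathbf U$.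
   Formalization: A_t is taken as the von Neumann subalgebra generated by X_s, s ≤ t; in (iii) Z−A lies in Q(X), and Z itself does when A lies in A_0 (otherwise Z is not adapted); in (ii) X' is assumed Lebesgue (Bochner) integrable on [0,T]. *)

(* Defs.v *)
From HB Require Import structures.
From mathcomp Require Import all_boot all_order all_algebra.
From mathcomp Require Import complex.
From mathcomp Require Import all_classical all_reals all_analysis.

Set Implicit Arguments.
Unset Strict Implicit.
Unset Printing Implicit Defensive.

Import Order.TTheory GRing.Theory Num.Theory.
Import numFieldTopology.Exports numFieldNormedType.Exports.

Local Open Scope classical_set_scope.
Local Open Scope complex_scope.
Local Open Scope ring_scope.

(* In a normed space over R[i] the norm is an element of R[i]; [nrm] is its   *)
(* real value.                                                                *)
Definition nrm (R : realType) (V : normedModType R[i]) (x : V) : R :=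
  complex.Re `|x|.

(** * Non-commutative probability spaces *)

Record hilbertSpace (R : realType) := HilbertSpace {
  hil_sort :> completeNormedModType R[i] ;
  hdot : hil_sort -> hil_sort -> R[i] ;
  hdot_linear : forall (k : R[i]) x y z,
    hdot (k *: x + y) z = k * hdot x z + hdot y z ;
  hdot_conj : forall x y, hdot y x = (hdot x y)^* ;
  hdot_norm : forall x, hdot x x = `|x| ^+ 2 }.

(* [T] lies in the closure of [S] for the weak operator topology *)
Definition wot_adherent (R : realType) (H : hilbertSpace R)
    (S : set (H -> H)) (T : H -> H) : Prop :=
  forall (n : nat) (xi eta : 'I_n -> H) (e : R), 0 < e ->
    exists2 U, S U &
      forall i, `|hdot (T (xi i)) (eta i) - hdot (U (xi i)) (eta i)| < e%:C.

(* A von Neumann algebra acting on a Hilbert space H: [vn_act] identifies the *)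
(* Banach space [vn_sort] with a unital *-subalgebra of B(H) that is closed   *)
(* for the weak operator topology; the norm, product, unit and involution are *)
(* those of B(H). The axioms of *-algebras, submultiplicativity of the norm   *)
(* and the C*-identity follow, because [vn_act] is isometric.                 *)
Record vonNeumannAlgebra (R : realType) := VonNeumannAlgebra {
  vn_sort :> completeNormedModType R[i] ;
  vn_one : vn_sort ;
  vn_mul : vn_sort -> vn_sort -> vn_sort ;
  vn_star : vn_sort -> vn_sort ;
  vn_hil : hilbertSpace R ;
  vn_act : vn_sort -> vn_hil -> vn_hil ;
  vn_act_linear : forall a, linear (vn_act a) ;
  vn_actD : forall (k : R[i]) a b x,
    vn_act (k *: a + b) x = k *: vn_act a x + vn_act b x ;
  vn_act1 : forall x, vn_act vn_one x = x ;
  vn_actM : forall a b x, vn_act (vn_mul a b) x = vn_act a (vn_act b x) ;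
  vn_adjoint : forall a x y,
    hdot (vn_act a x) y = hdot x (vn_act (vn_star a) y) ;
  vn_opnorm_le : forall a x, `|vn_act a x| <= `|a| * `|x| ;
  vn_opnorm_least : forall a (c : R[i]), 0 <= c ->
    (forall x, `|vn_act a x| <= c * `|x|) -> `|a| <= c ;
  vn_wot_closed : forall T : vn_hil -> vn_hil, linear T -> continuous T ->
    wot_adherent (range vn_act) T -> exists a, vn_act a = T }.

Arguments vn_one {R v}.
Arguments vn_mul {R v} a b.
Notation "a ** b" := (vn_mul a b) (at level 40, left associativity).
Arguments vn_star {R v} a.

(* Weak continuity of the state is continuity for the weak operator topology  *)
(* on the unit ball, i.e. continuity for the ultraweak topology (normality).  *)
Record ncProbSpace (R : realType) := NcProbSpace {
  nc_vn :> vonNeumannAlgebra R ;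
  nc_phi : nc_vn -> R[i] ;
  nc_phi_linear : forall (k : R[i]) a b,
    nc_phi (k *: a + b) = k * nc_phi a + nc_phi b ;
  nc_phi_unital : nc_phi vn_one = 1 ;
  nc_phi_positive : forall a, 0 <= nc_phi (vn_star a ** a) ;
  nc_phi_faithful : forall a, nc_phi (vn_star a ** a) = 0 -> a = 0 ;
  nc_phi_tracial : forall a b, nc_phi (a ** b) = nc_phi (b ** a) ;
  nc_phi_weakly_continuous : forall e : R, 0 < e ->
    exists (n : nat) (xi eta : 'I_n -> vn_hil nc_vn) (d : R), 0 < d /\
      forall a, `|a| <= 1 ->
        (forall i, `|hdot (vn_act a (xi i)) (eta i)| < d%:C) ->
        `|nc_phi a| < e%:C }.

Record von_neumann_subalgebra (R : realType) (A : vonNeumannAlgebra R)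
    (B : set A) : Prop := {
  vns_1 : B vn_one ;
  vns_linear : forall (k : R[i]) a b, B a -> B b -> B (k *: a + b) ;
  vns_M : forall a b, B a -> B b -> B (a ** b) ;
  vns_star : forall a, B a -> B (vn_star a) ;
  vns_closed : forall a,
    wot_adherent [set vn_act b | b in B] (vn_act a) -> B a }.

(* The algebra A_t; "generated" refers to von Neumann subalgebras. *)
Definition filtration (R : realType) (A : vonNeumannAlgebra R) (X : R -> A)
    (t : R) : set A :=
  [set a | forall B, von_neumann_subalgebra B ->
             (forall s, 0 <= s <= t -> B (X s)) -> B a].

(** * Projective tensor products of a subspace [B] with itself *)

Section Tensor2.
Variables (R : realType) (A : completeNormedModType R[i]) (B : set A).

Definition bilinear_on (G : lmodType R[i]) (b : A -> A -> G) : Prop :=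
  (forall (k : R[i]) x y v, B x -> B y -> B v ->
     b (k *: x + y) v = k *: b x v + b y v) /\
  (forall (k : R[i]) x y v, B x -> B y -> B v ->
     b v (k *: x + y) = k *: b v x + b v y).

Definition tsum2 (G : lmodType R[i]) (b : A -> A -> G) (s : seq (A * A)) : G :=
  \sum_(p <- s) b p.1 p.2.

Definition in_tensor2 (s : seq (A * A)) : Prop :=
  forall p, p \in s -> B p.1 /\ B p.2.

(* [s] and [s'], read as formal sums of pure tensors, represent the same      *)
(* element of the algebraic tensor product of [B] with itself.                *)
Definition tensor2_eq (s s' : seq (A * A)) : Prop :=
  forall (G : lmodType R[i]) (b : A -> A -> G), bilinear_on b ->
    tsum2 b s = tsum2 b s'.

Definition proj_norm2 (s : seq (A * A)) : R :=
  inf [set \sum_(p <- s') nrm p.1 * nrm p.2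
      | s' in [set s' | in_tensor2 s' /\ tensor2_eq s s']].

(* The completion of the algebraic tensor product for the projective norm: a  *)
(* Banach space containing it isometrically as a dense subspace. Only the     *)
(* values of [pure2] on [B] are relevant.                                     *)
Record tensor2 := Tensor2 {
  tensor2_sort :> completeNormedModType R[i] ;
  pure2 : A -> A -> tensor2_sort ;
  pure2_bilinear : bilinear_on pure2 ;
  pure2_norm : forall s, in_tensor2 s ->
    nrm (tsum2 pure2 s) = proj_norm2 s ;
  pure2_dense : forall (x : tensor2_sort) (e : R), 0 < e ->
    exists2 s, in_tensor2 s & nrm (x - tsum2 pure2 s) < e }.

(* The continuous linear extension of pure2 a b |-> b a b. *)
Definition ext2 (P : tensor2) (G : normedModType R[i]) (b : A -> A -> G) :
    P -> G :=
  xget (fun=> 0) [set f : P -> G | [/\ linear f, continuous f &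
    forall x y, B x -> B y -> f (pure2 P x y) = b x y]].

End Tensor2.

Section Tensor3.
Variables (R : realType) (A : completeNormedModType R[i]) (B : set A).

Definition trilinear_on (G : lmodType R[i]) (b : A -> A -> A -> G) : Prop :=
  [/\ forall (k : R[i]) x y v w, B x -> B y -> B v -> B w ->
        b (k *: x + y) v w = k *: b x v w + b y v w,
      forall (k : R[i]) x y v w, B x -> B y -> B v -> B w ->
        b v (k *: x + y) w = k *: b v x w + b v y w &
      forall (k : R[i]) x y v w, B x -> B y -> B v -> B w ->
        b v w (k *: x + y) = k *: b v w x + b v w y].

Definition tsum3 (G : lmodType R[i]) (b : A -> A -> A -> G)
    (s : seq (A * A * A)) : G :=
  \sum_(p <- s) b p.1.1 p.1.2 p.2.

Definition in_tensor3 (s : seq (A * A * A)) : Prop :=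
  forall p, p \in s -> [/\ B p.1.1, B p.1.2 & B p.2].

Definition tensor3_eq (s s' : seq (A * A * A)) : Prop :=
  forall (G : lmodType R[i]) (b : A -> A -> A -> G), trilinear_on b ->
    tsum3 b s = tsum3 b s'.

Definition proj_norm3 (s : seq (A * A * A)) : R :=
  inf [set \sum_(p <- s') nrm p.1.1 * nrm p.1.2 * nrm p.2
      | s' in [set s' | in_tensor3 s' /\ tensor3_eq s s']].

Record tensor3 := Tensor3 {
  tensor3_sort :> completeNormedModType R[i] ;
  pure3 : A -> A -> A -> tensor3_sort ;
  pure3_trilinear : trilinear_on pure3 ;
  pure3_norm : forall s, in_tensor3 s ->
    nrm (tsum3 pure3 s) = proj_norm3 s ;
  pure3_dense : forall (x : tensor3_sort) (e : R), 0 < e ->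
    exists2 s, in_tensor3 s & nrm (x - tsum3 pure3 s) < e }.

Definition ext3 (P : tensor3) (G : normedModType R[i]) (b : A -> A -> A -> G) :
    P -> G :=
  xget (fun=> 0) [set f : P -> G | [/\ linear f, continuous f &
    forall x y z, B x -> B y -> B z -> f (pure3 P x y z) = b x y z]].

End Tensor3.

(* The conjugate-linear continuous extension of U (x) V |-> V^* (x) U^*. *)
Definition star2 (R : realType) (A : vonNeumannAlgebra R) (B : set A)
    (P : tensor2 B) : P -> P :=
  xget (fun=> 0) [set f : P -> P | [/\
    forall (k : R[i]) x y, f (k *: x + y) = k^* *: f x + f y, continuous f &
    forall x y, B x -> B y ->
      f (pure2 P x y) = pure2 P (vn_star y) (vn_star x)]].

(** * Hoelder spaces *)

(* The quantities N[ . ], in [0, +oo], as functions of the (two- or           *)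
(* three-parameter) norms of the increments. The set {0} is added so that the *)
(* supremum over an empty family of nonnegative numbers is 0.                 *)

Definition norm0 (R : realType) (I : set R) (n : R -> R) : \bar R :=
  ereal_sup ([set 0%E] `|` [set (n s)%:E | s in I]).

Definition norm2 (R : realType) (I : set R) (a : R) (n : R -> R -> R) :
    \bar R :=
  ereal_sup ([set 0%E] `|`
    [set (n p.1 p.2 / (p.2 - p.1) `^ a)%:E
    | p in [set p : R * R | [/\ I p.1, I p.2 & p.1 < p.2]]]).

Definition norm3 (R : realType) (I : set R) (a b : R)
    (n : R -> R -> R -> R) : \bar R :=
  ereal_sup ([set 0%E] `|`
    [set (n p.1.1 p.1.2 p.2 /
          ((p.2 - p.1.2) `^ a * (p.1.2 - p.1.1) `^ b))%:E
    | p in [set p : R * R * R |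
             [/\ I p.1.1, I p.1.2, I p.2, p.1.1 < p.1.2 & p.1.2 < p.2]]]).

Section Holder.
Variables (R : realType) (V : completeNormedModType R[i]) (T : R).
Implicit Types (f : R -> V) (h : R -> R -> V) (k : R -> R -> R -> V).

Definition delta1 f (s t : R) : V := f t - f s.
Definition delta2 h (s u t : R) : V := h s t - h s u - h u t.

Definition simplex2 : set (R * R) :=
  [set p | [/\ 0 <= p.1, p.1 <= p.2 & p.2 <= T]].
Definition simplex3 : set (R * R * R) :=
  [set p | [/\ 0 <= p.1.1, p.1.1 <= p.1.2, p.1.2 <= p.2 & p.2 <= T]].

Definition C1 (a : R) f : Prop :=
  {within `[0, T], continuous f} /\
  (norm2 `[0%R, T] a (fun s t => nrm (delta1 f s t)) < +oo)%E.

Definition C2 (a : R) h : Prop :=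
  [/\ {within simplex2, continuous (fun p => h p.1 p.2)},
      forall t, 0 <= t <= T -> h t t = 0 &
      (norm2 `[0%R, T] a (fun s t => nrm (h s t)) < +oo)%E].

Definition C3ab (a b : R) k : Prop :=
  [/\ {within simplex3, continuous (fun p => k p.1.1 p.1.2 p.2)},
      forall s t, 0 <= s -> s <= t -> t <= T -> k s s t = 0 /\ k s t t = 0 &
      (norm3 `[0%R, T] a b (fun s u t => nrm (k s u t)) < +oo)%E].

Definition C3 (mu : R) k : Prop :=
  exists (n : nat) (a : 'I_n -> R) (ki : 'I_n -> R -> R -> R -> V),
    (forall i, 0 <= a i <= mu /\ C3ab (a i) (mu - a i) (ki i)) /\
    forall s u t, simplex3 (s, u, t) -> k s u t = \sum_(i < n) ki i s u t.

(* [g] = Lambda [k] *)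
Definition sewn k h : Prop :=
  exists2 mu, 1 < mu & [/\ C3 mu k, C2 mu h &
    forall s u t, simplex3 (s, u, t) -> delta2 h s u t = k s u t].

Definition Lambda k : R -> R -> V := xget (fun _ _ => 0) [set h | sewn k h].

End Holder.

(** * Bochner integral *)

Definition simple_fun (R : realType) (V : lmodType R[i]) (n : nat)
    (E : 'I_n -> set R) (c : 'I_n -> V) (u : R) : V :=
  \sum_(i < n) (\1_(E i) u)%:C *: c i.

(* [f] is Bochner integrable on [D] for the Lebesgue measure, with integral v *)
Definition is_integral (R : realType) (V : completeNormedModType R[i])
    (D : set R) (f : R -> V) (v : V) : Prop :=
  let mu := @lebesgue_measure R in
  exists (n : nat -> nat) (E : forall k, 'I_(n k) -> set R)
         (c : forall k, 'I_(n k) -> V),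
    let g k := simple_fun (E k) (c k) in
    [/\ forall k i, measurable (E k i) /\ E k i `<=` D,
        forall k i, (mu (E k i) < +oo)%E,
        {ae mu, forall u, D u -> g k u @[k --> \oo] --> f u},
        (\int[mu]_(u in D) (nrm (f u - g k u))%:E)%E @[k --> \oo] --> 0%E &
        \sum_(i < n k) (fine (mu (E k i)))%:C *: c k i @[k --> \oo] --> v].

(* [X'] is the derivative of [X] on [0, T], one-sided at the end points *)
Definition is_derivative (R : realType) (V : normedModType R[i]) (T : R)
    (X X' : R -> V) : Prop :=
  forall t, 0 <= t <= T ->
    (fun s => ((s - t)^-1)%:C *: (X s - X t)) @ within `[0, T] t^' --> X' t.

(** * Controlled processes and the rough integral *)

Section RoughIntegral.
Variables (R : realType) (A : vonNeumannAlgebra R) (T gamma : R) (X : R -> A).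

Notation A_ t := (filtration X t).

(* [P2 t] and [P3 t] are the second and third projective tensor powers of A_t, *)
(* so that U : forall t, P2 t is an adapted biprocess. The increments of U     *)
(* between s and t live in [P2 t] and are measured there. When A_t carries a   *)
(* faithful normal trace, the conditional expectation onto A_t makes the       *)
(* canonical map from [P2 t] to the tensor product of the whole algebra        *)
(* isometric, so that this is also the norm of the latter; same for [P3 t].    *)
Variables (P2 : forall t, tensor2 (A_ t)) (P3 : forall t, tensor3 (A_ t)).

Definition adapted (Y : R -> A) : Prop := forall t, 0 <= t <= T -> A_ t (Y t).

(* the canonical maps from the tensor powers of A_s to those of A_t, s <= t *)
Definition incl2 (s t : R) : P2 s -> P2 t := ext2 (pure2 (P2 t)).
Definition incl3 (s t : R) : P3 s -> P3 t := ext3 (pure3 (P3 t)).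

(* U # x *)
Definition sharp (s : R) (U : P2 s) (x : A) : A :=
  ext2 (fun a b => a ** x ** b) U.
(* x # U and U # x for x in A_t and U in the third tensor power of A_s *)
Definition lsharp (s t : R) (x : A) (U : P3 s) : P2 t :=
  ext3 (fun a b c => pure2 (P2 t) (a ** x ** b) c) U.
Definition rsharp (s t : R) (U : P3 s) (x : A) : P2 t :=
  ext3 (fun a b c => pure2 (P2 t) a (b ** x ** c)) U.

Definition holder_path : Prop :=
  (forall t, 0 <= t <= T -> vn_star (X t) = X t) /\ C1 T gamma X.

Definition levy_norm (L : forall s t : R, P2 s -> A) : \bar R :=
  ereal_sup ([set 0%E] `|` [set x | exists (s t : R) (U : P2 s),
    [/\ 0 <= s, s < t, t <= T, U != 0 &
        x = (nrm (L s t U) / ((t - s) `^ (2 * gamma) * nrm U))%:E]]).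

(* [L] is extended by 0 to the diagonal s = t. *)
Record product_levy_area (L : forall s t : R, P2 s -> A) : Prop := {
  levy_diag : forall s U, L s s U = 0 ;
  levy_linear : forall s t, 0 <= s -> s < t -> t <= T -> linear (L s t) ;
  levy_continuous : forall s t, 0 <= s -> s < t -> t <= T ->
    continuous (L s t) ;
  levy_adapted : forall s t U, 0 <= s -> s < t -> t <= T -> A_ t (L s t U) ;
  levy_finite : (levy_norm L < +oo)%E ;
  levy_delta : forall s u t (U : P2 s), 0 <= s -> s < u -> u < t -> t <= T ->
    L s t U - L s u U - L u t (incl2 u U) =
    sharp U (delta1 X s u) ** delta1 X u t }.

Section Area.
Variable L : forall s t : R, P2 s -> A.
Arguments L : clear implicits.

Definition levy_star (s t : R) (U : P2 s) : A :=
  vn_star (L s t (star2 U)).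

(* [L_st x Id] and [Id x L^*_st] *)
Definition levy_id (s t : R) : P3 s -> A :=
  ext3 (fun a b c => L s t (pure2 (P2 s) a b) ** c).
Definition id_levy_star (s t : R) : P3 s -> A :=
  ext3 (fun a b c => a ** levy_star t (pure2 (P2 s) b c)).

Section Integral.
Variables (U : forall t, P2 t) (U1 U2 : forall t, P3 t).

Definition germ (s t : R) : A :=
  sharp (U s) (delta1 X s t) + levy_id t (U1 s) + id_levy_star t (U2 s).

Definition rough_integral (s t : R) : A :=
  germ s t - Lambda T (delta2 germ) s t.

End Integral.
End Area.

Section Biprocess.
Variables (U : forall t, P2 t) (U1 U2 : forall t, P3 t).

Definition deltaP2 (s t : R) : P2 t := U t - incl2 t (U s).
Definition deltaP3 (W : forall t, P3 t) (s t : R) : P3 t := W t - incl3 t (W s).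

Definition bi_remainder (s t : R) : P2 t :=
  deltaP2 s t - lsharp t (delta1 X s t) (U1 s) - rsharp t (U2 s) (delta1 X s t).

Definition bi_norm0 (I : set R) : \bar R := norm0 I (fun s => nrm (U s)).
Definition bi_norm (I : set R) : \bar R :=
  norm2 I gamma (fun s t => nrm (deltaP2 s t)).
Definition tri_norm0 (W : forall t, P3 t) (I : set R) : \bar R :=
  norm0 I (fun s => nrm (W s)).
Definition tri_norm (W : forall t, P3 t) (I : set R) : \bar R :=
  norm2 I gamma (fun s t => nrm (deltaP3 W s t)).

(* N[U; Q(I; X)] for biprocesses *)
Definition bicontrolled_norm (I : set R) : \bar R :=
  (bi_norm I + (tri_norm0 U1 I + tri_norm U1 I)
             + (tri_norm0 U2 I + tri_norm U2 I)
             + norm2 I (2 * gamma)%R (fun s t => nrm (bi_remainder s t)))%E.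

(* U, with the decomposition given by U1 and U2, belongs to Q(X); the         *)
(* continuity of U, U1, U2 and of the remainder [bi_remainder] follows from the     *)
(* finiteness of the norm, as gamma > 0.                                      *)
Definition bicontrolled : Prop := (bicontrolled_norm `[0%R, T] < +oo)%E.

End Biprocess.

Section Process.
Variables (Y : R -> A) (YX : forall t, P2 t).

Definition remainder (s t : R) : A := delta1 Y s t - sharp (YX s) (delta1 X s t).

(* N[Y; Q(I; X)] *)
Definition controlled_norm (I : set R) : \bar R :=
  (norm2 I gamma (fun s t => nrm (delta1 Y s t)) + bi_norm0 YX I + bi_norm YX I
   + norm2 I (2 * gamma)%R (fun s t => nrm (remainder s t)))%E.

(* Y, with the decomposition given by YX, belongs to Q(X) *)
Definition controlled : Prop :=
  [/\ adapted Y, C1 T gamma Y, C2 T (2 * gamma) remainder &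
      (controlled_norm `[0%R, T] < +oo)%E].

End Process.

End RoughIntegral.

(* Main.v *)
From HB Require Import structures.
Require Import Defs.
From mathcomp Require Import all_boot all_order all_algebra.
From mathcomp Require Import complex.
From mathcomp Require Import all_classical all_reals all_analysis.
From mathcomp Require Import measurable_realfun ring lra.

(* For the germ M, Chen's relation for X and the decomposition of U give
     delta M_{sut} = - U^flat_{su} # (delta X)_{ut} - [X_{ut} x Id](delta U1)_{su}
                     - [Id x X^*_{ut}](delta U2)_{su},
   where the second-order terms cancel; this is bounded by a constant times
   (t-u)^gamma (u-s)^(2 gamma) + (t-u)^(2 gamma) (u-s)^gamma, hence has regularity
   3 gamma > 1, and sewing M along dyadic partitions produces Z with
   |delta Z - M| = O(|t-s|^(3 gamma)). The constant on [l1, l2] only involves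
   N[U; Q([l1, l2]; X)], which gives (iv). All maps on the tensor products are
   extended by density from pure tensors, with the bound for the projective norm.
   For (ii), only pointwise differentiability of X is available, so the inequality
   |X_b - X_a - int_a^b G| <= int_a^b |X' - G| for step functions G is obtained from
   a locally dominating majorant of |X' - G| (Vitali-Caratheodory). It allows one to
   compare, on the cells of a mesh, delta Z with the integral of U_q # G: the terms
   of M carrying U1 and U2 are negligible since |X_{st}[V]| is at most
   |V| sup |delta X| int_s^t |X'|. *)

Set Implicit Arguments.
Unset Strict Implicit.
Unset Printing Implicit Defensive.

Import Order.TTheory GRing.Theory Num.Theory.
Import numFieldTopology.Exports numFieldNormedType.Exports.

Local Open Scope classical_set_scope.
Local Open Scope complex_scope.
Local Open Scope ring_scope.

(** * Real-valued norms *)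

(** [ext2], [ext3], [star2] and [Lambda] are chosen elements of sets: nothing is known about them
    until the set is shown to be inhabited and, where a bound is wanted, to have a single element.
    The extension lemmas and [sewn_unique] serve this purpose. An increment of an adapted biprocess
    lives in the tensor power at the later time, so identities between two times pass through the
    contractions [incl2] and [incl3]. Two demands go beyond the estimate of delta M. Membership in
    [C3] asks for continuous pieces, each with its own pair of exponents, while the estimate is
    symmetric in the two exponents; a bounded weight performs the splitting. And (iv) must hold on
    every interval with the norm of that interval alone: Z is built once on [0, T], and its
    increments are compared with sums over partitions that stay inside the interval. In (ii), the
    bound of the area by a multiple of (t-s)^(2 gamma) does not sum to zero over a mesh when gamma
    <= 1/2; the integral form of the area gives a bound with an additive factor instead. *)

Section Nrm.
Context {R : realType} {V : normedModType R[i]}.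
Implicit Types (x y : V).

Lemma nrmE x : `|x| = (nrm x)%:C.
Proof.
rewrite /nrm; have : (0 : R[i]) <= `|x| by apply: normr_ge0.
by case: `|x| => a b; rewrite lecE /= => /andP[/eqP-> _].
Qed.

Lemma nrm_ge0 x : 0 <= nrm x.
Proof. by rewrite -lecR -nrmE; exact: normr_ge0. Qed.

Lemma nrm0 : nrm (0 : V) = 0.
Proof. by apply: complexI; rewrite -nrmE normr0. Qed.

Lemma nrm_eq0 x : (nrm x == 0) = (x == 0).
Proof. by rewrite -(normr_eq0 x) nrmE -(inj_eq (@complexI R)). Qed.

Lemma nrmN x : nrm (- x) = nrm x.
Proof. by rewrite /nrm normrN. Qed.

Lemma nrmB x y : nrm (x - y) = nrm (y - x).
Proof. by rewrite /nrm distrC. Qed.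

Lemma nrmD x y : nrm (x + y) <= nrm x + nrm y.
Proof. by rewrite -lecR raddfD/= -!nrmE ler_normD. Qed.

Lemma nrmBD x y : nrm (x - y) <= nrm x + nrm y.
Proof. by rewrite -(nrmN y) nrmD. Qed.

Lemma nrm_triB x y z : nrm (x - z) <= nrm (x - y) + nrm (y - z).
Proof. by rewrite (le_trans _ (nrmD _ _))// addrA subrK. Qed.

Lemma nrmZ (k : R[i]) x : nrm (k *: x) = complex.Re `|k| * nrm x.
Proof.
apply: complexI; rewrite -nrmE normrZ nrmE rmorphM/=.
by congr (_ * _); rewrite (nrmE (k : R[i]^o)).
Qed.

Lemma nrmZr (k : R) x : nrm (k%:C *: x) = `|k| * nrm x.
Proof. by rewrite nrmZ normc_def/= expr0n/= addr0 sqrtr_sqr. Qed.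

Lemma nrm_sum (I : Type) (r : seq I) (P : pred I) (F : I -> V) :
  nrm (\sum_(i <- r | P i) F i) <= \sum_(i <- r | P i) nrm (F i).
Proof.
elim/big_ind2 : _ => [|x1 x2 y1 y2 h1 h2|//]; first by rewrite nrm0.
by rewrite (le_trans (nrmD _ _))// lerD.
Qed.

Lemma nrm_le0 x : nrm x <= 0 -> x = 0.
Proof. by move=> h; apply/eqP; rewrite -nrm_eq0 eq_le h nrm_ge0. Qed.

Lemma nbhs_nrmP x (P : set V) :
  nbhs x P <-> exists2 e : R, 0 < e & forall y, nrm (x - y) < e -> P y.
Proof.
split=> [/nbhs_ballP[e /= e0 h]|[e e0 h]].
  (* Radii of balls are elements of [R[i]]; being positive in its partial order forces the imaginary
     part to vanish. *)
  have ee : e = (complex.Re e)%:C.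
    by move: e0; rewrite ltcE /= => /andP[/eqP/esym ie _]; case: e ie {h} => a b /= <-.
  exists (complex.Re e); first by move: e0; rewrite ee ltcR.
  by move=> y hy; apply: h; rewrite -ball_normE /ball_ /= nrmE ee ltcR.
apply/nbhs_ballP; exists e%:C; first by rewrite /= ltcR.
by move=> y; rewrite -ball_normE /ball_ /= nrmE ltcR; exact: h.
Qed.

Lemma cvg_nrmP (T : Type) (F : set_system T) (f : T -> V) x : Filter F ->
  f @ F --> x <-> forall e : R, 0 < e -> \forall t \near F, nrm (x - f t) < e.
Proof.
move=> FF; split=> [h e e0|h].
  by apply: (h [set y | nrm (x - y) < e]); apply/nbhs_nrmP; exists e.
move=> P /nbhs_nrmP[e e0 hP]; have := h e e0.
by apply: filterS => t; exact: hP.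
Qed.

Lemma cvg_nrm0P (T : Type) (F : set_system T) (f : T -> V) x : Filter F ->
  f @ F --> x <-> (fun t => nrm (x - f t)) @ F --> (0 : R).
Proof.
move=> FF; split=> h.
  apply/cvgrPdist_lt => e e0; have /cvg_nrmP/(_ e e0) := h.
  by apply: filterS => t; rewrite sub0r normrN ger0_norm ?nrm_ge0.
apply/cvg_nrmP => e e0; move/cvgrPdist_lt: h => /(_ e e0).
by apply: filterS => t; rewrite sub0r normrN ger0_norm ?nrm_ge0.
Qed.

Lemma cvg_nrm_seqP (u : nat -> V) x :
  u @ \oo --> x <-> forall e : R, 0 < e -> exists N, forall n, (N <= n)%N -> nrm (x - u n) < e.
Proof.
split=> [/cvg_nrmP h e e0|h].
  by have [N _ hN] := h e e0; exists N.
by apply/cvg_nrmP => e e0; have [N hN] := h e e0; exists N.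
Qed.

Lemma cvg_nrm_unique (u : nat -> V) x y :
  u @ \oo --> x -> u @ \oo --> y -> x = y.
Proof. by move=> ux uy; apply: cvg_unique ux uy; exact: norm_hausdorff. Qed.

End Nrm.

Lemma continuous_nrmP (R : realType) (V W : normedModType R[i]) (f : V -> W) :
  continuous f <-> forall x (e : R), 0 < e ->
    exists2 d : R, 0 < d & forall y, nrm (x - y) < d -> nrm (f x - f y) < e.
Proof.
split=> [cf x e e0|h x].
  by have /cvg_nrmP/(_ e e0)/nbhs_nrmP[d d0 hd] := cf x; exists d.
by apply/cvg_nrmP => e e0; apply/nbhs_nrmP; exact: h.
Qed.

(** Only additivity is asked for, so that the conjugate-linear map [star2] is covered together with
    the linear ones. *)
Lemma bounded_additive_continuous (R : realType) (V W : normedModType R[i])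
  (f : V -> W) (c : R) : (forall x y, f (x - y) = f x - f y) ->
  (forall x, nrm (f x) <= c * nrm x) -> continuous f.
Proof.
move=> fB fc; apply/continuous_nrmP => x e e0.
have c1 : 0 < `|c| + 1 by rewrite ltr_pwDr.
exists (e / (`|c| + 1)); first by rewrite divr_gt0.
move=> y; rewrite -fB ltr_pdivlMr// => h.
rewrite (le_lt_trans _ h)// (le_trans (fc _))// mulrC ler_wpM2l ?nrm_ge0//.
by rewrite (le_trans (ler_norm _))// lerDl.
Qed.

Lemma nrm_cauchy_cvg (R : realType) (V : completeNormedModType R[i])
  (u : nat -> V) :
  (forall e : R, 0 < e -> exists N, forall m n, (N <= m)%N -> (N <= n)%N ->
     nrm (u m - u n) < e) -> exists x : V, u @ \oo --> x.
Proof.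
move=> h; suff /cvg_ex[x ux] : cvgn u by exists x.
apply/cauchy_cvgP/cauchy_ballP => e e0.
have ee : e = (complex.Re e)%:C.
  by move: e0; rewrite ltcE /= => /andP[/eqP/esym ie _]; case: e ie => a b /= <-.
have re0 : 0 < complex.Re e by move: e0; rewrite ee ltcR.
have [N hN] := h _ re0.
exists (u @` [set n | (N <= n)%N], u @` [set n | (N <= n)%N]) => /=.
  by split; exists N => // n /= Nn; exists n.
move=> [_ _] [[m /= Nm <-] [n /= Nn <-]] /=.
by rewrite -ball_normE /ball_ /= nrmE ee ltcR; exact: hN.
Qed.

(** * Von Neumann algebras *)

Section Hilbert.
Context {R : realType} (H : hilbertSpace R).
Implicit Types (x y z : H) (k : R[i]).

Lemma hdotDr k x y z : hdot z (k *: x + y) = k^* * hdot z x + hdot z y.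
Proof. by rewrite hdot_conj hdot_linear rmorphD rmorphM /= -!hdot_conj. Qed.

Lemma hdot0l z : hdot (0 : H) z = 0.
Proof.
have := hdot_linear (-1) (0 : H) 0 z.
by rewrite scaler0 addr0 mulN1r addNr.
Qed.

Lemma hdot0r z : hdot z (0 : H) = 0.
Proof. by rewrite hdot_conj hdot0l rmorph0. Qed.

Lemma hdotBl x y z : hdot (x - y) z = hdot x z - hdot y z.
Proof. by rewrite -scaleN1r addrC hdot_linear mulN1r addrC. Qed.

Lemma hdot_CS x y : `|hdot x y| <= `|x| * `|y|.
Proof.
have [->|y0] := eqVneq y 0; first by rewrite hdot0r !normr0 mulr0.
set c := hdot x y; set n := `|y| ^+ 2.
have n0 : 0 < n by rewrite exprn_gt0// normr_gt0.
have cc : c * c^* = `|c| ^+ 2 by rewrite normCK.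
have nJ : n^* = n.
  by rewrite /n -hdot_norm -hdot_conj.
(* The square of |y|^2 x - <x,y> y, expanded. The summand 0 gives the inner vector the shape
   [k *: x + y] on which [hdot_linear] and [hdotDr] rewrite. *)
have : 0 <= `|n *: x + ((- c) *: y + 0)| ^+ 2 by rewrite exprn_ge0.
rewrite -hdot_norm !(hdot_linear, hdotDr, hdot0l, hdot0r) hdot_norm nJ.
rewrite !(mulr0, addr0) -/c (hdot_conj x y) -/c hdot_norm -/n rmorphN /=.
have -> : n * (n * `|x| ^+ 2 + - c^* * c) + - c * (n * c^* + - c^* * n)
   = n * (n * `|x| ^+ 2 - c * c^*) by ring.
rewrite pmulr_rge0// subr_ge0 cc /n => h.
rewrite -(ler_pXn2r (n := 2))// ?nnegrE ?mulr_ge0//.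
by rewrite exprMn mulrC.
Qed.

Lemma hdot_inj x y : (forall z, hdot x z = hdot y z) -> x = y.
Proof.
move=> h; apply/eqP; rewrite -subr_eq0 -normr_eq0 -sqrf_eq0.
by rewrite -hdot_norm hdotBl h subrr.
Qed.

End Hilbert.

Section VonNeumann.
Context {R : realType} {A : vonNeumannAlgebra R}.
Implicit Types (a b c : A) (k : R[i]).

(** [vn_opnorm_least] with the constant 0. All algebraic identities of the algebra are then checked
    on vectors, those with the involution on inner products. *)
Lemma vn_act_inj a b : (forall x, vn_act a x = vn_act b x) -> a = b.
Proof.
move=> h; apply/eqP; rewrite -subr_eq0 -normr_eq0 eq_le normr_ge0 andbT.
apply: vn_opnorm_least => // x.
by rewrite -scaleN1r addrC vn_actD h scaleN1r addNr normr0 mul0r.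
Qed.

Lemma vn_mulA a b c : a ** (b ** c) = a ** b ** c.
Proof. by apply: vn_act_inj => x; rewrite !vn_actM. Qed.

Lemma vn_mulDl k a b c : (k *: a + b) ** c = k *: (a ** c) + b ** c.
Proof. by apply: vn_act_inj => x; rewrite !(vn_actM, vn_actD). Qed.

Lemma vn_mulDr k a b c : c ** (k *: a + b) = k *: (c ** a) + c ** b.
Proof.
by apply: vn_act_inj => x; rewrite !(vn_actM, vn_actD) vn_act_linear.
Qed.

Lemma vn_actJ a x y : hdot (vn_act (vn_star a) x) y = hdot x (vn_act a y).
Proof. by rewrite hdot_conj -vn_adjoint -hdot_conj. Qed.

Lemma vn_starK a : vn_star (vn_star a) = a.
Proof.
apply: vn_act_inj => x; apply: hdot_inj => y.
by rewrite vn_actJ vn_adjoint.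
Qed.

Lemma vn_starD k a b : vn_star (k *: a + b) = k^* *: vn_star a + vn_star b.
Proof.
apply: vn_act_inj => x; apply: hdot_inj => y.
by rewrite vn_actJ !vn_actD hdot_linear hdotDr !vn_actJ.
Qed.

Lemma vn_starM a b : vn_star (a ** b) = vn_star b ** vn_star a.
Proof.
apply: vn_act_inj => x; apply: hdot_inj => y.
by rewrite vn_actJ !vn_actM !vn_actJ.
Qed.

Lemma nrm_mul a b : nrm (a ** b) <= nrm a * nrm b.
Proof.
rewrite -lecR -nrmE rmorphM /= -!nrmE.
apply: vn_opnorm_least => [|x]; first by rewrite mulr_ge0.
rewrite vn_actM (le_trans (vn_opnorm_le _ _))// -mulrA ler_wpM2l//.
exact: vn_opnorm_le.
Qed.

Lemma nrm_star a : nrm (vn_star a) = nrm a.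
Proof.
suff h b : nrm (vn_star b) <= nrm b by apply/le_anti; rewrite h -{1}(vn_starK a) h.
rewrite -lecR -!nrmE; apply: vn_opnorm_least => // x.
set y := vn_act _ _; have [->|y0] := eqVneq y 0; first by rewrite normr0 mulr_ge0.
have yp : 0 < `|y| by rewrite normr_gt0.
rewrite -(ler_pM2r yp) -expr2 -hdot_norm {2}/y -vn_adjoint.
(* This number equals |y|^2, hence is nonnegative and equal to its modulus; Cauchy-Schwarz bounds it
   by |b| |y| |x|, and one factor |y| cancels. *)
have -> : hdot (vn_act b y) x = `|hdot (vn_act b y) x|.
  by rewrite ger0_norm// vn_adjoint -/y hdot_norm exprn_ge0.
rewrite (le_trans (hdot_CS _ _))// mulrAC ler_wpM2r//.
exact: vn_opnorm_le.
Qed.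

Lemma vn_mul0l a : 0 ** a = 0.
Proof. by have := vn_mulDl (-1) 0 0 a; rewrite scaler0 addr0 scaleN1r addNr. Qed.

Lemma vn_mul0r a : a ** 0 = 0.
Proof. by have := vn_mulDr (-1) 0 0 a; rewrite scaler0 addr0 scaleN1r addNr. Qed.

Lemma vn_mulBl a b c : (a - b) ** c = a ** c - b ** c.
Proof. by rewrite -scaleN1r addrC vn_mulDl scaleN1r addrC. Qed.

Lemma vn_mulBr a b c : c ** (a - b) = c ** a - c ** b.
Proof. by rewrite -scaleN1r addrC vn_mulDr scaleN1r addrC. Qed.

Lemma vn_starB a b : vn_star (a - b) = vn_star a - vn_star b.
Proof.
by rewrite -scaleN1r addrC vn_starD rmorphN rmorph1 scaleN1r addrC.
Qed.

End VonNeumann.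

(** * The filtration, closed subspaces and von Neumann subalgebras *)

Section Filtration.
Context {R : realType} {A : vonNeumannAlgebra R} (X : R -> A).

Lemma filtration_subalgebra t : von_neumann_subalgebra (filtration X t).
Proof.
split=> [B hB _|k a b ha hb B hB hX|a b ha hb B hB hX|a ha B hB hX|a ha B hB hX].
- exact: vns_1.
- by apply: vns_linear => //; [exact: ha|exact: hb].
- by apply: vns_M => //; [exact: ha|exact: hb].
- by apply: vns_star => //; exact: ha.
- apply: (vns_closed hB) => n xi eta e e0; have [_ [b hb <-] h] := ha n xi eta e e0.
  by exists (vn_act b) => //; exists b => //; exact: hb.
Qed.

Lemma filtration_path t s : 0 <= s <= t -> filtration X t (X s).
Proof. by move=> h B _; exact. Qed.

Lemma filtration_le s t : s <= t -> filtration X s `<=` filtration X t.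
Proof.
move=> st a ha B hB hX; apply: ha => // r /andP[r0 rs].
by apply: hX; rewrite r0 (le_trans rs).
Qed.

End Filtration.

Definition lin_subspace (R : realType) (V : lmodType R[i]) (B : set V) : Prop :=
  B 0 /\ forall (k : R[i]) x y, B x -> B y -> B (k *: x + y).

(** Sequences are enough here, since elements of the completed tensor products are limits of
    sequences of finite sums. *)
Definition seq_closed (R : realType) (V : normedModType R[i]) (B : set V) : Prop :=
  forall (u : nat -> V) x, (forall n, B (u n)) -> u @ \oo --> x -> B x.

Section Subspace.
Context {R : realType} {V : lmodType R[i]} {B : set V} (hB : lin_subspace B).

Lemma lin_subspaceD x y : B x -> B y -> B (x + y).
Proof. by move=> hx hy; have := hB.2 1 x y hx hy; rewrite scale1r. Qed.

Lemma lin_subspaceN x : B x -> B (- x).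
Proof. by move=> hx; have := hB.2 (-1) x 0 hx hB.1; rewrite addr0 scaleN1r. Qed.

Lemma lin_subspaceB x y : B x -> B y -> B (x - y).
Proof. by move=> hx hy; exact: lin_subspaceD hx (lin_subspaceN hy). Qed.

Lemma lin_subspace_sum (I : eqType) (r : seq I) (P : pred I) (F : I -> V) :
  (forall i, i \in r -> P i -> B (F i)) -> B (\sum_(i <- r | P i) F i).
Proof.
move=> h; rewrite big_seq_cond; apply: (big_ind B); first exact: hB.1.
  exact: lin_subspaceD.
by move=> i /andP[]; exact: h.
Qed.

End Subspace.

Section Subalgebra.
Context {R : realType} {A : vonNeumannAlgebra R} {B : set A}.
Hypothesis hB : von_neumann_subalgebra B.

Lemma subalgebra_lin : lin_subspace B.
Proof.
split=> [|k x y]; last exact: vns_linear.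
have h1 := vns_1 hB; have := vns_linear hB (-1) h1 h1.
by rewrite scaleN1r addNr.
Qed.

Lemma subalgebra_closed : seq_closed B.
Proof.
move=> u x hu ux; apply: (vns_closed hB) => n xi eta e e0.
(* Norm distance e / c to [x] handles all the finitely many test pairs at once; the added 1 keeps
   [c] positive when there are none. *)
pose c := \sum_i nrm (xi i) * nrm (eta i) + 1.
have c0 : 0 < c by rewrite ltr_pwDr// sumr_ge0// => i _; rewrite mulr_ge0// nrm_ge0.
have /cvg_nrm_seqP/(_ (e / c))[|N hN] := ux; first by rewrite divr_gt0.
exists (vn_act (u N)); first by exists (u N).
move=> i; rewrite -hdotBl -[X in X - _]scale1r.
have -> : 1 *: vn_act x (xi i) - vn_act (u N) (xi i) = vn_act (x - u N) (xi i).
  by rewrite scale1r (addrC x) -(scaleN1r (u N)) vn_actD scaleN1r addrC.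
rewrite (le_lt_trans (hdot_CS _ _))//.
rewrite (@le_lt_trans _ _ ((nrm (x - u N))%:C * c%:C))//; last first.
  by rewrite -rmorphM ltcR -ltr_pdivlMr//; exact: hN.
rewrite (@le_trans _ _ ((nrm (x - u N))%:C * (nrm (xi i))%:C * (nrm (eta i))%:C))//.
  by rewrite -!nrmE ler_wpM2r// vn_opnorm_le.
rewrite -mulrA ler_wpM2l ?ler0c ?nrm_ge0// -rmorphM lecR /c.
rewrite (bigD1 i)//= -addrA lerDl addr_ge0// sumr_ge0// => j _.
by rewrite mulr_ge0// nrm_ge0.
Qed.

End Subalgebra.

(** * Bounded linear maps on projective tensor products *)

Definition bounded_linear (R : realType) (V W : normedModType R[i]) (f : V -> W)
    (K : R) : Prop :=
  linear f /\ forall x, nrm (f x) <= K * nrm x.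

Section BoundedLinear.
Context {R : realType} {V W : normedModType R[i]}.
Variables (f : V -> W) (K : R) (hf : bounded_linear f K).

Lemma blB x y : f (x - y) = f x - f y.
Proof. by rewrite -scaleN1r addrC hf.1 scaleN1r addrC. Qed.

Lemma bl0 : f 0 = 0.
Proof. by rewrite -(subrr 0) blB subrr. Qed.

Lemma bl_continuous : continuous f.
Proof. by apply: bounded_additive_continuous; [exact: blB|exact: hf.2]. Qed.

End BoundedLinear.

Lemma bounded_linearB (R : realType) (V W : normedModType R[i]) (f g : V -> W)
  (K K' : R) : bounded_linear f K -> bounded_linear g K' ->
  bounded_linear (fun x => f x - g x) (K + K').
Proof.
move=> [lf fK] [lg gK]; split=> [k x y|x].
  by rewrite lf lg scalerBr opprD addrACA.
by rewrite (le_trans (nrmBD _ _))// mulrDl lerD.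
Qed.

Lemma bounded_linear_comp (R : realType) (V W Z : normedModType R[i])
  (f : V -> W) (g : W -> Z) (K K' : R) : 0 <= K' ->
  bounded_linear f K -> bounded_linear g K' -> bounded_linear (g \o f) (K' * K).
Proof.
move=> K0 [lf fK] [lg gK]; split=> [k x y /=|x /=]; first by rewrite lf lg.
by rewrite (le_trans (gK _))// -mulrA ler_wpM2l.
Qed.

Section DenseExtension.
Context {R : realType} {V : normedModType R[i]} {W : completeNormedModType R[i]}.
Variables (sigma : R[i] -> R[i]) (Gr : V -> W -> Prop) (K : R).
Hypothesis sigmaN1 : sigma (-1) = -1.
Hypothesis K0 : 0 <= K.
Hypothesis Gr_lin : forall k x x' y y', Gr x y -> Gr x' y' ->
  Gr (k *: x + x') (sigma k *: y + y').
Hypothesis Gr_bound : forall x y, Gr x y -> nrm y <= K * nrm x.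
Hypothesis Gr_dense : forall x (e : R), 0 < e ->
  exists x' y', Gr x' y' /\ nrm (x - x') < e.

Let Gr_dist x x' y y' : Gr x y -> Gr x' y' -> nrm (y - y') <= K * nrm (x - x').
Proof.
move=> h h'; apply: Gr_bound; have := Gr_lin (-1) h' h.
by rewrite sigmaN1 !scaleN1r addrC (addrC _ y).
Qed.

(** The value at [x] is described by its distance to every pair of the graph. This single inequality
    later gives linearity, the bound and the agreement with the graph. *)
Let lim_ex x : exists y, forall x' y', Gr x' y' -> nrm (y - y') <= K * nrm (x - x').
Proof.
have /choice[u hu] n : exists p, Gr p.1 p.2 /\ nrm (x - p.1) < n.+1%:R^-1 :> R.
  by have [|x' [y' h]] := Gr_dense x (e := n.+1%:R^-1); [rewrite invr_gt0|exists (x', y')].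
have sm (e : R) : 0 < e -> exists N, forall n, (N <= n)%N -> K * nrm (x - (u n).1) < e.
  move=> e0; exists (Num.truncn ((K + 1) / e)) => n hn.
  rewrite (@le_lt_trans _ _ ((K + 1) * n.+1%:R^-1))//.
    by rewrite ler_pM ?nrm_ge0 ?lerDl// ltW//; case: (hu n).
  rewrite ltr_pdivrMr// mulrC -ltr_pdivrMr//.
  by rewrite (lt_le_trans (truncnS_gt _))// ler_nat ltnS.
have [e e0|y uy] := @nrm_cauchy_cvg _ _ (fun n => (u n).2).
  have [N hN] := sm _ (divr_gt0 e0 (ltr0Sn R 1)).
  exists N => m n Nm Nn.
  rewrite (le_lt_trans (Gr_dist (hu m).1 (hu n).1))//.
  rewrite (@le_lt_trans _ _ (K * (nrm (x - (u m).1) + nrm (x - (u n).1))))//.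
    by rewrite ler_wpM2l// (nrmB x) nrm_triB.
  by rewrite mulrDr (splitr e) ltrD// hN.
exists y => x' y' h; apply/ler_addgt0Pr => e e0.
have [N hN] := sm _ (divr_gt0 e0 (ltr0Sn R 1)).
have /cvg_nrm_seqP/(_ _ (divr_gt0 e0 (ltr0Sn R 1)))[N' hN'] := uy.
pose n := maxn N N'; have := hN n (leq_maxl _ _); have := hN' n (leq_maxr _ _).
have := Gr_dist (hu n).1 h.
have : K * nrm ((u n).1 - x') <= K * (nrm (x - (u n).1) + nrm (x - x')).
  by rewrite ler_wpM2l// (nrmB x) nrm_triB.
have := nrm_triB y (u n).2 y'.
by rewrite mulrDr; lra.
Qed.

(** The map to be extended is given as a relation because it is defined on formal sums; that it is
    single-valued follows from [Gr_bound] applied to differences. [sigma] is the identity or the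
    conjugation. *)
Lemma dense_extension : exists f : V -> W,
  [/\ forall k x y, f (k *: x + y) = sigma k *: f x + f y,
      forall x, nrm (f x) <= K * nrm x & forall x y, Gr x y -> f x = y].
Proof.
have [f hf] := choice lim_ex; exists f.
have fE x y : Gr x y -> f x = y.
  move=> h; apply/eqP; rewrite -subr_eq0 -nrm_eq0 eq_le nrm_ge0 andbT.
  by have := hf x x y h; rewrite subrr nrm0 mulr0.
split=> // [k x y|x].
  apply/eqP; rewrite -subr_eq0 -nrm_eq0 eq_le nrm_ge0 andbT.
  apply/ler_addgt0Pr => e e0; rewrite add0r.
  pose nk := complex.Re `|k|; pose ns := complex.Re `|sigma k|.
  have nk0 : 0 <= nk by exact: (@nrm_ge0 _ (R[i]^o)).
  have ns0 : 0 <= ns by exact: (@nrm_ge0 _ (R[i]^o)).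
  (* The errors add up to K (nk + ns + 2) d: k x and y on the source side, sigma k f x and f y on
     the target side. Using K + 1 avoids a division by zero. *)
  pose d := e / ((K + 1) * (nk + ns + 2)).
  have d0 : 0 < d by rewrite divr_gt0// mulr_gt0// ?ltr_wpDl// addr_ge0.
  have [x1 [x2 [hx dx]]] := Gr_dense x d0.
  have [y1 [y2 [hy dy]]] := Gr_dense y d0.
  rewrite (le_trans (nrm_triB _ (sigma k *: x2 + y2) _))//.
  have h1 : nrm (f (k *: x + y) - (sigma k *: x2 + y2)) <= K * (nk * d + d).
    rewrite (le_trans (hf _ _ _ (Gr_lin k hx hy)))// ler_wpM2l//.
    rewrite opprD addrACA -scalerBr (le_trans (nrmD _ _))// nrmZ.
    by rewrite lerD ?ler_wpM2l// ltW.
  have hfx : nrm (f x - x2) <= K * d by rewrite (le_trans (hf _ _ _ hx))// ler_wpM2l// ltW.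
  have hfy : nrm (f y - y2) <= K * d by rewrite (le_trans (hf _ _ _ hy))// ler_wpM2l// ltW.
  have h2 : nrm (sigma k *: x2 + y2 - (sigma k *: f x + f y)) <= ns * (K * d) + K * d.
    rewrite opprD addrACA -scalerBr (le_trans (nrmD _ _))// nrmZ.
    by rewrite lerD ?ler_wpM2l// nrmB.
  rewrite (le_trans (lerD h1 h2))//.
  have -> : e = (K + 1) * (nk + ns + 2) * d.
    rewrite /d mulrC divfK//; apply: lt0r_neq0.
    by rewrite mulr_gt0// ?ltr_wpDl// addr_ge0.
  rewrite -subr_ge0.
  have -> : (K + 1) * (nk + ns + 2) * d - (K * (nk * d + d) + (ns * (K * d) + K * d)) = (nk + ns + 2) * d by ring.
  by rewrite mulr_ge0// ?ltW// ltr_wpDl// addr_ge0.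
have [x1 [x2 [hx _]]] := Gr_dense 0 ltr01.
have h0 : Gr 0 0.
  by have := Gr_lin (-1) hx hx; rewrite sigmaN1 !scaleN1r !addNr.
by have := hf x _ _ h0; rewrite !subr0.
Qed.

End DenseExtension.

(* The complex conjugate of a module; it turns the conjugate-bilinear map
   defining [star2] into a bilinear one. *)
Definition conj_module (R : realType) (V : lmodType R[i]) : Type := V.

Section ConjModule.
Context {R : realType} (V : lmodType R[i]).
HB.instance Definition _ := GRing.Zmodule.on (conj_module V).
Let scale (k : R[i]) (x : conj_module V) : conj_module V := k^* *: (x : V).
Let scaleA a b x : scale a (scale b x) = scale (a * b) x.
Proof. by rewrite /scale scalerA rmorphM. Qed.
Let scale1 : left_id 1 scale.
Proof. by move=> x; rewrite /scale rmorph1 scale1r. Qed.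
Let scaleDr : right_distributive scale +%R.
Proof. by move=> a x y; exact: scalerDr. Qed.
Let scaleDl x : {morph scale^~ x : a b / a + b}.
Proof. by move=> a b; rewrite /scale rmorphD scalerDl. Qed.
HB.instance Definition _ := GRing.Zmodule_isLmodule.Build R[i] (conj_module V)
  scaleA scale1 scaleDr scaleDl.
End ConjModule.

Section Tensor2Theory.
Context {R : realType} {A : completeNormedModType R[i]} {B : set A}.
Hypothesis hB : lin_subspace B.
Variable P : tensor2 B.

(** The bound holds for every representation of the tensor, hence for the infimum. The target is a
    bare module with a subadditive function [nu], so that the conjugate module, which carries no
    norm, is allowed. *)
Lemma proj_norm2_bound (V : lmodType R[i]) (nu : V -> R) (b : A -> A -> V) (K : R) s :
  0 <= K -> bilinear_on B b ->
  (forall (r : seq (A * A)) F, nu (\sum_(p <- r) F p) <= \sum_(p <- r) nu (F p)) ->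
  (forall x y, B x -> B y -> nu (b x y) <= K * (nrm x * nrm y)) ->
  in_tensor2 B s -> nu (tsum2 b s) <= K * proj_norm2 B s.
Proof.
move=> K0 bb nuD nub hs; set S := [set s' | in_tensor2 B s' /\ tensor2_eq B s s'].
have hle s' : S s' -> nu (tsum2 b s) <= K * \sum_(p <- s') nrm p.1 * nrm p.2.
  move=> [hs' ss']; rewrite (ss' _ _ bb) (le_trans (nuD _ _))// mulr_sumr.
  rewrite big_seq [leRHS]big_seq.
  by apply: ler_sum => p ps; have [] := hs' _ ps; exact: nub.
have Ss : S s by split.
have [E|Kn0] := eqVneq K 0.
  by have := hle s Ss; rewrite E !mul0r.
rewrite mulrC -ler_pdivrMr ?lt_neqAle 1?eq_sym ?Kn0//.
apply: lb_le_inf; first by exists (\sum_(p <- s) nrm p.1 * nrm p.2); exists s.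
move=> _ [s' Ss' <-]; rewrite ler_pdivrMr ?lt_neqAle 1?eq_sym ?Kn0// mulrC.
exact: hle.
Qed.

Lemma nrm_pure2 x y : B x -> B y -> nrm (pure2 P x y) <= nrm x * nrm y.
Proof.
move=> hx hy; have hs : in_tensor2 B [:: (x, y)].
  by move=> p; rewrite inE => /eqP->.
have := pure2_norm P hs; rewrite /tsum2 big_seq1 /= => ->.
apply: inf_lbound; last by exists [:: (x, y)]; rewrite ?big_seq1.
exists 0 => _ [s' _ <-]; apply: sumr_ge0 => p _; by rewrite mulr_ge0 ?nrm_ge0.
Qed.

Lemma tsum2_lin (V : lmodType R[i]) (b : A -> A -> V) (sigma : R[i] -> R[i]) k s s' :
  (forall k x y, B x -> B y -> b (k *: x) y = sigma k *: b x y) ->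
  in_tensor2 B s ->
  tsum2 b ([seq (k *: p.1, p.2) | p <- s] ++ s') = sigma k *: tsum2 b s + tsum2 b s'.
Proof.
move=> hb hs; rewrite /tsum2 big_cat big_map /=; congr (_ + _).
rewrite scaler_sumr big_seq [RHS]big_seq.
by apply: eq_bigr => p /hs[]; exact: hb.
Qed.

Lemma in_tensor2_lin k s s' : in_tensor2 B s -> in_tensor2 B s' ->
  in_tensor2 B ([seq (k *: p.1, p.2) | p <- s] ++ s').
Proof.
move=> hs hs' p; rewrite mem_cat => /orP[/mapP[q /hs[q1 q2] ->]|/hs'//].
by split=> //=; rewrite -[_ *: _]addr0; apply: hB.2 => //; exact: hB.1.
Qed.

Lemma bilinear_onZ (V : lmodType R[i]) (b : A -> A -> V) k x y :
  bilinear_on B b -> B x -> B y -> b (k *: x) y = k *: b x y.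
Proof.
move=> [bl _] hx hy; have B0 := hB.1.
have b0 : b 0 y = 0.
  have := bl (-1) x x y hx hx hy; rewrite scaleN1r addNr => ->.
  by rewrite scaleN1r addNr.
by have := bl k x 0 y hx B0 hy; rewrite !addr0 b0 addr0.
Qed.

(** Sums of pure tensors are dense, so a closed linear condition has to be tested on pure tensors
    only. *)
Lemma tensor2_ind (Q : set P) : lin_subspace Q -> seq_closed Q ->
  (forall x y, B x -> B y -> Q (pure2 P x y)) -> forall u, Q u.
Proof.
move=> lQ cQ pQ u.
have /choice[s hs] n : exists s, in_tensor2 B s /\ nrm (u - tsum2 (pure2 P) s) < n.+1%:R^-1 :> R.
  by have [|s h1 h2] := pure2_dense u (e := n.+1%:R^-1); [rewrite invr_gt0|exists s].
apply: (cQ (fun n => tsum2 (pure2 P) (s n))) => [n|].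
  by apply: (lin_subspace_sum lQ) => p /(hs n).1[h1 h2] _; exact: pQ.
apply/cvg_nrm_seqP => e e0; exists (Num.truncn e^-1) => n hn.
rewrite (lt_trans (hs n).2)// invf_plt ?posrE//.
by rewrite (lt_le_trans (truncnS_gt _))// ler_nat ltnS.
Qed.

Lemma bounded_linear_in2 (W : normedModType R[i]) (f : P -> W) K (C : set W) :
  bounded_linear f K -> lin_subspace C -> seq_closed C ->
  (forall x y, B x -> B y -> C (f (pure2 P x y))) -> forall u, C (f u).
Proof.
move=> hf lC cC pC; apply: tensor2_ind => // [|u x hu ux].
  split=> [|k x y hx hy]; first by rewrite (bl0 hf); exact: lC.1.
  by rewrite hf.1; exact: lC.2.
apply: (cC (f \o u)) => //; apply: cvg_comp ux _; exact: (bl_continuous hf).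
Qed.

Lemma bounded_linear_eq2 (W : normedModType R[i]) (f g : P -> W) K K' :
  bounded_linear f K -> bounded_linear g K' ->
  (forall x y, B x -> B y -> f (pure2 P x y) = g (pure2 P x y)) -> f =1 g.
Proof.
move=> hf hg fg; apply: tensor2_ind => //.
  split=> [|k x y hx hy]; first by rewrite (bl0 hf) (bl0 hg).
  by rewrite hf.1 hg.1 hx hy.
move=> u x hu ux.
have fx : f \o u @ \oo --> f x by apply: cvg_comp ux _; exact: (bl_continuous hf).
have gx : g \o u @ \oo --> g x by apply: cvg_comp ux _; exact: (bl_continuous hg).
by apply: cvg_nrm_unique fx _; rewrite (_ : f \o u = g \o u)//; apply/funext.
Qed.

(** The estimate is assumed on formal sums rather than derived from bilinearity, because the map
    behind [star2] is only conjugate-bilinear into its target. *)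
Lemma tensor2_extension (W : completeNormedModType R[i]) (b : A -> A -> W) K sigma :
  0 <= K -> sigma (-1) = -1 ->
  (forall k x y, B x -> B y -> b (k *: x) y = sigma k *: b x y) ->
  (forall s, in_tensor2 B s -> nrm (tsum2 b s) <= K * proj_norm2 B s) ->
  exists f : P -> W,
  [/\ forall k x y, f (k *: x + y) = sigma k *: f x + f y,
      forall x, nrm (f x) <= K * nrm x &
      forall x y, B x -> B y -> f (pure2 P x y) = b x y].
Proof.
move=> K0 sN1 bZ bK.
pose Gr u w := exists s, [/\ in_tensor2 B s, u = tsum2 (pure2 P) s & w = tsum2 b s].
have [| |x e e0|f [fl fK fG]] := @dense_extension _ P W sigma Gr K sN1 K0.
- move=> k _ _ _ _ [s [hs -> ->]] [s' [hs' -> ->]].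
  exists ([seq (k *: p.1, p.2) | p <- s] ++ s'); split.
  + exact: in_tensor2_lin.
  + rewrite (tsum2_lin (sigma := id))// => *.
    by rewrite (bilinear_onZ _ (pure2_bilinear P)).
  + by rewrite (tsum2_lin (sigma := sigma)).
- by move=> _ _ [s [hs -> ->]]; rewrite (pure2_norm P hs); exact: bK.
- have [s hs h] := pure2_dense x e0.
  by exists (tsum2 (pure2 P) s), (tsum2 b s); split=> //; exists s.
exists f; split=> // x y hx hy; apply: fG; exists [:: (x, y)].
split; rewrite /tsum2 ?big_seq1//.
by move=> p; rewrite inE => /eqP->.
Qed.

(** The set defining [ext2] asks for continuity without a constant. The bound is obtained by
    constructing one bounded extension and showing, by density, that every element of the set equals
    it. *)
Lemma ext2P (W : completeNormedModType R[i]) (b : A -> A -> W) K : 0 <= K ->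
  bilinear_on B b ->
  (forall x y, B x -> B y -> nrm (b x y) <= K * (nrm x * nrm y)) ->
  bounded_linear (ext2 b : P -> W) K /\
  forall x y, B x -> B y -> ext2 b (pure2 P x y) = b x y.
Proof.
move=> K0 bb bK.
have [|s hs|f [fl fK fp]] := @tensor2_extension W b K id K0 erefl.
- by move=> *; exact: bilinear_onZ.
- by apply: (proj_norm2_bound K0 bb) => // r F; exact: nrm_sum.
have hf : bounded_linear f K by split.
pose S := [set f : P -> W | [/\ linear f, continuous f &
    forall x y, B x -> B y -> f (pure2 P x y) = b x y]].
have Sf : S f by split=> //; exact: (bl_continuous hf).
suff E g : S g -> g = f.
  by rewrite (E (ext2 b))//; exact: (xgetPex (fun=> 0) (ex_intro S f Sf)).
move=> [gl gc gp]; have gB x y : g (x - y) = g x - g y.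
  have -> : x - y = (-1) *: y + x by rewrite scaleN1r addrC.
  by rewrite gl scaleN1r addrC.
apply/funext; apply: tensor2_ind => /=.
- split=> [|k x y hx hy] /=; first by rewrite -(subrr 0) gB subrr subrr (bl0 hf).
  by rewrite gl hf.1 hx hy.
- move=> u x hu ux.
  have fx : f \o u @ \oo --> f x by apply: cvg_comp ux _; exact: (bl_continuous hf).
  have gx : g \o u @ \oo --> g x by apply: cvg_comp ux _; exact: gc.
  by apply: cvg_nrm_unique gx _; rewrite (_ : g \o u = f \o u)//; exact/funext.
- by move=> x y hx hy; rewrite gp// fp.
Qed.

End Tensor2Theory.

Lemma star2_pure (R : realType) (A : vonNeumannAlgebra R) (B : set A)
  (hB : von_neumann_subalgebra B) (P : tensor2 B) x y : B x -> B y ->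
  star2 (pure2 P x y) = pure2 P (vn_star y) (vn_star x).
Proof.
have lB := subalgebra_lin hB.
pose b x y := pure2 P (vn_star y) (vn_star x).
(* With values in the conjugate module the same map is bilinear, so it takes equal values on formal
   sums that represent the same tensor. *)
pose b' : A -> A -> conj_module P := b.
have [pl pr] := pure2_bilinear P.
have bb : bilinear_on B b'.
  split=> k u v w hu hv hw; rewrite /b' /b vn_starD.
    by rewrite pr//; exact: (vns_star hB).
  by rewrite pl//; exact: (vns_star hB).
have [||s hs|f [fl fK fp]] := @tensor2_extension R A B lB P P b 1 (fun k => k^*) ler01.
- by rewrite rmorphN rmorph1.
- move=> k u v hu hv; have := bilinear_onZ lB k bb hu hv; exact.
- apply: (@proj_norm2_bound R A B (conj_module P) (@nrm R P) b' 1 s ler01 bb) => //.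
    by move=> r F; exact: nrm_sum.
  move=> u v hu hv; rewrite mul1r mulrC -(nrm_star u) -(nrm_star v).
  by apply: nrm_pure2; exact: (vns_star hB).
move=> hx hy.
pose S := [set f : P -> P | [/\
    forall (k : R[i]) x y, f (k *: x + y) = k^* *: f x + f y, continuous f &
    forall x y, B x -> B y ->
      f (pure2 P x y) = pure2 P (vn_star y) (vn_star x)]].
have Sf : S f.
  split=> //; apply: bounded_additive_continuous fK => u v.
  have -> : u - v = (-1) *: v + u by rewrite scaleN1r addrC.
  by rewrite fl rmorphN rmorph1 scaleN1r addrC.
have [_ _] : S (@star2 R A B P) by exact: (xgetPex (fun=> 0) (ex_intro S f Sf)).
exact.
Qed.

Section Tensor3Theory.
Context {R : realType} {A : completeNormedModType R[i]} {B : set A}.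
Hypothesis hB : lin_subspace B.
Variable P : tensor3 B.

Lemma proj_norm3_bound (V : normedModType R[i]) (b : A -> A -> A -> V) (K : R) s :
  0 <= K -> trilinear_on B b ->
  (forall x y z, B x -> B y -> B z ->
     nrm (b x y z) <= K * (nrm x * nrm y * nrm z)) ->
  in_tensor3 B s -> nrm (tsum3 b s) <= K * proj_norm3 B s.
Proof.
move=> K0 bb bK hs; set S := [set s' | in_tensor3 B s' /\ tensor3_eq B s s'].
have hle s' : S s' ->
    nrm (tsum3 b s) <= K * \sum_(p <- s') nrm p.1.1 * nrm p.1.2 * nrm p.2.
  move=> [hs' ss']; rewrite (ss' _ _ bb) (le_trans (nrm_sum _ _ _))// mulr_sumr.
  rewrite big_seq [leRHS]big_seq.
  by apply: ler_sum => p ps; have [] := hs' _ ps; exact: bK.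
have Ss : S s by split.
have [E|Kn0] := eqVneq K 0.
  by have := hle s Ss; rewrite E !mul0r.
rewrite mulrC -ler_pdivrMr ?lt_neqAle 1?eq_sym ?Kn0//.
apply: lb_le_inf.
  by exists (\sum_(p <- s) nrm p.1.1 * nrm p.1.2 * nrm p.2); exists s.
move=> _ [s' Ss' <-]; rewrite ler_pdivrMr ?lt_neqAle 1?eq_sym ?Kn0// mulrC.
exact: hle.
Qed.

Lemma nrm_pure3 x y z : B x -> B y -> B z ->
  nrm (pure3 P x y z) <= nrm x * nrm y * nrm z.
Proof.
move=> hx hy hz; have hs : in_tensor3 B [:: (x, y, z)].
  by move=> p; rewrite inE => /eqP->.
have := pure3_norm P hs; rewrite /tsum3 big_seq1 /= => ->.
apply: inf_lbound; last by exists [:: (x, y, z)]; rewrite ?big_seq1.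
by exists 0 => _ [s' _ <-]; apply: sumr_ge0 => p _; rewrite !mulr_ge0 ?nrm_ge0.
Qed.

Lemma tsum3_lin (V : lmodType R[i]) (b : A -> A -> A -> V) k s s' :
  (forall k x y z, B x -> B y -> B z -> b (k *: x) y z = k *: b x y z) ->
  in_tensor3 B s ->
  tsum3 b ([seq (k *: p.1.1, p.1.2, p.2) | p <- s] ++ s') =
  k *: tsum3 b s + tsum3 b s'.
Proof.
move=> hb hs; rewrite /tsum3 big_cat big_map /=; congr (_ + _).
rewrite scaler_sumr big_seq [RHS]big_seq.
by apply: eq_bigr => p /hs[]; exact: hb.
Qed.

Lemma in_tensor3_lin k s s' : in_tensor3 B s -> in_tensor3 B s' ->
  in_tensor3 B ([seq (k *: p.1.1, p.1.2, p.2) | p <- s] ++ s').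
Proof.
move=> hs hs' p; rewrite mem_cat => /orP[/mapP[q /hs[q1 q2 q3] ->]|/hs'//].
by split=> //=; rewrite -[_ *: _]addr0; apply: hB.2 => //; exact: hB.1.
Qed.

Lemma trilinear_onZ (V : lmodType R[i]) (b : A -> A -> A -> V) k x y z :
  trilinear_on B b -> B x -> B y -> B z -> b (k *: x) y z = k *: b x y z.
Proof.
move=> [bl _ _] hx hy hz; have B0 := hB.1.
have b0 : b 0 y z = 0.
  have := bl (-1) x x y z hx hx hy hz; rewrite scaleN1r addNr => ->.
  by rewrite scaleN1r addNr.
by have := bl k x 0 y z hx B0 hy hz; rewrite !addr0 b0 addr0.
Qed.

Lemma tensor3_ind (Q : set P) : lin_subspace Q -> seq_closed Q ->
  (forall x y z, B x -> B y -> B z -> Q (pure3 P x y z)) -> forall u, Q u.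
Proof.
move=> lQ cQ pQ u.
have /choice[s hs] n : exists s, in_tensor3 B s /\ nrm (u - tsum3 (pure3 P) s) < n.+1%:R^-1 :> R.
  by have [|s h1 h2] := pure3_dense u (e := n.+1%:R^-1); [rewrite invr_gt0|exists s].
apply: (cQ (fun n => tsum3 (pure3 P) (s n))) => [n|].
  by apply: (lin_subspace_sum lQ) => p /(hs n).1[h1 h2 h3] _; exact: pQ.
apply/cvg_nrm_seqP => e e0; exists (Num.truncn e^-1) => n hn.
rewrite (lt_trans (hs n).2)// invf_plt ?posrE//.
by rewrite (lt_le_trans (truncnS_gt _))// ler_nat ltnS.
Qed.

Lemma bounded_linear_in3 (W : normedModType R[i]) (f : P -> W) K (C : set W) :
  bounded_linear f K -> lin_subspace C -> seq_closed C ->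
  (forall x y z, B x -> B y -> B z -> C (f (pure3 P x y z))) -> forall u, C (f u).
Proof.
move=> hf lC cC pC; apply: tensor3_ind => // [|u x hu ux].
  split=> [|k x y hx hy]; first by rewrite (bl0 hf); exact: lC.1.
  by rewrite hf.1; exact: lC.2.
apply: (cC (f \o u)) => //; apply: cvg_comp ux _; exact: (bl_continuous hf).
Qed.

Lemma bounded_linear_eq3 (W : normedModType R[i]) (f g : P -> W) K K' :
  bounded_linear f K -> bounded_linear g K' ->
  (forall x y z, B x -> B y -> B z -> f (pure3 P x y z) = g (pure3 P x y z)) ->
  f =1 g.
Proof.
move=> hf hg fg; apply: tensor3_ind => //.
  split=> [|k x y hx hy]; first by rewrite (bl0 hf) (bl0 hg).
  by rewrite hf.1 hg.1 hx hy.
move=> u x hu ux.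
have fx : f \o u @ \oo --> f x by apply: cvg_comp ux _; exact: (bl_continuous hf).
have gx : g \o u @ \oo --> g x by apply: cvg_comp ux _; exact: (bl_continuous hg).
by apply: cvg_nrm_unique fx _; rewrite (_ : f \o u = g \o u)//; apply/funext.
Qed.

Lemma ext3P (W : completeNormedModType R[i]) (b : A -> A -> A -> W) K : 0 <= K ->
  trilinear_on B b ->
  (forall x y z, B x -> B y -> B z ->
     nrm (b x y z) <= K * (nrm x * nrm y * nrm z)) ->
  bounded_linear (ext3 b : P -> W) K /\
  forall x y z, B x -> B y -> B z -> ext3 b (pure3 P x y z) = b x y z.
Proof.
move=> K0 bb bK.
pose Gr u w := exists s, [/\ in_tensor3 B s, u = tsum3 (pure3 P) s & w = tsum3 b s].
have [| |x e e0|f [fl fK fG]] := @dense_extension _ P W id Gr K erefl K0.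
- move=> k _ _ _ _ [s [hs -> ->]] [s' [hs' -> ->]].
  exists ([seq (k *: p.1.1, p.1.2, p.2) | p <- s] ++ s'); split.
  + exact: in_tensor3_lin.
  + rewrite tsum3_lin// => *.
    by rewrite (trilinear_onZ _ (pure3_trilinear P)).
  + by rewrite tsum3_lin// => *; rewrite (trilinear_onZ _ bb).
- move=> _ _ [s [hs -> ->]]; rewrite (pure3_norm P hs).
  exact: proj_norm3_bound.
- have [s hs h] := pure3_dense x e0.
  by exists (tsum3 (pure3 P) s), (tsum3 b s); split=> //; exists s.
have hf : bounded_linear f K by split.
pose S := [set f : P -> W | [/\ linear f, continuous f &
    forall x y z, B x -> B y -> B z -> f (pure3 P x y z) = b x y z]].
have fp x y z : B x -> B y -> B z -> f (pure3 P x y z) = b x y z.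
  move=> hx hy hz; apply: fG; exists [:: (x, y, z)].
  split; rewrite /tsum3 ?big_seq1//.
  by move=> p; rewrite inE => /eqP->.
have Sf : S f by split=> //; exact: (bl_continuous hf).
suff E g : S g -> g = f.
  by rewrite (E (ext3 b))//; exact: (xgetPex (fun=> 0) (ex_intro S f Sf)).
move=> [gl gc gp]; have gB x y : g (x - y) = g x - g y.
  have -> : x - y = (-1) *: y + x by rewrite scaleN1r addrC.
  by rewrite gl scaleN1r addrC.
apply/funext; apply: tensor3_ind => /=.
- split=> [|k x y hx hy] /=; first by rewrite -(subrr 0) gB subrr subrr (bl0 hf).
  by rewrite gl hf.1 hx hy.
- move=> u x hu ux.
  have fx : f \o u @ \oo --> f x by apply: cvg_comp ux _; exact: (bl_continuous hf).
  have gx : g \o u @ \oo --> g x by apply: cvg_comp ux _; exact: gc.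
  by apply: cvg_nrm_unique gx _; rewrite (_ : g \o u = f \o u)//; exact/funext.
- by move=> x y z hx hy hz; rewrite gp// fp.
Qed.

End Tensor3Theory.

(** * Actions of increments and of the area on adapted tensors *)

Section Operations.
Context {R : realType} {A : vonNeumannAlgebra R} {X : R -> A}.
Context {P2 : forall t, tensor2 (filtration X t)}.
Context {P3 : forall t, tensor3 (filtration X t)}.
Implicit Types (a b c x y : A) (r s t u : R).

Let hB t : von_neumann_subalgebra (filtration X t) := @filtration_subalgebra R A X t.
Let lB t : lin_subspace (filtration X t) := subalgebra_lin (hB t).

Lemma incl2P s t : s <= t -> bounded_linear (incl2 t : P2 s -> P2 t) 1 /\
  forall x y, filtration X s x -> filtration X s y ->
    incl2 t (pure2 (P2 s) x y) = pure2 (P2 t) x y.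
Proof.
move=> st; have st' := filtration_le (X := X) st.
apply: ext2P => // [|x y hx hy].
  have [h1 h2] := pure2_bilinear (P2 t).
  by split=> k x y v hx hy hv; [apply: h1|apply: h2]; exact: st'.
by rewrite mul1r; apply: nrm_pure2; exact: st'.
Qed.

Lemma incl3P s t : s <= t -> bounded_linear (incl3 t : P3 s -> P3 t) 1 /\
  forall x y z, filtration X s x -> filtration X s y -> filtration X s z ->
    incl3 t (pure3 (P3 s) x y z) = pure3 (P3 t) x y z.
Proof.
move=> st; have st' := filtration_le (X := X) st.
apply: ext3P => // [|x y z hx hy hz].
  have [h1 h2 h3] := pure3_trilinear (P3 t).
  by split=> k x y v w hx hy hv hw; [apply: h1|apply: h2|apply: h3]; exact: st'.
by rewrite mul1r; apply: nrm_pure3; exact: st'.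
Qed.

Lemma incl2_id t (U : P2 t) : incl2 t U = U.
Proof.
have [h1 h2] := incl2P (lexx t).
apply: (bounded_linear_eq2 (g := id) (K' := 1) h1) => //.
by split=> [k x y //|x]; rewrite mul1r.
Qed.

Lemma nrm_mul3 a x b : nrm (a ** x ** b) <= nrm x * (nrm a * nrm b).
Proof.
rewrite (le_trans (nrm_mul _ _))// mulrA ler_wpM2r ?nrm_ge0// mulrC.
exact: nrm_mul.
Qed.

Lemma sharpP s x : bounded_linear (fun U : P2 s => sharp U x) (nrm x) /\
  forall a b, filtration X s a -> filtration X s b ->
    sharp (pure2 (P2 s) a b) x = a ** x ** b.
Proof.
apply: ext2P => // [||a b _ _]; [exact: nrm_ge0| |exact: nrm_mul3].
by split=> k a b c _ _ _; rewrite ?vn_mulDl ?vn_mulDr.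
Qed.

Lemma nrm_sharp s (U : P2 s) x : nrm (sharp U x) <= nrm x * nrm U.
Proof. exact: (sharpP s x).1.2. Qed.

(** [sharp] is a separate extension for each [x], so linearity in [x] is not part of its
    construction; it is transported from pure tensors by density in [U]. *)
Lemma sharpDr s (U : P2 s) k x y : sharp U (k *: x + y) = k *: sharp U x + sharp U y.
Proof.
apply/eqP; rewrite -subr_eq0; apply/eqP; move: U.
apply: (tensor2_ind (Q := [set U | sharp U (k *: x + y) - (k *: sharp U x + sharp U y) = 0])).
- split=> [|l U V /= hU hV].
    by rewrite /= !(bl0 (sharpP s _).1) scaler0 addr0 subrr.
  apply/eqP; rewrite subr_eq0 !(sharpP s _).1.1.
  move/eqP: hU; rewrite subr_eq0 => /eqP ->; move/eqP: hV; rewrite subr_eq0 => /eqP ->.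
  by rewrite !scalerDr !scalerA (mulrC k) addrACA.
- move=> u z hu uz /=; apply/eqP; rewrite subr_eq0; apply/eqP.
  have c1 := bl_continuous (sharpP s (k *: x + y)).1.
  have c2 := bl_continuous (sharpP s x).1.
  have c3 := bl_continuous (sharpP s y).1.
  have l1 : (fun n => sharp (u n) (k *: x + y)) @ \oo --> sharp z (k *: x + y).
    by apply: cvg_comp uz _; exact: c1.
  apply: cvg_nrm_unique l1 _.
  rewrite (_ : (fun _ => _) = fun n => k *: sharp (u n) x + sharp (u n) y); last first.
    by apply/funext => n; apply/eqP; rewrite -subr_eq0; apply/eqP; exact: hu.
  apply: cvgD.
    by apply: cvgZr; apply: cvg_comp uz _; exact: c2.
  by apply: cvg_comp uz _; exact: c3.
- move=> a b ha hb /=; rewrite !(sharpP s _).2// !(vn_mulDl, vn_mulDr).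
  by rewrite subrr.
Qed.

Lemma sharpBr s (U : P2 s) x y : sharp U (x - y) = sharp U x - sharp U y.
Proof. by rewrite -scaleN1r addrC sharpDr scaleN1r addrC. Qed.

Lemma sharp0r s (U : P2 s) : sharp U 0 = 0.
Proof. by have := sharpBr U 0 0; rewrite !subrr. Qed.

Lemma sharp_incl s t (U : P2 s) x : s <= t -> sharp (incl2 t U : P2 t) x = sharp U x.
Proof.
move=> st; have [i1 i2] := incl2P st; move: U.
have h1 := bounded_linear_comp (nrm_ge0 x) i1 (sharpP t x).1.
apply: (bounded_linear_eq2 h1 (sharpP s x).1) => a b ha hb /=.
by rewrite i2// !(sharpP _ _).2//; exact: (filtration_le st).
Qed.

Lemma sharp_in s t (U : P2 s) x : s <= t -> filtration X t x ->
  filtration X t (sharp U x).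
Proof.
move=> st hx; move: U; apply: (bounded_linear_in2 (sharpP s x).1 (lB t)).
  exact: (subalgebra_closed (hB t)).
move=> a b ha hb; rewrite (sharpP _ _).2//.
by apply: (vns_M (hB t)); [apply: (vns_M (hB t))|] => //; exact: (filtration_le st).
Qed.

(** [x] has to lie in A_t: [pure2 (P2 t)] is bilinear and norm-controlled on A_t only, and a x b
    must belong to it. *)
Lemma lsharpP s t x : s <= t -> filtration X t x ->
  bounded_linear (lsharp P2 t x : P3 s -> P2 t) (nrm x) /\
  forall a b c, filtration X s a -> filtration X s b -> filtration X s c ->
    lsharp P2 t x (pure3 (P3 s) a b c) = pure2 (P2 t) (a ** x ** b) c.
Proof.
move=> st hx; have st' := filtration_le (X := X) st.
have hM a b : filtration X s a -> filtration X s b -> filtration X t (a ** x ** b).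
  by move=> /st' ha /st' hb; apply: (vns_M (hB t)) => //; exact: (vns_M (hB t)).
have [p1 p2] := pure2_bilinear (P2 t).
apply: ext3P => // [||a b c ha hb hc]; first exact: nrm_ge0.
  split=> k a b c d ha hb hc hd.
  - by rewrite !vn_mulDl p1//; [exact: hM|exact: hM|exact: st'].
  - by rewrite vn_mulDr p1//; [exact: hM|exact: hM|exact: st'].
  - by rewrite p2//; [exact: st'|exact: st'|exact: hM].
rewrite (le_trans (nrm_pure2 _ _ _))//; [exact: hM|exact: st'|].
by rewrite mulrA ler_wpM2r ?nrm_ge0//; exact: nrm_mul3.
Qed.

Lemma rsharpP s t x : s <= t -> filtration X t x ->
  bounded_linear (fun U : P3 s => rsharp P2 t U x) (nrm x) /\
  forall a b c, filtration X s a -> filtration X s b -> filtration X s c ->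
    rsharp P2 t (pure3 (P3 s) a b c) x = pure2 (P2 t) a (b ** x ** c).
Proof.
move=> st hx; have st' := filtration_le (X := X) st.
have hM a b : filtration X s a -> filtration X s b -> filtration X t (a ** x ** b).
  by move=> /st' ha /st' hb; apply: (vns_M (hB t)) => //; exact: (vns_M (hB t)).
have [p1 p2] := pure2_bilinear (P2 t).
apply: ext3P => // [||a b c ha hb hc]; first exact: nrm_ge0.
  split=> k a b c d ha hb hc hd.
  - by rewrite p1//; [exact: st'|exact: st'|exact: hM].
  - by rewrite !vn_mulDl p2//; [exact: hM|exact: hM|exact: st'].
  - by rewrite vn_mulDr p2//; [exact: hM|exact: hM|exact: st'].
rewrite (le_trans (nrm_pure2 _ _ _))//; [exact: st'|exact: hM|].
by rewrite -(mulrA (nrm a)) (mulrCA _ (nrm a)) ler_wpM2l ?nrm_ge0//; exact: nrm_mul3.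
Qed.

Section LevyOperations.
Variable L : forall s t : R, P2 s -> A.
Arguments L : clear implicits.

(** The constant [K] is left free because two bounds of the area are used: the one given by
    [levy_norm], and in (ii) the one coming from its integral form. *)
Lemma levy_idP s t K : 0 <= K -> bounded_linear (L s t) K ->
  bounded_linear (levy_id L t : P3 s -> A) K /\
  forall a b c, filtration X s a -> filtration X s b -> filtration X s c ->
    levy_id L t (pure3 (P3 s) a b c) = L s t (pure2 (P2 s) a b) ** c.
Proof.
move=> K0 hL; have [p1 p2] := pure2_bilinear (P2 s).
apply: ext3P => // [|a b c ha hb hc].
  split=> k a b c d ha hb hc hd.
  - by rewrite p1// hL.1 vn_mulDl.
  - by rewrite p2// hL.1 vn_mulDl.
  - by rewrite vn_mulDr.
rewrite (le_trans (nrm_mul _ _))// mulrA ler_wpM2r ?nrm_ge0//.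
by rewrite (le_trans (hL.2 _))// ler_wpM2l//; exact: nrm_pure2.
Qed.

(** The two conjugations, from the star inside the argument and from the star of the value, cancel
    and leave a linear map. The norm is preserved because the involution is isometric. *)
Lemma id_levy_starP s t K : 0 <= K -> bounded_linear (L s t) K ->
  bounded_linear (id_levy_star L t : P3 s -> A) K /\
  forall a b c, filtration X s a -> filtration X s b -> filtration X s c ->
    id_levy_star L t (pure3 (P3 s) a b c) =
    a ** vn_star (L s t (pure2 (P2 s) (vn_star c) (vn_star b))).
Proof.
move=> K0 hL; have [p1 p2] := pure2_bilinear (P2 s).
have hs a b : filtration X s a -> filtration X s b ->
    levy_star L t (pure2 (P2 s) a b) =
    vn_star (L s t (pure2 (P2 s) (vn_star b) (vn_star a))).
  by move=> ha hb; rewrite /levy_star star2_pure.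
have hst a : filtration X s a -> filtration X s (vn_star a) by exact: (vns_star (hB s)).
suff [h1 h2] : bounded_linear (id_levy_star L t : P3 s -> A) K /\
    forall a b c, filtration X s a -> filtration X s b -> filtration X s c ->
      id_levy_star L t (pure3 (P3 s) a b c) = a ** levy_star L t (pure2 (P2 s) b c).
  by split=> // a b c ha hb hc; rewrite h2// hs.
apply: ext3P => // [|a b c ha hb hc].
  split=> k a b c d ha hb hc hd.
  - by rewrite vn_mulDl.
  - rewrite !hs//; last exact: (vns_linear (hB s)).
    by rewrite vn_starD p2//; [rewrite hL.1 vn_starD conjCK vn_mulDr|exact: hst..].
  - rewrite !hs//; last exact: (vns_linear (hB s)).
    by rewrite vn_starD p1//; [rewrite hL.1 vn_starD conjCK vn_mulDr|exact: hst..].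
rewrite (le_trans (nrm_mul _ _))// -mulrA mulrCA ler_wpM2l ?nrm_ge0//.
rewrite hs// nrm_star (le_trans (hL.2 _))// ler_wpM2l//.
rewrite -(nrm_star b) -(nrm_star c) mulrC.
by apply: nrm_pure2; exact: hst.
Qed.

Lemma levy_id_in s t K (W : P3 s) : 0 <= K -> bounded_linear (L s t) K -> s <= t ->
  (forall U, filtration X t (L s t U)) -> filtration X t (levy_id L t W).
Proof.
move=> K0 hL st hA; have [h1 h2] := levy_idP K0 hL; move: W.
apply: (bounded_linear_in3 h1 (lB t)); first exact: (subalgebra_closed (hB t)).
by move=> a b c ha hb hc; rewrite h2//; apply: (vns_M (hB t)) => //; exact: (filtration_le st).
Qed.

Lemma id_levy_star_in s t K (W : P3 s) : 0 <= K -> bounded_linear (L s t) K -> s <= t ->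
  (forall U, filtration X t (L s t U)) -> filtration X t (id_levy_star L t W).
Proof.
move=> K0 hL st hA; have [h1 h2] := id_levy_starP K0 hL; move: W.
apply: (bounded_linear_in3 h1 (lB t)); first exact: (subalgebra_closed (hB t)).
move=> a b c ha hb hc; rewrite h2//; apply: (vns_M (hB t)).
  exact: (filtration_le st).
exact: (vns_star (hB t)).
Qed.

End LevyOperations.
End Operations.

(* Moves the two occurrences of x, with opposite signs, to the end of a sum,
   where they cancel. *)
Ltac cancel x := rewrite ?(addrAC _ x) ?(addrAC _ (- x)) ?addrK ?addrNK.

(** * Hoelder norms and the germ *)

Section HolderNorms.
Context {R : realType}.
Implicit Types (I : set R) (a c : R).

Lemma norm0_ge0 I (n : R -> R) : (0 <= norm0 I n)%E.
Proof. by apply: ereal_sup_ubound; left. Qed.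

Lemma norm2_ge0 I a (n : R -> R -> R) : (0 <= norm2 I a n)%E.
Proof. by apply: ereal_sup_ubound; left. Qed.

Lemma norm0_le I (n : R -> R) c : 0 <= c ->
  (forall s, I s -> n s <= c) -> (norm0 I n <= c%:E)%E.
Proof.
move=> c0 h; apply: ge_ereal_sup => _ [->|[s Is <-]]; first by rewrite lee_fin.
by rewrite lee_fin h.
Qed.

Lemma norm2_le I a (n : R -> R -> R) c : 0 <= c ->
  (forall s t, I s -> I t -> s < t -> n s t <= c * (t - s) `^ a) ->
  (norm2 I a n <= c%:E)%E.
Proof.
move=> c0 h; apply: ge_ereal_sup => _ [->|[[s t] /= [Is It st] <-]].
  by rewrite lee_fin.
by rewrite lee_fin ler_pdivrMr ?powR_gt0 ?subr_gt0// h.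
Qed.

Lemma norm0_bound I (n : R -> R) s : (norm0 I n < +oo)%E -> I s ->
  n s <= fine (norm0 I n).
Proof.
move=> hf Is; rewrite -lee_fin fineK ?ge0_fin_numE ?norm0_ge0//.
by apply: ereal_sup_ubound; right; exists s.
Qed.

Lemma norm2_bound I a (n : R -> R -> R) s t : (norm2 I a n < +oo)%E ->
  I s -> I t -> s < t -> n s t <= fine (norm2 I a n) * (t - s) `^ a.
Proof.
move=> hf Is It st; rewrite -ler_pdivrMr ?powR_gt0 ?subr_gt0//.
rewrite -lee_fin fineK ?ge0_fin_numE ?norm2_ge0//.
by apply: ereal_sup_ubound; right; exists (s, t).
Qed.

Lemma norm0_subset I I' (n : R -> R) : I `<=` I' -> (norm0 I n <= norm0 I' n)%E.
Proof.
move=> II'; apply: ereal_sup_le => x [->|[s Is <-]]; first by left.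
by right; exists s => //; exact: II'.
Qed.

Lemma norm2_subset I I' a (n : R -> R -> R) : I `<=` I' ->
  (norm2 I a n <= norm2 I' a n)%E.
Proof.
move=> II'; apply: ereal_sup_le => x [->|[p [h1 h2 h3] <-]]; first by left.
by right; exists p => //; split=> //; exact: II'.
Qed.

Lemma norm3_le I a b (n : R -> R -> R -> R) c : 0 <= c ->
  (forall s u t, I s -> I u -> I t -> s < u -> u < t ->
     n s u t <= c * ((t - u) `^ a * (u - s) `^ b)) ->
  (norm3 I a b n <= c%:E)%E.
Proof.
move=> c0 h; apply: ge_ereal_sup => _ [->|[[[s u] t] /= [Is Iu It su ut] <-]].
  by rewrite lee_fin.
by rewrite lee_fin ler_pdivrMr ?mulr_gt0 ?powR_gt0 ?subr_gt0// h.
Qed.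

End HolderNorms.

Section Germ.
Context {R : realType} {A : vonNeumannAlgebra R} {X : R -> A}.
Context {P2 : forall t, tensor2 (filtration X t)}.
Context {P3 : forall t, tensor3 (filtration X t)}.
Variables (T gamma : R) (L : forall s t : R, P2 s -> A).
Arguments L : clear implicits.
Hypothesis X_star : forall t, 0 <= t <= T -> vn_star (X t) = X t.
Hypothesis hL : product_levy_area T gamma L.

Let NL := fine (levy_norm T gamma L).

Lemma levy_norm_ge0 : (0 <= levy_norm T gamma L)%E.
Proof. by apply: ereal_sup_ubound; left. Qed.

Lemma fine_levy_norm_ge0 : 0 <= NL.
Proof. by rewrite fine_ge0// levy_norm_ge0. Qed.

(** The supremum defining [levy_norm] skips U = 0 and the diagonal; there the bound holds by
    linearity and by [levy_diag]. *)
Lemma levy_bounded_linear s t : 0 <= s -> s <= t -> t <= T ->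
  bounded_linear (L s t) (NL * (t - s) `^ (2 * gamma)).
Proof.
move=> s0; rewrite le_eqVlt => /orP[/eqP <- _|st tT].
  split=> [k U V|U]; rewrite !(levy_diag hL) ?scaler0 ?addr0//.
  by rewrite nrm0 mulr_ge0 ?nrm_ge0// mulr_ge0 ?powR_ge0// fine_levy_norm_ge0.
split; first exact: (levy_linear hL).
move=> U; have [->|U0] := eqVneq U 0.
  have lin := levy_linear hL s0 st tT.
  have := lin (-1) 0 0; rewrite scaler0 addr0 scaleN1r addNr => ->.
  by rewrite !nrm0 mulr0.
have U0' : 0 < nrm U by rewrite lt_neqAle nrm_ge0 eq_sym nrm_eq0 U0.
rewrite -mulrA -ler_pdivrMr ?mulr_gt0 ?powR_gt0 ?subr_gt0//.
rewrite -lee_fin fineK ?ge0_fin_numE ?levy_norm_ge0//; last exact: levy_finite hL.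
by apply: ereal_sup_ubound; right; exists s, t, U.
Qed.

Let K0 s t : 0 <= NL * (t - s) `^ (2 * gamma).
Proof. by rewrite mulr_ge0 ?powR_ge0// fine_levy_norm_ge0. Qed.

(** Chen's relation is given for strictly ordered times; at s = u or u = t both sides vanish. Having
    it on the closed simplex avoids case distinctions when partition points coincide. *)
Lemma levy_deltaE s u t (U : P2 s) : 0 <= s -> s <= u -> u <= t -> t <= T ->
  L s t U - L s u U - L u t (incl2 u U) = sharp U (delta1 X s u) ** delta1 X u t.
Proof.
move=> s0; rewrite le_eqVlt => /orP[/eqP <- _ _|su].
  by rewrite (levy_diag hL) incl2_id subr0 subrr /delta1 subrr sharp0r vn_mul0l.
rewrite le_eqVlt => /orP[/eqP <- _|ut tT]; last by apply: (levy_delta hL).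
by rewrite (levy_diag hL) subr0 subrr /delta1 (subrr (X u)) vn_mul0r.
Qed.

Lemma delta1_in s t : 0 <= s -> s <= t -> filtration X t (delta1 X s t).
Proof.
move=> s0 st; apply: (lin_subspaceB (subalgebra_lin (filtration_subalgebra X t))).
  by apply: filtration_path; rewrite (le_trans s0 st) lexx.
by apply: filtration_path; rewrite s0 st.
Qed.

Lemma delta1_star s t : 0 <= s -> s <= t -> t <= T ->
  vn_star (delta1 X s t) = delta1 X s t.
Proof.
move=> s0 st tT; rewrite vn_starB !X_star// ?s0 ?tT ?(le_trans s0 st)//.
by rewrite (le_trans st tT).
Qed.

(** Chen's relation multiplied on the right by the third leg. Both sides are bounded linear in [W],
    so pure tensors decide. *)
Lemma levy_id_delta s u t (W : P3 s) : 0 <= s -> s <= u -> u <= t -> t <= T ->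
  levy_id L t W - levy_id L u W - levy_id L t (incl3 u W) =
  sharp (lsharp P2 u (delta1 X s u) W) (delta1 X u t).
Proof.
move=> s0 su ut tT; have st := le_trans su ut; have uT := le_trans ut tT.
have u0 := le_trans s0 su.
have [a1 a2] := levy_idP (P3 := P3) (K0 s t) (levy_bounded_linear s0 st tT).
have [b1 b2] := levy_idP (P3 := P3) (K0 s u) (levy_bounded_linear s0 su uT).
have [c1 c2] := levy_idP (P3 := P3) (K0 u t) (levy_bounded_linear u0 ut tT).
have [d1 d2] := incl3P (P3 := P3) su.
have [e1 e2] := lsharpP (P2 := P2) (P3 := P3) su (delta1_in s0 su).
have [f1 f2] := sharpP (P2 := P2) u (delta1 X u t).
have l1 := bounded_linearB (bounded_linearB a1 b1) (bounded_linear_comp (K0 u t) d1 c1).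
have l2 := bounded_linear_comp (nrm_ge0 _) e1 f1.
move: W; apply: (bounded_linear_eq3 l1 l2) => a b c ha hb hc /=.
have le_su := filtration_le (X := X) su.
rewrite a2// b2// d2// c2//; [|exact: le_su..].
rewrite e2// f2//; last exact: le_su.
  by rewrite -!vn_mulBl -(incl2P su).2// levy_deltaE// (sharpP _ _).2// vn_mulA.
have hs := filtration_subalgebra X u.
by apply: (vns_M hs); [apply: (vns_M hs); [exact: le_su|exact: delta1_in]|exact: le_su].
Qed.

(** Chen's relation for the tensor of c^* and b^*, followed by the star. This reverses the order of
    the factors, and self-adjointness of [X] returns the increments unchanged. *)
Lemma id_levy_star_delta s u t (W : P3 s) : 0 <= s -> s <= u -> u <= t -> t <= T ->
  id_levy_star L t W - id_levy_star L u W - id_levy_star L t (incl3 u W) =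
  sharp (rsharp P2 u W (delta1 X s u)) (delta1 X u t).
Proof.
move=> s0 su ut tT; have st := le_trans su ut; have uT := le_trans ut tT.
have u0 := le_trans s0 su.
have [a1 a2] := id_levy_starP (P3 := P3) (K0 s t) (levy_bounded_linear s0 st tT).
have [b1 b2] := id_levy_starP (P3 := P3) (K0 s u) (levy_bounded_linear s0 su uT).
have [c1 c2] := id_levy_starP (P3 := P3) (K0 u t) (levy_bounded_linear u0 ut tT).
have [d1 d2] := incl3P (P3 := P3) su.
have [e1 e2] := rsharpP (P2 := P2) (P3 := P3) su (delta1_in s0 su).
have [f1 f2] := sharpP (P2 := P2) u (delta1 X u t).
have l1 := bounded_linearB (bounded_linearB a1 b1) (bounded_linear_comp (K0 u t) d1 c1).
have l2 := bounded_linear_comp (nrm_ge0 _) e1 f1.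
move: W; apply: (bounded_linear_eq3 l1 l2) => a b c ha hb hc /=.
have le_su := filtration_le (X := X) su.
have hs := filtration_subalgebra X u; have hss := filtration_subalgebra X s.
rewrite a2// b2// d2// c2//; [|exact: le_su..].
rewrite e2// f2//; [|exact: le_su|]; last first.
  by apply: (vns_M hs); [apply: (vns_M hs); [exact: le_su|exact: delta1_in]|exact: le_su].
have hst x : filtration X s x -> filtration X s (vn_star x) by exact: (vns_star hss).
rewrite -!vn_mulBr -!vn_starB -(incl2P su).2//; [|exact: hst..].
rewrite levy_deltaE// (sharpP _ _).2//; [|exact: hst..].
by rewrite !vn_starM !vn_starK !delta1_star// !vn_mulA.
Qed.

Variables (U : forall t, P2 t) (U1 U2 : forall t, P3 t).

Lemma germ_delta s u t : 0 <= s -> s <= u -> u <= t -> t <= T ->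
  delta2 (germ L U U1 U2) s u t =
  - (sharp (bi_remainder U U1 U2 s u) (delta1 X u t)
     + levy_id L t (deltaP3 U1 s u) + id_levy_star L t (deltaP3 U2 s u)).
Proof.
move=> s0 su ut tT; have st := le_trans su ut; have uT := le_trans ut tT.
have u0 := le_trans s0 su.
have c1 := (levy_idP (P3 := P3) (K0 u t) (levy_bounded_linear u0 ut tT)).1.
have c2 := (id_levy_starP (P3 := P3) (K0 u t) (levy_bounded_linear u0 ut tT)).1.
have f1 := (sharpP (P2 := P2) u (delta1 X u t)).1.
rewrite /bi_remainder /deltaP2 /deltaP3 /delta2 /germ.
rewrite !(blB f1) (blB c1) (blB c2).
(* Chen's relations are read from right to left: the terms with [lsharp] and [rsharp] become
   differences of area terms, and what remains is cancellation in an additive group. *)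
rewrite (sharp_incl _ _ su) -levy_id_delta// -id_levy_star_delta//.
have -> : delta1 X s t = delta1 X s u + delta1 X u t.
  by rewrite /delta1 [RHS]addrC addrA subrK.
have -> : sharp (U s) (delta1 X s u + delta1 X u t)
   = sharp (U s) (delta1 X s u) + sharp (U s) (delta1 X u t).
  by rewrite -[X in X + _]scale1r sharpDr scale1r.
set x1 := sharp _ _; set x2 := sharp _ _; set x3 := sharp _ _.
set y1 := levy_id _ _ _; set y2 := levy_id _ _ _; set y3 := levy_id _ _ _.
set y4 := levy_id _ _ _.
set z1 := id_levy_star _ _ _; set z2 := id_levy_star _ _ _.
set z3 := id_levy_star _ _ _; set z4 := id_levy_star _ _ _.
apply/eqP; rewrite -subr_eq0 !(opprD, opprK) -[X in X == 0]add0r !addrA.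
by cancel x1; cancel x2; cancel x3; cancel y1; cancel y2; cancel y3; cancel y4; cancel z1; cancel z2; cancel z3; cancel z4.
Qed.
End Germ.

Lemma powR_le (R : realType) (a x y : R) : 0 <= a -> 0 <= x -> x <= y ->
  x `^ a <= y `^ a.
Proof. by move=> a0 x0 xy; apply: ge0_ler_powR; rewrite ?nnegrE// (le_trans x0). Qed.

Lemma powR_double (R : realType) (x a : R) : 0 < a -> x `^ (2 * a) = x `^ a ^+ 2.
Proof.
move=> a0; have -> : 2 * a = a + a by ring.
by rewrite powRD ?expr2//; apply/implyP; rewrite gt_eqF// addr_gt0.
Qed.

Lemma geometric_cvg (R : realType) (V : completeNormedModType R[i])
  (u : nat -> V) (c q : R) : 0 <= q < 1 ->
  (forall n, nrm (u n.+1 - u n) <= c * q ^+ n) -> exists x : V, u @ \oo --> x.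
Proof.
move=> /andP[q0 q1] hu.
have c0 : 0 <= c by have := hu 0%N; rewrite expr0 mulr1; apply: le_trans; exact: nrm_ge0.
have q1' : 0 < 1 - q by rewrite subr_gt0.
have h N k : nrm (u (N + k)%N - u N) <= c / (1 - q) * q ^+ N.
  (* The induction needs the exact geometric sum; without the factor 1 - q^k the hypothesis would
     not reproduce itself. *)
  have : nrm (u (N + k)%N - u N) <= c / (1 - q) * q ^+ N * (1 - q ^+ k).
    elim: k => [|k IH]; first by rewrite addn0 subrr nrm0 expr0 subrr mulr0.
    rewrite addnS (le_trans (nrm_triB _ (u (N + k)%N) _))//.
    rewrite (le_trans (lerD (hu _) IH))// exprD exprS le_eqVlt; apply/orP; left.
    by apply/eqP; field; rewrite gt_eqF.
  move=> /le_trans; apply; rewrite ler_piMr ?mulr_ge0 ?exprn_ge0 ?invr_ge0 ?(ltW q1')//.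
  by rewrite lerBlDr lerDl exprn_ge0.
apply: nrm_cauchy_cvg => e e0.
have /cvgrPdist_lt/(_ (e / 2 / (c / (1 - q) + 1))) : (fun n => q ^+ n) @ \oo --> (0 : R).
  by apply: cvg_expr; rewrite ger0_norm.
have d0 : 0 < c / (1 - q) + 1 by rewrite ltr_wpDl// divr_ge0// ltW.
case=> [|N _ hN]; first by rewrite !divr_gt0.
exists N => m n Nm Nn.
have hk k : (N <= k)%N -> nrm (u k - u N) < e / 2.
  move=> Nk; rewrite -(subnKC Nk) (le_lt_trans (h _ _))//.
  have := hN N (leqnn _); rewrite /= sub0r normrN ger0_norm ?exprn_ge0//.
  rewrite ltr_pdivlMr// mulrC; apply: le_lt_trans.
  by rewrite ler_wpM2r ?exprn_ge0// lerDl.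
rewrite (le_lt_trans (nrm_triB _ (u N) _))// (splitr e) ltrD ?hk// nrmB hk//.
Qed.

(** * The sewing map *)

Section Sewing.
Context {R : realType} {V : completeNormedModType R[i]}.
Variables (T mu : R).
Hypothesis mu1 : 1 < mu.
Implicit Types (M : R -> R -> V) (C s u t : R).

Let q : R := 2 * 2^-1 `^ mu.
(** The solution of S = 2 + q S: cutting a partition costs two values of delta M, and the two halves
    cost S times 2 (1/2)^mu = q. *)
Definition sew_const : R := 2 / (1 - q).

Let mu0 : 0 < mu. Proof. exact: lt_trans mu1. Qed.

Let q_ge0 : 0 <= q.
Proof. by rewrite mulr_ge0// powR_ge0. Qed.

Let q_lt1 : q < 1.
Proof.
rewrite /q.
have : (2^-1 : R) `^ mu < 2^-1 `^ 1.
  have -> : mu = 1 + (mu - 1) by ring.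
  have h2 : (2^-1 : R) != 0 by rewrite invr_eq0.
  rewrite powRD; last by rewrite h2 implybT.
  have : (2^-1 : R) `^ (mu - 1) < 1 `^ (mu - 1).
    by apply: gt0_ltr_powR; rewrite ?nnegrE ?subr_gt0 ?invr_ge0// invf_lt1// ltr1n.
  by rewrite powR1 powRr1 ?invr_ge0// gtr_pMr ?invr_gt0.
by rewrite powRr1 ?invr_ge0//; lra.
Qed.

Lemma sew_const_ge0 : 0 <= sew_const.
Proof. by rewrite divr_ge0// subr_ge0 ltW. Qed.

Let half_powR d : 0 <= d -> 2 * (d / 2) `^ mu = q * d `^ mu.
Proof. by move=> d0; rewrite powRM ?invr_ge0// /q; ring. Qed.

Let sew_constE : 2 + q * sew_const = sew_const.
Proof. by rewrite /sew_const; field; rewrite subr_eq0 gt_eqF. Qed.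

(* Cut the partition at the last point of the left half: the two remaining
   pieces have at most half the length, so the constant reproduces itself. *)
Lemma partition_sum_bound M (l1 l2 C : R) (p : nat -> R) : 0 <= C ->
  (forall t, l1 <= t <= l2 -> M t t = 0) ->
  (forall s u t, l1 <= s -> s <= u -> u <= t -> t <= l2 ->
     nrm (delta2 M s u t) <= C * (t - s) `^ mu) ->
  {homo p : m n / (m <= n)%N >-> m <= n} -> (forall i, l1 <= p i <= l2) ->
  forall m n, (m <= n)%N ->
  nrm (M (p m) (p n) - \sum_(m <= i < n) M (p i) (p i.+1)) <=
  sew_const * C * (p n - p m) `^ mu.
Proof.
move=> C0 M0 MC pm pI m n; move: {2}(n - m)%N (leqnn (n - m)) => k.
elim: k m n => [|k IH] m n.
  rewrite leqn0 subn_eq0 => nm mn; have -> : m = n by apply/eqP; rewrite eqn_leq mn.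
  rewrite big_geq// subr0 M0// nrm0.
  by rewrite mulr_ge0 ?powR_ge0// mulr_ge0// sew_const_ge0.
move=> nmk; rewrite leq_eqVlt => /orP[/eqP->|mn].
  rewrite big_geq// subr0 M0// nrm0.
  by rewrite mulr_ge0 ?powR_ge0// mulr_ge0// sew_const_ge0.
set d := p n - p m; have d0 : 0 <= d by rewrite subr_ge0 pm// ltnW.
pose P j := [&& (m <= j)%N, (j < n)%N & p j - p m <= d / 2].
have Pm : P m by rewrite /P leqnn mn subrr divr_ge0.
have Pb i : P i -> (i <= n)%N by case/and3P => _ /ltnW.
case: (ex_maxnP (ex_intro P m Pm) Pb) => j /and3P[mj jn jd] jmax.
have jd' : p n - p j.+1 <= d / 2.
  have [->|jn'] := eqVneq j.+1 n; first by rewrite subrr divr_ge0.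
  have : ~~ P j.+1 by apply/negP => /jmax; rewrite ltnn.
  by rewrite /P (leqW mj) ltn_neqAle jn' jn/= -ltNge /d; lra.
have h1 := IH m j; have h2 := IH j.+1 n.
have {}h1 : nrm (M (p m) (p j) - \sum_(m <= i < j) M (p i) (p i.+1)) <=
    sew_const * C * (d / 2) `^ mu.
  rewrite (le_trans (h1 _ mj))//.
    by rewrite -ltnS (leq_trans _ nmk)// ltn_sub2r.
  apply: ler_wpM2l; first by rewrite mulr_ge0// sew_const_ge0.
  by apply: powR_le; [exact: ltW|rewrite subr_ge0 pm|].
have {}h2 : nrm (M (p j.+1) (p n) - \sum_(j.+1 <= i < n) M (p i) (p i.+1)) <=
    sew_const * C * (d / 2) `^ mu.
  rewrite (le_trans (h2 _ jn))//.
    by rewrite -ltnS (leq_trans _ nmk)// ltn_sub2l.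
  apply: ler_wpM2l; first by rewrite mulr_ge0// sew_const_ge0.
  by apply: powR_le; [exact: ltW|rewrite subr_ge0 pm|].
have pmj := pm _ _ mj; have pjn := pm _ _ jn; have pjj := pm _ _ (leqnSn j).
have [pm1 _] := andP (pI m); have [_ pn2] := andP (pI n).
have h3 : nrm (delta2 M (p m) (p j) (p n)) <= C * d `^ mu.
  by rewrite MC// (le_trans pjj).
have h4 : nrm (delta2 M (p j) (p j.+1) (p n)) <= C * d `^ mu.
  rewrite (le_trans (MC _ _ _ _ _ _ _))//; first exact: le_trans pmj.
  rewrite ler_wpM2l// powR_le//; [exact: ltW|by rewrite subr_ge0 (le_trans pjj)|].
  by rewrite /d lerD2l lerN2.
rewrite (big_cat_nat (n := j)) ?(ltnW jn)//= (big_ltn jn).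
(* The cell from [p j] to [p j.+1], which contains the middle, may be long; it is separated at both
   of its ends, whence two values of [delta2 M]. *)
have -> : M (p m) (p n) - (\sum_(m <= i < j) M (p i) (p i.+1) +
   (M (p j) (p j.+1) + \sum_(j.+1 <= i < n) M (p i) (p i.+1))) =
   delta2 M (p m) (p j) (p n) + delta2 M (p j) (p j.+1) (p n) +
   (M (p m) (p j) - \sum_(m <= i < j) M (p i) (p i.+1)) +
   (M (p j.+1) (p n) - \sum_(j.+1 <= i < n) M (p i) (p i.+1)).
  rewrite /delta2; set S1 := \sum_(m <= i < j) _; set S2 := \sum_(_ <= i < n) _.
  set a1 := M (p m) (p n); set a2 := M (p j) (p j.+1); set a3 := M (p m) (p j).
  set a4 := M (p j) (p n); set a5 := M (p j.+1) (p n).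
  apply/eqP; rewrite -subr_eq0 !(opprD, opprK) -[X in X == 0]add0r !addrA.
  by cancel a1; cancel a2; cancel a3; cancel a4; cancel a5; cancel S1; cancel S2.
rewrite (le_trans (nrmD _ _))//.
have := nrmD (delta2 M (p m) (p j) (p n) + delta2 M (p j) (p j.+1) (p n))
  (M (p m) (p j) - \sum_(m <= i < j) M (p i) (p i.+1)).
have := nrmD (delta2 M (p m) (p j) (p n)) (delta2 M (p j) (p j.+1) (p n)).
have E : 2 * (sew_const * C * (d / 2) `^ mu) = q * sew_const * C * d `^ mu.
  by rewrite mulrCA half_powR//; ring.
have E' : sew_const * C * d `^ mu = 2 * (C * d `^ mu) + q * sew_const * C * d `^ mu.
  by rewrite -[in LHS]sew_constE; ring.
rewrite E' -E; lra.
Qed.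

(** Halving the interval n times multiplies the bound by q^n, which tends to 0 since mu > 1. *)
Lemma additive_small_eq0 M C : 0 <= C ->
  (forall s u t, 0 <= s -> s <= u -> u <= t -> t <= T -> delta2 M s u t = 0) ->
  (forall s t, 0 <= s -> s <= t -> t <= T -> nrm (M s t) <= C * (t - s) `^ mu) ->
  forall s t, 0 <= s -> s <= t -> t <= T -> M s t = 0.
Proof.
move=> C0 dM MC.
have h n : forall s t, 0 <= s -> s <= t -> t <= T ->
    nrm (M s t) <= q ^+ n * (C * (t - s) `^ mu).
  elim: n => [|n IH] s t s0 st tT; first by rewrite expr0 mul1r MC.
  pose u := (s + t) / 2.
  have su : s <= u by rewrite /u; lra.
  have ut : u <= t by rewrite /u; lra.
  have -> : M s t = M s u + M u t.
    apply/eqP; rewrite -subr_eq0 opprD addrA; apply/eqP.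
    exact: dM.
  rewrite (le_trans (nrmD _ _))//.
  have h1 := IH s u s0 su (le_trans ut tT).
  have h2 := IH u t (le_trans s0 su) ut tT.
  have E1 : u - s = (t - s) / 2 by rewrite /u; field.
  have E2 : t - u = (t - s) / 2 by rewrite /u; field.
  rewrite E1 in h1; rewrite E2 in h2.
  rewrite (le_trans (lerD h1 h2))// exprS.
  have -> : q ^+ n * (C * ((t - s) / 2) `^ mu) + q ^+ n * (C * ((t - s) / 2) `^ mu)
     = q ^+ n * C * (2 * ((t - s) / 2) `^ mu) by ring.
  by rewrite half_powR ?subr_ge0// le_eqVlt; apply/orP; left; apply/eqP; ring.
move=> s t s0 st tT; apply: nrm_le0.
have hc : (fun n => q ^+ n * (C * (t - s) `^ mu)) @ \oo --> 0 * (C * (t - s) `^ mu).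
  by apply: cvgMl; apply: cvg_expr; rewrite ger0_norm.
rewrite mul0r in hc.
apply: (ler_cvg_to (cvg_cst (nrm (M s t))) hc).
by near=> n; exact: h.
Unshelve. all: by end_near.
Qed.

Section Construction.
Variables (M : R -> R -> V) (C : R).
Hypothesis T0 : 0 < T.
Hypothesis C0 : 0 <= C.
Hypothesis M0 : forall t, 0 <= t <= T -> M t t = 0.
Hypothesis MC : forall s u t, 0 <= s -> s <= u -> u <= t -> t <= T ->
  nrm (delta2 M s u t) <= C * (t - s) `^ mu.

Let g n (i : nat) : R := i%:R * (T / 2 ^+ n).
(** The grid is that of [0, T] for all [t], with points clipped at [t]. Grids of successive levels
    are then nested, and increments in [t] change the sum in few cells. *)
Let Z n t := \sum_(0 <= i < 2 ^ n) M (Num.min t (g n i)) (Num.min t (g n i.+1)).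

Let mesh_gt0 n : 0 < T / 2 ^+ n.
Proof. by rewrite divr_gt0// exprn_gt0. Qed.

Let gS n i : g n i.+1 = g n i + T / 2 ^+ n.
Proof. by rewrite /g -natr1 mulrDl mul1r. Qed.

Let g_ge0 n i : 0 <= g n i.
Proof. by rewrite mulr_ge0// ltW. Qed.

Let g_le n i : g n i <= g n i.+1.
Proof. by rewrite gS lerDl ltW. Qed.

Let g_last n : g n (2 ^ n) = T.
Proof. by rewrite /g natrX mulrC divfK// expf_neq0. Qed.

Let mesh_powR n : 2 ^+ n * (T / 2 ^+ n) `^ mu = T `^ mu * q ^+ n.
Proof.
elim: n => [|n IH]; first by rewrite !expr0 divr1 mul1r mulr1.
have -> : T / 2 ^+ n.+1 = T / 2 ^+ n / 2.
  by rewrite exprS; field; rewrite expf_neq0.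
have E := half_powR (ltW (mesh_gt0 n)).
by rewrite exprS (mulrC 2) -(mulrA (2 ^+ n)) E mulrCA IH exprS; ring.
Qed.

Let minB_le (t a b : R) : a <= b -> Num.min t a <= Num.min t b.
Proof. by move=> ab; rewrite le_min !ge_min lexx ab orbT. Qed.

Let minB_step (t a b : R) : a <= b -> Num.min t b - Num.min t a <= b - a.
Proof. by move=> ab; case: (leP t b); case: (leP t a) => h1 h2; lra. Qed.

Let cell_bound n i t :
  C * (Num.min t (g n i.+1) - Num.min t (g n i)) `^ mu <= C * (T / 2 ^+ n) `^ mu.
Proof.
have h := g_le n i.
rewrite ler_wpM2l// powR_le; [by []|exact: ltW|by rewrite subr_ge0 minB_le|].
by rewrite (le_trans (minB_step _ h))// gS addrC addKr.
Qed.

Let sum_bound n (F : nat -> V) :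
  (forall i, (i < 2 ^ n)%N -> nrm (F i) <= C * (T / 2 ^+ n) `^ mu) ->
  nrm (\sum_(0 <= i < 2 ^ n) F i) <= C * T `^ mu * q ^+ n.
Proof.
move=> hF; rewrite (le_trans (nrm_sum _ _ _))//.
rewrite (@le_trans _ _ (\sum_(0 <= i < 2 ^ n) C * (T / 2 ^+ n) `^ mu))//.
  by rewrite big_nat [leRHS]big_nat; apply: ler_sum => i /andP[_ /hF].
rewrite sumr_const_nat subn0 -(mulr_natl _ (2 ^ n)) natrX mulrCA mesh_powR.
by rewrite mulrA.
Qed.

Let sum_pairs (F : nat -> V) k :
  \sum_(0 <= i < k.*2) F i = \sum_(0 <= i < k) (F i.*2 + F i.*2.+1).
Proof.
elim: k => [|k IH]; first by rewrite !big_geq.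
by rewrite doubleS !big_nat_recr//= IH addrA.
Qed.

Let Z_step n t : 0 <= t <= T -> nrm (Z n.+1 t - Z n t) <= C * T `^ mu * q ^+ n.
Proof.
move=> /andP[t0 tT].
have gd i : g n.+1 i.*2 = g n i.
  by rewrite /g -muln2 natrM exprS; field; rewrite expf_neq0.
rewrite /Z expnS mul2n sum_pairs -sumrB; apply: sum_bound => i _.
rewrite -doubleS !gd -nrmN opprB.
set a := Num.min t (g n i); set b := Num.min t (g n i.+1).
set c := Num.min t (g n.+1 i.*2.+1).
have ac : a <= c by rewrite /a -gd; exact: minB_le (g_le _ _).
have cb : c <= b by rewrite /b -gd doubleS; exact: minB_le (g_le _ _).
rewrite opprD addrA; apply: le_trans (cell_bound n i t).
apply: MC => //; first by rewrite /a le_min t0 g_ge0.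
by rewrite /b ge_min tT.
Qed.

(** Cell by cell, the two sides agree unless [s] lies strictly inside the cell; there the difference
    is a value of [delta2 M] at a, s, b. *)
Let Z_split n s t : 0 <= s -> s <= t -> t <= T ->
  nrm (Z n t - Z n s - \sum_(0 <= i < 2 ^ n)
     M (Num.max s (Num.min t (g n i))) (Num.max s (Num.min t (g n i.+1))))
  <= C * T `^ mu * q ^+ n.
Proof.
move=> s0 st tT; rewrite /Z -!sumrB; apply: sum_bound => i _.
apply: le_trans (cell_bound n i t).
have h := g_le n i.
have -> : Num.min s (g n i) = Num.min s (Num.min t (g n i)).
  by rewrite minA (min_idPl st).
have -> : Num.min s (g n i.+1) = Num.min s (Num.min t (g n i.+1)).
  by rewrite minA (min_idPl st).
have a0 : 0 <= Num.min t (g n i) by rewrite le_min (le_trans s0)// g_ge0.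
have bT : Num.min t (g n i.+1) <= T by rewrite ge_min tT.
move: (minB_le t h) a0 bT; set a := Num.min t (g n i); set b := Num.min t _.
move=> ab a0 bT.
have Ms : M s s = 0 by rewrite M0// s0 (le_trans st).
have r0 : 0 <= C * (b - a) `^ mu by rewrite mulr_ge0 ?powR_ge0.
have [bs|/negbTE bs] := boolP (b <= s). 
  have as' := le_trans ab bs.
  rewrite (min_idPr bs) (min_idPr as') (max_idPl bs) (max_idPl as').
  by rewrite Ms subr0 subrr nrm0.
have {bs}sb : s < b by rewrite ltNge bs.
have [sa|/negbTE sa] := boolP (s <= a).
  rewrite (min_idPl sa) (min_idPl (ltW sb)) (max_idPr sa) (max_idPr (ltW sb)).
  by rewrite Ms subr0 subrr nrm0.
have {sa}as' : a < s by rewrite ltNge sa.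
rewrite (min_idPr (ltW as')) (min_idPl (ltW sb)) (max_idPl (ltW as')).
rewrite (max_idPr (ltW sb)); exact: MC (ltW as') (ltW sb) _.
Qed.

(** The clause on [B] transports closed linear conditions from the germ to Z, and is used for
    adaptedness. In the last clause the constant belongs to the subinterval while Z does not depend
    on it, as needed for the local estimate (iv). *)
Lemma sewing : exists Zl : R -> V,
  [/\ Zl 0 = 0,
      forall (B : R -> set V), (forall t, lin_subspace (B t)) ->
        (forall t, seq_closed (B t)) ->
        (forall s u t, 0 <= s -> s <= u -> u <= t -> t <= T -> B t (M s u)) ->
        forall t, 0 <= t <= T -> B t (Zl t) &
      forall l1 l2 C', 0 <= l1 -> l2 <= T -> 0 <= C' ->
       (forall s u t, l1 <= s -> s <= u -> u <= t -> t <= l2 ->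
         nrm (delta2 M s u t) <= C' * (t - s) `^ mu) ->
       forall s t, l1 <= s -> s <= t -> t <= l2 ->
         nrm (Zl t - Zl s - M s t) <= sew_const * C' * (t - s) `^ mu].
Proof.
have /choice[Zl hZ] t : exists x : V, 0 <= t <= T -> (fun n => Z n t) @ \oo --> x.
  have [ht|ht] := boolP (0 <= t <= T); last by exists 0.
  have [x hx] := @geometric_cvg _ _ (fun n => Z n t) (C * T `^ mu) q
     (introT andP (conj q_ge0 q_lt1)) (fun n => Z_step n ht).
  by exists x.
exists Zl; split.
- have h0 : 0 <= (0 : R) <= T by rewrite lexx ltW.
  apply: cvg_nrm_unique (hZ 0 h0) _.
  rewrite (_ : (fun n => Z n 0) = cst 0); first exact: cvg_cst.
  apply/funext => n; rewrite /Z big1// => i _.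
  by rewrite !(min_idPl (g_ge0 _ _)) M0.
- move=> B lB cB MB t /andP[t0 tT]; have ht : 0 <= t <= T by rewrite t0.
  apply: (cB t (fun n => Z n t)) (hZ t ht) => n.
  apply: (lin_subspace_sum (lB t)) => i _ _; apply: MB => //.
  + by rewrite le_min t0 g_ge0.
  + exact: minB_le (g_le _ _).
  + by rewrite ge_min lexx.
- move=> l1 l2 C' l10 l2T C'0 MC' s t l1s st tl2.
  have s0 := le_trans l10 l1s; have tT := le_trans tl2 l2T.
  have hs : 0 <= s <= T by rewrite s0 (le_trans st).
  have ht : 0 <= t <= T by rewrite tT (le_trans s0).
  have hb n : nrm (Z n t - Z n s - M s t) <=
      C * T `^ mu * q ^+ n + sew_const * C' * (t - s) `^ mu.
    (* Clipping the grid to [s, t] keeps all partition points inside [l1, l2], so that the local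
       constant C' suffices. The constant [C] of [0, T] enters only in [Z_split], whose error
       vanishes in the limit. *)
    pose p i := Num.max s (Num.min t (g n i)).
    have p0 : p 0%N = s.
      by rewrite /p /g mul0r (min_idPr (le_trans s0 st)) (max_idPl s0).
    have pn : p (2 ^ n)%N = t by rewrite /p g_last (min_idPl tT) (max_idPr st).
    have := @partition_sum_bound M l1 l2 C' p C'0 _ MC' _ _ 0%N (2 ^ n)%N (leq0n _).
    rewrite p0 pn => h2.
    rewrite (le_trans (nrm_triB _ (\sum_(0 <= i < 2 ^ n) M (p i) (p i.+1)) _))//.
    rewrite lerD//; first exact: (Z_split n s0 st tT).
    rewrite nrmB h2//.
    + by move=> r /andP[r1 r2]; rewrite M0// (le_trans l10)// (le_trans r2).
    + move=> i j ij; rewrite /p ge_max !le_max lexx/=; apply/orP; right.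
      apply: minB_le; apply: ler_wpM2r; first exact: ltW.
      by rewrite ler_nat.
    + move=> i; rewrite /p le_max l1s ge_max (le_trans st tl2)/=.
      by rewrite ge_min tl2.
  have lim1 : (fun n => Z n t - Z n s - M s t) @ \oo --> Zl t - Zl s - M s t.
    by apply: cvgB; [apply: cvgB; [exact: hZ|exact: hZ]|exact: cvg_cst].
  have lim2 : (fun n => C * T `^ mu * q ^+ n + sew_const * C' * (t - s) `^ mu) @ \oo -->
      C * T `^ mu * 0 + sew_const * C' * (t - s) `^ mu.
    apply: cvgD; last exact: cvg_cst.
    by apply: cvgMr; apply: cvg_expr; rewrite ger0_norm.
  rewrite mulr0 add0r in lim2.
  apply/ler_addgt0Pr => e e0; near \oo => n.
  have e1 : nrm (Zl t - Zl s - M s t - (Z n t - Z n s - M s t)) < e / 2.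
    near: n; have /cvg_nrmP := lim1; apply; exact: divr_gt0.
  have e2 : C * T `^ mu * q ^+ n + sew_const * C' * (t - s) `^ mu < sew_const * C' * (t - s) `^ mu + e / 2.
    near: n; apply: (cvgr_lt _ lim2); by rewrite ltrDl divr_gt0.
  have := hb n.
  have := nrmD (Zl t - Zl s - M s t - (Z n t - Z n s - M s t)) (Z n t - Z n s - M s t).
  rewrite subrK; lra.
Unshelve. all: by end_near.
Qed.
End Construction.
End Sewing.

Lemma powR_small (R : realType) (a e : R) : 0 < a -> 0 < e ->
  exists2 d : R, 0 < d & forall x, 0 <= x -> x < d -> x `^ a < e.
Proof.
move=> a0 e0; exists (e `^ a^-1); first exact: powR_gt0.
move=> x x0 xd; have : x `^ a < (e `^ a^-1) `^ a.
  by apply: gt0_ltr_powR; rewrite ?nnegrE// (le_trans x0)// ltW.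
by rewrite -powRrM mulVf ?gt_eqF// powRr1// ltW.
Qed.

(** * Continuity of two- and three-parameter maps from Hoelder bounds *)

Section HolderContinuity.
Context {R : realType} {V : completeNormedModType R[i]} (T gamma : R).
Hypothesis gamma0 : 0 < gamma.
Implicit Types (h : R -> R -> V) (C : R).

Lemma holder1_continuous (f : R -> V) C : 0 <= C ->
  (forall s t, 0 <= s -> s <= t -> t <= T -> nrm (f t - f s) <= C * (t - s) `^ gamma) ->
  {within `[0, T], continuous f}.
Proof.
move=> C0 fC; apply/subspace_continuousP => x /=; rewrite in_itv/= => /andP[x0 xT].
apply/cvg_nrmP => e e0.
have [d d0 hd] := powR_small gamma0 (divr_gt0 e0 (ltr_wpDl C0 ltr01)).
apply/nbhs_ballP; exists d => //= y; rewrite /ball /= => xy.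
rewrite in_itv/= => /andP[y0 yT].
have {}hd := hd _ (normr_ge0 (x - y)) xy.
have : nrm (f x - f y) <= C * `|x - y| `^ gamma.
  have [h|h] := leP x y.
    by rewrite nrmB (distrC x) ger0_norm ?subr_ge0// fC.
  by rewrite [`|x - y|]ger0_norm ?subr_ge0 ?(ltW h)// fC// ltW.
move=> /le_lt_trans; apply.
move: hd; rewrite ltr_pdivlMr ?ltr_wpDl// => /(le_lt_trans _); apply.
by rewrite mulrC ler_wpM2l ?powR_ge0// lerDl.
Qed.

(** Both pairs of times are compared with the larger pair (min s s', max t t'), so that only nested
    intervals occur; moving one end point costs a value of h and a value of [delta2 h]. *)
Lemma holder2_modulus h C : 0 <= C ->
  (forall s t, 0 <= s -> s <= t -> t <= T -> nrm (h s t) <= C * (t - s) `^ gamma) ->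
  (forall s u t, 0 <= s -> s <= u -> u <= t -> t <= T ->
    nrm (delta2 h s u t) <= C * (t - u) `^ gamma /\
    nrm (delta2 h s u t) <= C * (u - s) `^ gamma) ->
  forall s t s' t', simplex2 T (s, t) -> simplex2 T (s', t') ->
  nrm (h s t - h s' t') <= 4 * C * (`|s - s'| `^ gamma + `|t - t'| `^ gamma).
Proof.
move=> C0 hC dC.
have ht s t t' : 0 <= s -> s <= t -> t <= t' -> t' <= T ->
    nrm (h s t' - h s t) <= 2 * C * (t' - t) `^ gamma.
  move=> s0 st tt t'T; have -> : h s t' - h s t = h t t' + delta2 h s t t'.
    by rewrite /delta2 [RHS]addrC subrK.
  rewrite (le_trans (nrmD _ _))//.
  have := hC t t' (le_trans s0 st) tt t'T; have := (dC s t t' s0 st tt t'T).1; lra.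
have hs s s' t : 0 <= s -> s <= s' -> s' <= t -> t <= T ->
    nrm (h s t - h s' t) <= 2 * C * (s' - s) `^ gamma.
  move=> s0 st tt t'T; have -> : h s t - h s' t = h s s' + delta2 h s s' t.
    by rewrite /delta2 [RHS]addrC addrAC subrK.
  rewrite (le_trans (nrmD _ _))//.
  have := hC s s' s0 st (le_trans tt t'T); have := (dC s s' t s0 st tt t'T).2; lra.
have hc s t s' t' : simplex2 T (s, t) -> simplex2 T (s', t') ->
    nrm (h s t - h (Num.min s s') (Num.max t t')) <=
    2 * C * (`|s - s'| `^ gamma + `|t - t'| `^ gamma).
  move=> [/= s0 st tT] [/= s'0 st' t'T].
  have m0 : 0 <= Num.min s s' by rewrite le_min s0.
  have MT : Num.max t t' <= T by rewrite ge_max tT.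
  have ms : Num.min s s' <= s by rewrite ge_min lexx.
  have tM : t <= Num.max t t' by rewrite le_max lexx.
  rewrite (le_trans (nrm_triB _ (h (Num.min s s') t) _))// mulrDr lerD//.
    rewrite nrmB (le_trans (hs _ _ _ m0 ms st tT))// ler_wpM2l ?mulr_ge0//.
    apply: powR_le; [exact: ltW|by rewrite subr_ge0|].
    have [a|a] := boolP (s <= s'); first by rewrite (min_idPl a) subrr.
    have {}a : s' <= s by rewrite ltW// ltNge.
    by rewrite (min_idPr a) ler_norm.
  rewrite nrmB (le_trans (ht _ _ _ m0 (le_trans ms st) tM MT))//.
  rewrite ler_wpM2l ?mulr_ge0//.
  apply: powR_le; [exact: ltW|by rewrite subr_ge0|].
  have [a|a] := boolP (t' <= t); first by rewrite (max_idPl a) subrr.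
  have {}a : t <= t' by rewrite ltW// ltNge.
  by rewrite (max_idPr a) (distrC t) ler_norm.
move=> s t s' t' hst hst'.
rewrite (le_trans (nrm_triB _ (h (Num.min s s') (Num.max t t')) _))//.
have h1 := hc _ _ _ _ hst hst'; have := hc _ _ _ _ hst' hst.
rewrite (minC s') (maxC t') (nrmB (h s' t')) (distrC s') (distrC t'); lra.
Qed.

Lemma modulus2_continuous h K : 0 <= K ->
  (forall s t s' t', simplex2 T (s, t) -> simplex2 T (s', t') ->
    nrm (h s t - h s' t') <= K * (`|s - s'| `^ gamma + `|t - t'| `^ gamma)) ->
  {within simplex2 T, continuous (fun p => h p.1 p.2)}.
Proof.
move=> K0 hK; apply/subspace_continuousP => -[s t] st /=.
apply/cvg_nrmP => e e0.
have c0 : 0 < e / (2 * (K + 1)) by rewrite divr_gt0// mulr_gt0// ltr_wpDl.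
have [d d0 hd] := powR_small gamma0 c0.
apply/nbhs_ballP; exists d => //= -[s' t'] [/= h1 h2] st'.
have {}h1 := hd _ (normr_ge0 _) h1; have {}h2 := hd _ (normr_ge0 _) h2.
rewrite (le_lt_trans (hK _ _ _ _ st st'))//.
have h3 := ltrD h1 h2.
rewrite (@le_lt_trans _ _ ((K + 1) * (`|s - s'| `^ gamma + `|t - t'| `^ gamma)))//.
  by rewrite ler_wpM2r ?lerDl// addr_ge0// powR_ge0.
rewrite -ltr_pdivlMl ?ltr_wpDl//.
have -> : (K + 1)^-1 * e = e / (2 * (K + 1)) + e / (2 * (K + 1)); last by [].
by field; rewrite gt_eqF// ltr_wpDl.
Qed.

Lemma modulus3_continuous h K : 0 <= K ->
  (forall s t s' t', simplex2 T (s, t) -> simplex2 T (s', t') ->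
    nrm (h s t - h s' t') <= K * (`|s - s'| `^ gamma + `|t - t'| `^ gamma)) ->
  {within simplex3 T, continuous (fun p => delta2 h p.1.1 p.1.2 p.2)}.
Proof.
move=> K0 hK; apply/subspace_continuousP => -[[s u] t] [/= s0 su ut tT].
apply/cvg_nrmP => e e0.
have c0 : 0 < e / (6 * (K + 1)) by rewrite divr_gt0// mulr_gt0// ltr_wpDl.
have [d d0 hd] := powR_small gamma0 c0.
apply/nbhs_ballP; exists d => //= -[[s' u'] t'] [[/= h1 h2] /= h3].
move=> [/= s'0 su' ut' t'T].
have {}h1 := hd _ (normr_ge0 _) h1; have {}h2 := hd _ (normr_ge0 _) h2.
have {}h3 := hd _ (normr_ge0 _) h3.
have k1 : nrm (h s t - h s' t') <= K * (`|s - s'| `^ gamma + `|t - t'| `^ gamma).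
  by apply: hK; split=> //=; [exact: le_trans ut|exact: le_trans ut'].
have k2 : nrm (h s u - h s' u') <= K * (`|s - s'| `^ gamma + `|u - u'| `^ gamma).
  by apply: hK; split=> //=; [exact: le_trans tT|exact: le_trans t'T].
have k3 : nrm (h u t - h u' t') <= K * (`|u - u'| `^ gamma + `|t - t'| `^ gamma).
  by apply: hK; split=> //=; [exact: le_trans su|exact: le_trans su'].
have -> : delta2 h s u t - delta2 h s' u' t' =
   (h s t - h s' t') - (h s u - h s' u') - (h u t - h u' t').
  rewrite /delta2; set a := h s t; set b := h s u; set c := h u t.
  set a' := h s' t'; set b' := h s' u'; set c' := h u' t'.
  apply/eqP; rewrite -subr_eq0 !(opprD, opprK) -[X in X == 0]add0r !addrA.
  by cancel a; cancel b; cancel c; cancel a'; cancel b'; cancel c'.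
have := nrmBD (h s t - h s' t' - (h s u - h s' u')) (h u t - h u' t').
have := nrmBD (h s t - h s' t') (h s u - h s' u').
move: k1 k2 k3; set x := `|s - s'| `^ gamma; set y := `|u - u'| `^ gamma.
set z := `|t - t'| `^ gamma => k1 k2 k3 k4 k5.
have x0 : 0 <= x by exact: powR_ge0.
have y0 : 0 <= y by exact: powR_ge0.
have z0 : 0 <= z by exact: powR_ge0.
have k6 : nrm (h s t - h s' t' - (h s u - h s' u') - (h u t - h u' t')) <=
    2 * (K + 1) * (x + y + z) by lra.
rewrite (le_lt_trans k6)// -ltr_pdivlMl ?mulr_gt0 ?ltr_wpDl//.
have -> : (2 * (K + 1))^-1 * e = e / (6 * (K + 1)) + e / (6 * (K + 1)) + e / (6 * (K + 1)).
  by field; rewrite gt_eqF// ltr_wpDl.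
by rewrite !ltrD.
Qed.

(** Exponent [gamma] serves for continuity and the diagonal, exponent [a] for the norm; they differ
    in the applications to the remainder and to the sewn map. *)
Lemma holder2_C2 h a C N : 0 <= C -> 0 <= N ->
  (forall s t, 0 <= s -> s <= t -> t <= T -> nrm (h s t) <= C * (t - s) `^ gamma) ->
  (forall s u t, 0 <= s -> s <= u -> u <= t -> t <= T ->
    nrm (delta2 h s u t) <= C * (t - u) `^ gamma /\
    nrm (delta2 h s u t) <= C * (u - s) `^ gamma) ->
  (forall s t, 0 <= s -> s <= t -> t <= T -> nrm (h s t) <= N * (t - s) `^ a) ->
  C2 T a h.
Proof.
move=> C0 N0 hC dC hN; split.
- have C40 : 0 <= 4 * C by rewrite mulr_ge0.
  apply: (modulus2_continuous C40).
  exact: (holder2_modulus C0).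
- move=> t /andP[t0 tT]; apply: nrm_le0.
  have := hC t t t0 (lexx t) tT.
  by rewrite subrr powR0 ?gt_eqF// mulr0.
- apply: (@le_lt_trans _ _ N%:E); last by rewrite ltry.
  apply: norm2_le => // s t; rewrite /= !in_itv/= => /andP[s0 _] /andP[_ tT] st.
  by apply: hN => //; exact: ltW.
Qed.

End HolderContinuity.

Section SewnGerm.
Context {R : realType} {V : completeNormedModType R[i]} (T gamma : R).
Hypothesis T0 : 0 < T.
Hypothesis gamma0 : 0 < gamma.
Implicit Types (h M : R -> R -> V) (C : R).

(* A partition of unity on the simplex: it splits a quantity of order
   x y (x + y), with x = (t-u)^gamma and y = (u-s)^gamma, into a part of order
   x y^2 and a part of order x^2 y. *)
Definition weight (m : nat) (s u t : R) : R :=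
  (u - s) ^+ m / ((t - u) ^+ m + (u - s) ^+ m).

Lemma weight_itv m s u t : s <= u -> u <= t -> 0 <= weight m s u t <= 1.
Proof.
move=> su ut; rewrite /weight.
have a0 : 0 <= (t - u) ^+ m by rewrite exprn_ge0// subr_ge0.
have b0 : 0 <= (u - s) ^+ m by rewrite exprn_ge0// subr_ge0.
rewrite divr_ge0//=; last by rewrite addr_ge0.
have [E|E] := eqVneq ((t - u) ^+ m + (u - s) ^+ m) 0.
  by rewrite E invr0 mulr0.
by rewrite ler_pdivrMr ?mul1r ?lerDr// lt_neqAle eq_sym E addr_ge0.
Qed.

(** Time reversal exchanges t - u and u - s, so the bound for the complementary weight is an
    instance of [weight_bound]. *)
Lemma weightC m s u t : s < t -> s <= u -> u <= t ->
  1 - weight m s u t = weight m (- t) (- u) (- s).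
Proof.
move=> st su ut; rewrite /weight !opprK (addrC (- u) t) (addrC (- s) u).
have h : (t - u) ^+ m + (u - s) ^+ m != 0.
  rewrite paddr_eq0 ?exprn_ge0 ?subr_ge0//; apply/negP => /andP[].
  case: m => [|m]; first by rewrite expr0 oner_eq0.
  rewrite !expf_eq0 !subr_eq0 => /andP[_ /eqP tu] /andP[_ /eqP us].
  by move: st; rewrite tu us ltxx.
by rewrite (addrC ((u - s) ^+ m)); field.
Qed.

(** With a = t - u and b = u - s, only b < a is delicate: there b^m a^gamma <= b^gamma a^m, because
    (b/a)^(m - gamma) <= 1 when m >= gamma. *)
Lemma weight_bound m s u t : gamma <= m%:R -> s <= u -> u <= t ->
  weight m s u t * ((t - u) `^ gamma + (u - s) `^ gamma) <= 2 * (u - s) `^ gamma.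
Proof.
move=> gm su ut; have := weight_itv m su ut; rewrite /weight.
set a := t - u; set b := u - s.
have a0 : 0 <= a by rewrite subr_ge0.
have b0 : 0 <= b by rewrite subr_ge0.
set w := b ^+ m / (a ^+ m + b ^+ m) => /andP[w0 w1].
suff h : w * a `^ gamma <= b `^ gamma.
  have hb := powR_ge0 b gamma.
  have : w * b `^ gamma <= b `^ gamma by rewrite ler_piMl.
  by rewrite mulrDr; lra.
have [ab|ba] := leP a b.
  rewrite (le_trans (y := a `^ gamma))//; first by rewrite ler_piMl// powR_ge0.
  by apply: powR_le => //; exact: ltW.
have ap : 0 < a by exact: le_lt_trans ba.
have am : 0 < a ^+ m + b ^+ m by rewrite ltr_pwDl ?exprn_gt0// exprn_ge0.
rewrite /w mulrAC ler_pdivrMr//.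
have E x : 0 <= x -> x ^+ m = x `^ gamma * x `^ (m%:R - gamma).
  move=> x0; have pm : gamma + (m%:R - gamma) = m%:R by ring.
  rewrite -powR_mulrn// -{1}pm powRD// pm.
  by rewrite (gt_eqF (lt_le_trans gamma0 gm)).
rewrite mulrDr (le_trans (y := b `^ gamma * a ^+ m))//; last first.
  by rewrite lerDl mulr_ge0 ?powR_ge0// exprn_ge0.
rewrite !E// -mulrA ler_wpM2l ?powR_ge0// mulrC ler_wpM2l ?powR_ge0//.
by apply: powR_le => //; [rewrite subr_ge0|exact: ltW].
Qed.

Lemma weight_continuous m s u t : s < t -> s <= u -> u <= t ->
  (fun p : R * R * R => weight m p.1.1 p.1.2 p.2) @ (s, u, t) --> weight m s u t.
Proof.
move=> st su ut.
have h : (t - u) ^+ m + (u - s) ^+ m != 0.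
  rewrite paddr_eq0 ?exprn_ge0 ?subr_ge0//; apply/negP => /andP[].
  case: m => [|m]; first by rewrite expr0 oner_eq0.
  rewrite !expf_eq0 !subr_eq0 => /andP[_ /eqP tu] /andP[_ /eqP us].
  by move: st; rewrite tu us ltxx.
have c1 : (fun p : R * R * R => p.1.1) @ (s, u, t) --> s.
  by apply: (@cvg_comp _ _ _ fst fst _ (nbhs (s, u))); exact: cvg_fst.
have c2 : (fun p : R * R * R => p.1.2) @ (s, u, t) --> u.
  by apply: (@cvg_comp _ _ _ fst snd _ (nbhs (s, u))); [exact: cvg_fst|exact: cvg_snd].
have c3 : (fun p : R * R * R => p.2) @ (s, u, t) --> t by exact: cvg_snd.
have cb : (fun p : R * R * R => (p.1.2 - p.1.1) ^+ m) @ (s, u, t) --> (u - s) ^+ m.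
  by apply: (cvg_comp _ (fun x : R => x ^+ m) (cvgB c2 c1)); exact: exprn_continuous.
have ca : (fun p : R * R * R => (p.2 - p.1.2) ^+ m) @ (s, u, t) --> (t - u) ^+ m.
  by apply: (cvg_comp _ (fun x : R => x ^+ m) (cvgB c3 c2)); exact: exprn_continuous.
by apply: cvgM => //; apply: cvgV => //; exact: cvgD.
Qed.

(** The weight has no limit on the diagonal s = u = t, but it is bounded and the map it multiplies
    vanishes there. *)
Lemma scaled_continuous (w : R -> R -> R -> R) (k : R -> R -> R -> V) :
  (forall s u t, simplex3 T (s, u, t) -> 0 <= w s u t <= 1) ->
  (forall s u t, simplex3 T (s, u, t) -> s < t ->
     (fun p : R * R * R => w p.1.1 p.1.2 p.2) @ (s, u, t) --> w s u t) ->
  (forall s, 0 <= s <= T -> k s s s = 0) ->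
  {within simplex3 T, continuous (fun p => k p.1.1 p.1.2 p.2)} ->
  {within simplex3 T, continuous (fun p => (w p.1.1 p.1.2 p.2)%:C *: k p.1.1 p.1.2 p.2)}.
Proof.
move=> w01 wc k0 /subspace_continuousP kc.
apply/subspace_continuousP => -[[s u] t] hp /=.
have /cvg_nrmP kc' := kc _ hp; apply/cvg_nrmP => e e0.
have [/= s0 su ut tT] := hp.
have hk := kc' _ (divr_gt0 e0 (ltr0Sn R 1)).
have hw : \forall p \near within (simplex3 T) (nbhs (s, u, t)),
    `|w s u t - w p.1.1 p.1.2 p.2| * nrm (k s u t) < e / 2.
  have [st|st] := ltP s t.
    have n0 : 0 < nrm (k s u t) + 1 by rewrite ltr_wpDl// nrm_ge0.
    have c0 : 0 < e / 2 / (nrm (k s u t) + 1) by rewrite !divr_gt0.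
    have /cvgrPdist_lt/(_ _ c0) hn := wc _ _ _ hp st.
    apply: cvg_within; move: hn; apply: filterS => p /=.
    rewrite ltr_pdivlMr// => /(le_lt_trans _); apply.
    by rewrite ler_wpM2l// lerDl.
  have us : u = s by apply/le_anti; rewrite su (le_trans ut st).
  have ts : t = s by apply/le_anti; rewrite st (le_trans su ut).
  rewrite us ts k0 ?s0 -?ts// nrm0; apply: filterE => p.
  by rewrite mulr0 divr_gt0.
have hs : \forall p \near within (simplex3 T) (nbhs (s, u, t)), simplex3 T p.
  by rewrite near_withinE; apply: filterE.
move: hk hw hs; apply: filterS3 => -[[s' u'] t'] /= h1 h2 h3.
have -> : (w s u t)%:C *: k s u t - (w s' u' t')%:C *: k s' u' t' =
    (w s u t - w s' u' t')%:C *: k s u t + (w s' u' t')%:C *: (k s u t - k s' u' t').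
  rewrite rmorphB /= scalerBl scalerBr.
  by rewrite addrA subrK.
rewrite (le_lt_trans (nrmD _ _))// !nrmZr (splitr e) ltrD//.
have /andP[w0 w1] := w01 _ _ _ h3.
by rewrite (le_lt_trans _ h1)// ger0_norm// ler_piMl// nrm_ge0.
Qed.

Lemma C3_delta2 M C K : 0 <= C -> 0 <= K ->
  (forall s t s' t', simplex2 T (s, t) -> simplex2 T (s', t') ->
    nrm (M s t - M s' t') <= K * (`|s - s'| `^ gamma + `|t - t'| `^ gamma)) ->
  (forall t, 0 <= t <= T -> M t t = 0) ->
  (forall s u t, 0 <= s -> s <= u -> u <= t -> t <= T ->
    nrm (delta2 M s u t) <= C * ((t - u) `^ gamma * (u - s) `^ gamma *
                                ((t - u) `^ gamma + (u - s) `^ gamma))) ->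
  C3 T (3 * gamma) (delta2 M).
Proof.
move=> C0 K0 MK M0 MC.
pose m := (Num.truncn gamma).+1.
have gm : gamma <= m%:R by rewrite ltW// truncnS_gt.
pose w1 := weight m.
pose w2 s u t := 1 - weight m s u t.
have cM := modulus3_continuous gamma0 K0 MK.
have M00 s t : 0 <= s -> s <= t -> t <= T ->
    delta2 M s s t = 0 /\ delta2 M s t t = 0.
  move=> s0 st tT; rewrite /delta2 !M0 ?s0 ?(le_trans s0 st) ?(le_trans st tT)//.
  by rewrite subr0 subrr subrr.
have w01 s u t : simplex3 T (s, u, t) -> 0 <= w1 s u t <= 1.
  by move=> [/= _ su ut _]; exact: weight_itv.
have w02 s u t : simplex3 T (s, u, t) -> 0 <= w2 s u t <= 1.
  by move=> /w01; rewrite /w1 /w2; lra.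
have diag s : 0 <= s <= T -> delta2 M s s s = 0.
  by move=> /andP[s0 sT]; exact: (M00 s s s0 (lexx s) sT).1.
have aux (a b : R) (w : R -> R -> R -> R) : 0 < a -> 0 < b ->
   (forall s u t, simplex3 T (s, u, t) -> 0 <= w s u t <= 1) ->
   (forall s u t, simplex3 T (s, u, t) -> s < t ->
     (fun p : R * R * R => w p.1.1 p.1.2 p.2) @ (s, u, t) --> w s u t) ->
   (forall s u t, 0 <= s -> s < u -> u < t -> t <= T ->
     w s u t * ((t - u) `^ gamma * (u - s) `^ gamma *
                                ((t - u) `^ gamma + (u - s) `^ gamma)) <=
     2 * ((t - u) `^ a * (u - s) `^ b)) ->
   C3ab T a b (fun s u t => (w s u t)%:C *: delta2 M s u t).
  move=> a0 b0 w0 wc wb; split.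
  - exact: scaled_continuous.
  - by move=> s t s0 st tT; have [-> ->] := M00 s t s0 st tT; rewrite !scaler0.
  - have C20 : 0 <= C * 2 by rewrite mulr_ge0.
    rewrite (@le_lt_trans _ _ (C * 2)%:E) ?ltry//; apply: norm3_le => // s u t.
    rewrite /= !in_itv/= => /andP[s0 _] _ /andP[_ tT] su ut.
    have hp : simplex3 T (s, u, t) by split=> //=; exact: ltW.
    have /andP[wp _] := w0 _ _ _ hp.
    rewrite nrmZr ger0_norm// -mulrA.
    rewrite (le_trans (ler_wpM2l wp (MC s u t s0 (ltW su) (ltW ut) tT)))//.
    by rewrite mulrCA ler_wpM2l// wb.
(* The first piece has exponents (gamma, 2 gamma), the second (2 gamma, gamma); the two weights add
   up to 1. *)
exists 2%N, (fun i => if i == ord0 then gamma else 2 * gamma),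
  (fun i s u t => (if i == ord0 then w1 s u t else w2 s u t)%:C *: delta2 M s u t).
split=> [i|s u t hp]; last first.
  by rewrite !big_ord_recl big_ord0 /= addr0 -scalerDl -rmorphD /w1 /w2 subrKC scale1r.
case: ifPn => _; split.
- by have := gamma0 => /= h; lra.
- have -> : 3 * gamma - gamma = 2 * gamma by ring.
  apply: aux => //; first by rewrite mulr_gt0.
    by move=> s u t [/= s0 su ut tT] st; exact: weight_continuous.
  move=> s u t s0 su ut tT; have := weight_bound gm (ltW su) (ltW ut).
  rewrite -/(w1 s u t) powR_double//; set x := (t - u) `^ _; set y := (u - s) `^ _ => h.
  have x0 : 0 <= x by exact: powR_ge0.
  have y0 : 0 <= y by exact: powR_ge0.
  have -> : w1 s u t * (x * y * (x + y)) = (x * y) * (w1 s u t * (x + y)) by ring.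
  have -> : 2 * (x * y ^+ 2) = (x * y) * (2 * y) by ring.
  by rewrite ler_wpM2l// mulr_ge0.
- by have := gamma0 => /= h; lra.
- have -> : 3 * gamma - 2 * gamma = gamma by ring.
  apply: aux => //; first by rewrite mulr_gt0.
    move=> s u t [/= s0 su ut tT] st; apply: cvgB; first exact: cvg_cst.
    exact: weight_continuous.
  move=> s u t s0 su ut tT.
  have ut' : - t <= - u by rewrite lerN2 ltW.
  have su' : - u <= - s by rewrite lerN2 ltW.
  have := weight_bound gm ut' su'.
  rewrite -(weightC m (lt_trans su ut) (ltW su) (ltW ut)) -/(w2 s u t) powR_double// !opprK.
  rewrite (addrC (- s)) (addrC (- u)).
  set x := (t - u) `^ _; set y := (u - s) `^ _ => h.
  have x0 : 0 <= x by exact: powR_ge0.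
  have y0 : 0 <= y by exact: powR_ge0.
  have -> : w2 s u t * (x * y * (x + y)) = (x * y) * (w2 s u t * (y + x)) by ring.
  have -> : 2 * (x ^+ 2 * y) = (x * y) * (2 * x) by ring.
  by rewrite ler_wpM2l// mulr_ge0.
Qed.

End SewnGerm.

Lemma powR_triple (R : realType) (x a : R) : 0 < a -> x `^ (3 * a) = x `^ a ^+ 3.
Proof.
move=> a0; have -> : 3 * a = 2 * a + a by ring.
rewrite powRD ?powR_double// -?exprSr//.
by apply/implyP; rewrite gt_eqF// addr_gt0// mulr_gt0.
Qed.

Lemma cubic_bound (R : realType) (gamma s u t : R) : 0 < gamma -> s <= u -> u <= t ->
  (t - u) `^ gamma * (u - s) `^ gamma * ((t - u) `^ gamma + (u - s) `^ gamma) <=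
  2 * (t - s) `^ (3 * gamma).
Proof.
move=> g0 su ut; rewrite powR_triple//.
have hx : (t - u) `^ gamma <= (t - s) `^ gamma.
  by apply: powR_le; [exact: ltW|rewrite subr_ge0|rewrite lerD2l lerN2].
have hy : (u - s) `^ gamma <= (t - s) `^ gamma.
  by apply: powR_le; [exact: ltW|rewrite subr_ge0|rewrite lerD2r].
have x0 := powR_ge0 (t - u) gamma; have y0 := powR_ge0 (u - s) gamma.
set d := (t - s) `^ gamma in hx hy *.
have -> : 2 * d ^+ 3 = d * d * (d + d) by ring.
by rewrite ler_pM ?mulr_ge0 ?addr_ge0// ?ler_pM// lerD.
Qed.

Section RoughSewing.
Context {R : realType} {V : completeNormedModType R[i]} (T gamma : R).
Hypothesis T0 : 0 < T.
Hypothesis gamma3 : 3^-1 < gamma.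
Implicit Types (h M : R -> R -> V) (C : R).

Let gamma0 : 0 < gamma. Proof. by apply: lt_trans gamma3; rewrite invr_gt0. Qed.
Let mu1 : 1 < 3 * gamma. Proof. by have := gamma3; lra. Qed.

Lemma powR_interval_le (a b : R) d : 0 <= a -> a <= b -> 0 <= d -> d <= T ->
  d `^ b <= T `^ (b - a) * d `^ a.
Proof.
move=> a0 ab d0 dT; have [->|dn] := eqVneq d 0.
  have [b0|b0] := eqVneq b 0.
    have a00 : a = 0 by apply/le_anti; rewrite -{1}b0 ab a0.
    by rewrite b0 a00 subr0 !powRr0 mulr1.
  by rewrite powR0// mulr_ge0 ?powR_ge0.
have -> : b = (b - a) + a by ring.
rewrite addrK powRD; last by rewrite dn implybT.
by rewrite ler_wpM2r ?powR_ge0// powR_le// subr_ge0.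
Qed.

(** The exponents of the two candidates may differ. On a bounded interval both are of order nu =
    min(mu, mu') > 1, and their difference is additive, hence zero. *)
Lemma sewn_unique k h h' : sewn T k h -> sewn T k h' ->
  forall s t, simplex2 T (s, t) -> h s t = h' s t.
Proof.
move=> [mu mu_1 [_ [_ h0 hN] hk]] [mu' mu'_1 [_ [_ h'0 hN'] hk']].
pose nu := Num.min mu mu'.
have nu1 : 1 < nu by rewrite lt_min mu_1.
have nu0 : 0 <= nu by rewrite ltW// (lt_trans _ nu1).
pose N := fine (norm2 `[0, T] mu (fun s t => nrm (h s t))).
pose N' := fine (norm2 `[0, T] mu' (fun s t => nrm (h' s t))).
have N0 : 0 <= N by rewrite fine_ge0// norm2_ge0.
have N'0 : 0 <= N' by rewrite fine_ge0// norm2_ge0.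
have bound (f : R -> R -> V) (a : R) : 1 < a -> nu <= a ->
    (forall t, 0 <= t <= T -> f t t = 0) ->
    (norm2 `[0%R, T] a (fun s t => nrm (f s t)) < +oo)%E ->
    forall s t, 0 <= s -> s <= t -> t <= T -> nrm (f s t) <=
    fine (norm2 `[0%R, T] a (fun s t => nrm (f s t))) * T `^ (a - nu) * (t - s) `^ nu.
  move=> a1 nua f0 hf s t s0; rewrite le_eqVlt => /orP[/eqP<- sT|st tT].
    rewrite f0 ?s0// nrm0 mulr_ge0 ?powR_ge0// mulr_ge0 ?powR_ge0//.
    by rewrite fine_ge0// norm2_ge0.
  rewrite (le_trans (norm2_bound hf _ _ st))//=.
  - by rewrite in_itv/= s0 (le_trans _ tT)// ltW.
  - by rewrite in_itv/= tT (le_trans s0)// ltW.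
  rewrite -mulrA ler_wpM2l//; first by rewrite fine_ge0// norm2_ge0.
  apply: powR_interval_le => //; first by rewrite subr_ge0 ltW.
  by rewrite lerBlDr (le_trans tT)// lerDl.
have nul : nu <= mu by rewrite ge_min lexx.
have nur : nu <= mu' by rewrite ge_min lexx orbT.
have b1 := bound h mu mu_1 nul h0 hN.
have b2 := bound h' mu' mu'_1 nur h'0 hN'.
pose C := N * T `^ (mu - nu) + N' * T `^ (mu' - nu).
have C0 : 0 <= C by rewrite addr_ge0// mulr_ge0// powR_ge0.
move=> s t [/= s0 st tT]; apply/eqP; rewrite -subr_eq0; apply/eqP.
apply: (@additive_small_eq0 R V T nu nu1 (fun s t => h s t - h' s t) C) => //.
  move=> r u v r0 ru uv vT; rewrite /delta2.
  have <- : delta2 h r u v - delta2 h' r u v = 0 by rewrite hk// hk'// subrr.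
  rewrite /delta2 !opprD !opprK !addrA.
  set a := h r v; set b := h r u; set c := h u v.
  set a' := h' r v; set b' := h' r u; set c' := h' u v.
  apply/eqP; rewrite -subr_eq0 !(opprD, opprK) -[X in X == 0]add0r !addrA.
  by cancel a; cancel b; cancel c; cancel a'; cancel b'; cancel c'.
move=> r u r0 ru uT; rewrite (le_trans (nrmBD _ _))// mulrDl lerD//.
  exact: b1.
exact: b2.
Qed.

(** [sewing] at exponent 3 gamma, together with the regularity required by [sewn]. The bound by [C1]
    provides the modulus of continuity of M that [C3] asks for. *)
Lemma rough_sewing M C C1 : 0 <= C -> 0 <= C1 ->
  (forall t, 0 <= t <= T -> M t t = 0) ->
  (forall s t, 0 <= s -> s <= t -> t <= T -> nrm (M s t) <= C1 * (t - s) `^ gamma) ->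
  (forall s u t, 0 <= s -> s <= u -> u <= t -> t <= T ->
    nrm (delta2 M s u t) <= C * ((t - u) `^ gamma * (u - s) `^ gamma *
                                ((t - u) `^ gamma + (u - s) `^ gamma))) ->
  exists Z : R -> V,
  [/\ Z 0 = 0,
      forall (B : R -> set V), (forall t, lin_subspace (B t)) ->
        (forall t, seq_closed (B t)) ->
        (forall s u t, 0 <= s -> s <= u -> u <= t -> t <= T -> B t (M s u)) ->
        forall t, 0 <= t <= T -> B t (Z t),
      forall l1 l2 C', 0 <= l1 -> l2 <= T -> 0 <= C' ->
       (forall s u t, l1 <= s -> s <= u -> u <= t -> t <= l2 ->
         nrm (delta2 M s u t) <= C' * ((t - u) `^ gamma * (u - s) `^ gamma *
                                ((t - u) `^ gamma + (u - s) `^ gamma))) ->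
       forall s t, l1 <= s -> s <= t -> t <= l2 ->
         nrm (delta1 Z s t - M s t) <=
           sew_const (3 * gamma) * (2 * C') * (t - s) `^ (3 * gamma) &
      sewn T (delta2 M) (fun s t => M s t - delta1 Z s t)].
Proof.
move=> C0 C10 M0 MC1 MC.
have cubic C' s u t : 0 <= C' -> s <= u -> u <= t ->
    C' * ((t - u) `^ gamma * (u - s) `^ gamma * ((t - u) `^ gamma + (u - s) `^ gamma))
    <= 2 * C' * (t - s) `^ (3 * gamma).
  move=> C'0 su ut; rewrite (mulrC 2) -(mulrA C') ler_wpM2l//.
  exact: cubic_bound.
have C20 : 0 <= 2 * C by rewrite mulr_ge0.
have [|Z [Z0 ZB Zb]] := sewing mu1 T0 C20 M0.
  by move=> s u t s0 su ut tT; rewrite (le_trans (MC _ _ _ s0 su ut tT))// cubic.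
have {}Zb l1 l2 C' : 0 <= l1 -> l2 <= T -> 0 <= C' ->
       (forall s u t, l1 <= s -> s <= u -> u <= t -> t <= l2 ->
         nrm (delta2 M s u t) <= C' * ((t - u) `^ gamma * (u - s) `^ gamma *
                                ((t - u) `^ gamma + (u - s) `^ gamma))) ->
       forall s t, l1 <= s -> s <= t -> t <= l2 ->
         nrm (delta1 Z s t - M s t) <=
           sew_const (3 * gamma) * (2 * C') * (t - s) `^ (3 * gamma).
  move=> l10 l2T C'0 MC' s t l1s st tl2.
  apply: (Zb l1 l2) => //; first by rewrite mulr_ge0.
  move=> r u v h1 h2 h3 h4.
  by rewrite (le_trans (MC' _ _ _ h1 h2 h3 h4))// cubic.
exists Z; split => //.
pose K := sew_const (3 * gamma) * (2 * C).
have K0 : 0 <= K by rewrite mulr_ge0// sew_const_ge0.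
pose h s t := M s t - delta1 Z s t.
have hK s t : 0 <= s -> s <= t -> t <= T -> nrm (h s t) <= K * (t - s) `^ (3 * gamma).
  by move=> s0 st tT; rewrite nrmB; exact: (Zb 0 T).
have dh s u t : delta2 h s u t = delta2 M s u t.
  rewrite /delta2 /h /delta1; set a := M s t; set b := M s u; set c := M u t.
  apply/eqP; rewrite -subr_eq0 !(opprD, opprK) -[X in X == 0]add0r !addrA.
  by cancel a; cancel b; cancel c; cancel (Z s); cancel (Z t); cancel (Z u).
have Tg s t : 0 <= s -> s <= t -> t <= T -> (t - s) `^ gamma <= T `^ gamma.
  move=> s0 st tT; apply: powR_le; [exact: ltW|by rewrite subr_ge0|].
  by rewrite lerBlDr (le_trans tT)// lerDl.
(* Two of the three factors are bounded by powers of T, leaving one factor of either kind; this is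
   the form that [holder2_modulus] takes. *)
have dC s u t : 0 <= s -> s <= u -> u <= t -> t <= T ->
    nrm (delta2 M s u t) <= (C * (2 * T `^ gamma * T `^ gamma)) * (t - u) `^ gamma /\
    nrm (delta2 M s u t) <= (C * (2 * T `^ gamma * T `^ gamma)) * (u - s) `^ gamma.
  move=> s0 su ut tT.
  have hx := Tg u t (le_trans s0 su) ut tT; have hy := Tg s u s0 su (le_trans ut tT).
  have x0 := powR_ge0 (t - u) gamma; have y0 := powR_ge0 (u - s) gamma.
  have := MC s u t s0 su ut tT.
  move: hx hy x0 y0; set x := (t - u) `^ _; set y := (u - s) `^ _; set d := T `^ _.
  move=> hx hy x0 y0 hm.
  have k1 : y * (x + y) <= 2 * d * d.
    have -> : 2 * d * d = d * (d + d) by ring.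
    by rewrite ler_pM ?addr_ge0// lerD.
  have k2 : x * (x + y) <= 2 * d * d.
    have -> : 2 * d * d = d * (d + d) by ring.
    by rewrite ler_pM ?addr_ge0// lerD.
  split; rewrite (le_trans hm)// -(mulrA C) ler_wpM2l//.
    by rewrite -(mulrA x) mulrC ler_wpM2r.
  by rewrite (mulrC x) -(mulrA y) mulrC ler_wpM2r.
pose E := C * (2 * T `^ gamma * T `^ gamma).
have E0 : 0 <= E by rewrite mulr_ge0// !mulr_ge0// powR_ge0.
exists (3 * gamma) => //; split=> //.
- have C1E : 0 <= C1 + E by rewrite addr_ge0.
  have C1E4 : 0 <= 4 * (C1 + E) by rewrite mulr_ge0.
  apply: (C3_delta2 gamma0 C0 C1E4) => //.
  apply: (holder2_modulus gamma0 C1E).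
    move=> s t s0 st tT; rewrite (le_trans (MC1 _ _ s0 st tT))//.
    by rewrite ler_wpM2r ?powR_ge0// lerDl.
  move=> s u t s0 su ut tT; have [h1 h2] := dC s u t s0 su ut tT.
  by split; [apply: (le_trans h1)|apply: (le_trans h2)];
    rewrite ler_wpM2r ?powR_ge0// lerDr.
- pose E1 := K * T `^ (3 * gamma - gamma) + E.
  have E10 : 0 <= E1 by rewrite addr_ge0// mulr_ge0// powR_ge0.
  apply: (holder2_C2 gamma0 E10 K0) => //.
    move=> s t s0 st tT; rewrite (le_trans (hK _ _ s0 st tT))//.
    rewrite (@le_trans _ _ (K * T `^ (3 * gamma - gamma) * (t - s) `^ gamma))//.
      rewrite -mulrA ler_wpM2l//; apply: powR_interval_le.
      + exact: ltW.
      + by have := gamma0; lra.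
      + by rewrite subr_ge0.
      + by rewrite lerBlDr (le_trans tT)// lerDl.
    by rewrite ler_wpM2r ?powR_ge0// lerDl.
  move=> s u t s0 su ut tT; have [h1 h2] := dC s u t s0 su ut tT.
  rewrite dh; split; [apply: (le_trans h1)|apply: (le_trans h2)];
    by rewrite ler_wpM2r ?powR_ge0// lerDr mulr_ge0// powR_ge0.
Qed.

End RoughSewing.

Lemma fine_le_sum (R : realType) (x y : \bar R) : (0 <= x)%E -> (x <= y)%E ->
  (y < +oo)%E -> (x < +oo)%E /\ fine x <= fine y.
Proof.
move=> x0 xy yoo; have xoo := le_lt_trans xy yoo; split=> //.
by rewrite fine_le// ge0_fin_numE// (le_trans x0).
Qed.

(** * The rough integral *)

Section RoughIntegralTheory.
Context {R : realType} {A : vonNeumannAlgebra R} {X : R -> A}.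
Context {P2 : forall t, tensor2 (filtration X t)}.
Context {P3 : forall t, tensor3 (filtration X t)}.
Variables (T gamma : R) (L : forall s t : R, P2 s -> A).
Arguments L : clear implicits.
Hypothesis T0 : 0 < T.
Hypothesis gamma3 : 3^-1 < gamma.
Hypothesis hX : holder_path T gamma X.
Hypothesis hL : product_levy_area T gamma L.
Variables (U : forall t, P2 t) (U1 U2 : forall t, P3 t).
Hypothesis hU : bicontrolled T gamma U U1 U2.

Let gamma0 : 0 < gamma. Proof. by apply: lt_trans gamma3; rewrite invr_gt0. Qed.
Let NX := fine (norm2 `[0%R, T] gamma (fun s t => nrm (delta1 X s t))).
Let NL := fine (levy_norm T gamma L).
Let M := germ L U U1 U2.

Let NX0 : 0 <= NX. Proof. by rewrite fine_ge0// norm2_ge0. Qed.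
Let NL0 : 0 <= NL. Proof. exact: fine_levy_norm_ge0. Qed.

Lemma nrm_delta1_path s t : 0 <= s -> s <= t -> t <= T ->
  nrm (delta1 X s t) <= NX * (t - s) `^ gamma.
Proof.
move=> s0; rewrite le_eqVlt => /orP[/eqP<- _|st tT].
  by rewrite /delta1 subrr nrm0 mulr_ge0// powR_ge0.
apply: (norm2_bound (n := fun s t => nrm (delta1 X s t)) hX.2.2) => //.
  by rewrite /= in_itv/= s0 (le_trans _ tT)// ltW.
by rewrite /= in_itv/= tT (le_trans s0)// ltW.
Qed.

Section Interval.
Variables l1 l2 : R.
Hypotheses (l10 : 0 <= l1) (l12 : l1 <= l2) (l2T : l2 <= T).
Local Notation I := (`[l1, l2]%classic).
Let Q := fine (bicontrolled_norm gamma U U1 U2 I).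

Let IT : I `<=` `[0, T]%classic.
Proof.
move=> x; rewrite /= !in_itv/= => /andP[h1 h2].
by rewrite (le_trans l10)// (le_trans h2).
Qed.

Let bicontrolled_norm_ge0 : (0 <= bicontrolled_norm gamma U U1 U2 I)%E.
Proof. by rewrite /bicontrolled_norm !adde_ge0// ?norm2_ge0// ?norm0_ge0. Qed.

Lemma bicontrolled_norm_fin : (bicontrolled_norm gamma U U1 U2 I < +oo)%E.
Proof.
apply: le_lt_trans hU; rewrite /bicontrolled_norm.
by rewrite !leeD// ?norm2_subset// ?norm0_subset.
Qed.

Lemma fine_bicontrolled_norm_ge0 : 0 <= Q.
Proof. by rewrite fine_ge0. Qed.

Let component (x : \bar R) : (0 <= x)%E ->
  (x <= bicontrolled_norm gamma U U1 U2 I)%E -> (x < +oo)%E /\ fine x <= Q.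
Proof. by move=> x0 h; apply: fine_le_sum => //; exact: bicontrolled_norm_fin. Qed.

Let in_I s : l1 <= s -> s <= l2 -> I s.
Proof. by move=> h1 h2; rewrite /= in_itv/= h1. Qed.

Lemma bi_increment_le s t : l1 <= s -> s < t -> t <= l2 ->
  nrm (deltaP2 U s t) <= Q * (t - s) `^ gamma.
Proof.
move=> ls st tl.
have [|h1 h2] := @component (bi_norm gamma U I) (norm2_ge0 _ _ _).
  by rewrite /bicontrolled_norm -!addeA leeDl// !adde_ge0// ?norm2_ge0// ?norm0_ge0.
rewrite (le_trans (norm2_bound h1 (in_I ls (le_trans (ltW st) tl))
  (in_I (le_trans ls (ltW st)) tl) st))//.
by rewrite ler_wpM2r// powR_ge0.
Qed.

Lemma tri1_increment_le s t : l1 <= s -> s < t -> t <= l2 ->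
  nrm (deltaP3 U1 s t) <= Q * (t - s) `^ gamma.
Proof.
move=> ls st tl.
have [|h1 h2] := @component (tri_norm gamma U1 I) (norm2_ge0 _ _ _).
  apply: le_trans (leeDl _ _); last exact: norm2_ge0.
  apply: le_trans (leeDl _ _); last by rewrite adde_ge0 ?norm2_ge0 ?norm0_ge0.
  apply: le_trans (leeDr _ _); last exact: norm2_ge0.
  by rewrite leeDr// norm0_ge0.
rewrite (le_trans (norm2_bound h1 (in_I ls (le_trans (ltW st) tl))
  (in_I (le_trans ls (ltW st)) tl) st))//.
by rewrite ler_wpM2r// powR_ge0.
Qed.

Lemma tri2_increment_le s t : l1 <= s -> s < t -> t <= l2 ->
  nrm (deltaP3 U2 s t) <= Q * (t - s) `^ gamma.
Proof.
move=> ls st tl.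
have [|h1 h2] := @component (tri_norm gamma U2 I) (norm2_ge0 _ _ _).
  apply: le_trans (leeDl _ _); last exact: norm2_ge0.
  apply: le_trans (leeDr _ _); last by rewrite !adde_ge0 ?norm2_ge0 ?norm0_ge0.
  by rewrite leeDr// norm0_ge0.
rewrite (le_trans (norm2_bound h1 (in_I ls (le_trans (ltW st) tl))
  (in_I (le_trans ls (ltW st)) tl) st))//.
by rewrite ler_wpM2r// powR_ge0.
Qed.

Lemma bi_remainder_le s t : l1 <= s -> s < t -> t <= l2 ->
  nrm (bi_remainder U U1 U2 s t) <= Q * (t - s) `^ (2 * gamma).
Proof.
move=> ls st tl.
have [|h1 h2] := @component (norm2 I (2 * gamma)
    (fun s t => nrm (bi_remainder U U1 U2 s t))) (norm2_ge0 _ _ _).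
  by rewrite leeDr// !adde_ge0// ?norm2_ge0// ?norm0_ge0.
rewrite (le_trans (norm2_bound h1 (in_I ls (le_trans (ltW st) tl))
  (in_I (le_trans ls (ltW st)) tl) st))//.
by rewrite ler_wpM2r// powR_ge0.
Qed.

Let powI s t : l1 <= s -> s <= t -> t <= l2 -> (t - s) `^ gamma <= (l2 - l1) `^ gamma.
Proof.
move=> ls st tl; apply: powR_le; [exact: ltW|by rewrite subr_ge0|by rewrite lerB].
Qed.

(** This is why only the values at the left end point enter (iv): the supremum of W on I is traded
    for |W_{l1}| plus the Hoelder norm times |I|^gamma. *)
Lemma tri_le (W : forall t, P3 t) s :
  (forall s t, l1 <= s -> s < t -> t <= l2 ->
    nrm (deltaP3 W s t) <= Q * (t - s) `^ gamma) ->
  l1 <= s -> s <= l2 -> nrm (W s) <= nrm (W l1) + (l2 - l1) `^ gamma * Q.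
Proof.
move=> hW; rewrite le_eqVlt => /orP[/eqP<- _|ls sl].
  by rewrite lerDl mulr_ge0 ?powR_ge0// fine_bicontrolled_norm_ge0.
have -> : W s = incl3 s (W l1) + deltaP3 W l1 s by rewrite /deltaP3 subrKC.
rewrite (le_trans (nrmD _ _))// lerD//.
  by have := (incl3P (P3 := P3) (ltW ls)).1.2 (W l1); rewrite mul1r.
rewrite (le_trans (hW _ _ _ ls sl))// mulrC ler_wpM2r//.
  exact: fine_bicontrolled_norm_ge0.
by apply: powI => //; exact: ltW.
Qed.

Let u12 := nrm (U1 l1) + nrm (U2 l1) + 2 * ((l2 - l1) `^ gamma * Q).

Lemma tri_sum_le s : l1 <= s -> s <= l2 -> nrm (U1 s) + nrm (U2 s) <= u12.
Proof.
move=> ls sl; have := tri_le tri1_increment_le ls sl.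
have := tri_le tri2_increment_le ls sl; rewrite /u12; lra.
Qed.

Let u12_ge0 : 0 <= u12.
Proof.
by rewrite !addr_ge0 ?nrm_ge0// mulr_ge0// mulr_ge0 ?powR_ge0// fine_bicontrolled_norm_ge0.
Qed.

(** [bi_increment_le] would put N[U; Q(I; X)] into (iv) without the factor |I|^gamma. Expanding the
    increment by its decomposition gives either that factor or a norm at [l1]. *)
Lemma bi_increment_controlled_le s t : l1 <= s -> s < t -> t <= l2 ->
  nrm (deltaP2 U s t) <= (NX * u12 + (l2 - l1) `^ gamma * Q) * (t - s) `^ gamma.
Proof.
move=> ls st tl; have s0 := le_trans l10 ls; have tT := le_trans tl l2T.
have hd := delta1_in (X := X) s0 (ltW st).
have h1 := (lsharpP (P2 := P2) (P3 := P3) (ltW st) hd).1.2 (U1 s).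
have h2 := (rsharpP (P2 := P2) (P3 := P3) (ltW st) hd).1.2 (U2 s).
have h3 := bi_remainder_le ls st tl.
have h4 := nrm_delta1_path s0 (ltW st) tT.
have h5 := tri_sum_le ls (le_trans (ltW st) tl).
have -> : deltaP2 U s t = bi_remainder U U1 U2 s t + rsharp P2 t (U2 s) (delta1 X s t)
     + lsharp P2 t (delta1 X s t) (U1 s) by rewrite /bi_remainder subrK subrK.
rewrite (le_trans (nrmD _ _))//.
have h6 := nrmD (bi_remainder U U1 U2 s t) (rsharp P2 t (U2 s) (delta1 X s t)).
have h7 : nrm (delta1 X s t) * (nrm (U1 s) + nrm (U2 s)) <= NX * (t - s) `^ gamma * u12.
  by rewrite ler_pM ?nrm_ge0 ?addr_ge0 ?nrm_ge0.
have h8 : Q * (t - s) `^ (2 * gamma) <= (l2 - l1) `^ gamma * Q * (t - s) `^ gamma.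
  rewrite powR_double// expr2 mulrA ler_wpM2r ?powR_ge0// mulrC ler_wpM2r//.
    exact: fine_bicontrolled_norm_ge0.
  by apply: powI => //; exact: ltW.
lra.
Qed.

Lemma levy_terms_le s t : l1 <= s -> s <= t -> t <= l2 ->
  nrm (levy_id L t (U1 s) + id_levy_star L t (U2 s)) <= NL * u12 * (t - s) `^ (2 * gamma).
Proof.
move=> ls st tl; have s0 := le_trans l10 ls; have tT := le_trans tl l2T.
have K0 : 0 <= NL * (t - s) `^ (2 * gamma) by rewrite mulr_ge0// powR_ge0.
have hl := levy_bounded_linear hL s0 st tT.
have h1 := (levy_idP (P3 := P3) K0 hl).1.2 (U1 s).
have h2 := (id_levy_starP (P3 := P3) K0 hl).1.2 (U2 s).
have h5 := tri_sum_le ls (le_trans st tl).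
rewrite (le_trans (nrmD _ _))// mulrAC.
rewrite (le_trans (lerD h1 h2))// -mulrDr ler_wpM2l//.
Qed.

Lemma sharp_le (V : forall t, P2 t) s t : l1 <= s -> s <= t -> t <= l2 ->
  nrm (sharp (V s) (delta1 X s t)) <= NX * nrm (V s) * (t - s) `^ gamma.
Proof.
move=> ls st tl; have s0 := le_trans l10 ls; have tT := le_trans tl l2T.
rewrite (le_trans (nrm_sharp _ _))// mulrAC ler_wpM2r ?nrm_ge0//.
exact: nrm_delta1_path.
Qed.

Lemma germ_diag t : 0 <= t <= T -> M t t = 0.
Proof.
move=> /andP[t0 tT]; have K0 : 0 <= NL * (t - t) `^ (2 * gamma) by rewrite mulr_ge0// powR_ge0.
have hl := levy_bounded_linear hL t0 (lexx t) tT.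
have h1 := (levy_idP (P3 := P3) K0 hl).1.2 (U1 t).
have h2 := (id_levy_starP (P3 := P3) K0 hl).1.2 (U2 t).
have g20 : 2 * gamma != 0 by rewrite mulf_neq0// gt_eqF.
rewrite subrr powR0// mulr0 !mul0r in h1 h2.
by rewrite /M /germ /delta1 subrr sharp0r (nrm_le0 h1) (nrm_le0 h2) !addr0.
Qed.

Lemma germ_delta_le s u t : l1 <= s -> s <= u -> u <= t -> t <= l2 ->
  nrm (delta2 M s u t) <= (NX + 2 * NL) * Q *
    ((t - u) `^ gamma * (u - s) `^ gamma * ((t - u) `^ gamma + (u - s) `^ gamma)).
Proof.
move=> ls su ut tl; have s0 := le_trans l10 ls; have tT := le_trans tl l2T.
have Q0 := fine_bicontrolled_norm_ge0.
have u0 := le_trans s0 su; have uT := le_trans ut tT.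
have rhs0 : 0 <= (NX + 2 * NL) * Q *
    ((t - u) `^ gamma * (u - s) `^ gamma * ((t - u) `^ gamma + (u - s) `^ gamma)).
  rewrite mulr_ge0//; first by rewrite mulr_ge0// addr_ge0// mulr_ge0.
  by rewrite !mulr_ge0 ?addr_ge0 ?powR_ge0.
move: su; rewrite le_eqVlt => /orP[/eqP su|su].
  move: rhs0 uT; rewrite -su => rhs0 uT.
  by rewrite /delta2 germ_diag ?s0// subr0 subrr nrm0.
have K0 : 0 <= NL * (t - u) `^ (2 * gamma) by rewrite mulr_ge0// powR_ge0.
have hl := levy_bounded_linear hL u0 ut tT.
have h1 := (levy_idP (P3 := P3) K0 hl).1.2 (deltaP3 U1 s u).
have h2 := (id_levy_starP (P3 := P3) K0 hl).1.2 (deltaP3 U2 s u).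
have h3 := nrm_sharp (bi_remainder U U1 U2 s u) (delta1 X u t).
have ul := le_trans ut tl.
have h4 := nrm_delta1_path u0 ut tT.
have h5 := bi_remainder_le ls su ul.
have h6 := tri1_increment_le ls su ul.
have h7 := tri2_increment_le ls su ul.
rewrite (germ_delta hX.1 hL U U1 U2 s0 (ltW su) ut tT) nrmN.
rewrite !powR_double// in h1 h2 h5 K0 *.
move: h1 h2 h4 h5 h6 h7 K0 rhs0; set x := (t - u) `^ _; set y := (u - s) `^ _.
move=> h1 h2 h4 h5 h6 h7 K0 rhs0.
have x0 : 0 <= x by exact: powR_ge0.
have y0 : 0 <= y by exact: powR_ge0.
have k1 := le_trans h1 (ler_wpM2l K0 h6).
have k2 := le_trans h2 (ler_wpM2l K0 h7).
have k3 : nrm (delta1 X u t) * nrm (bi_remainder U U1 U2 s u) <= NX * x * (Q * y ^+ 2).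
  by rewrite ler_pM ?nrm_ge0.
have k4 := le_trans h3 k3.
have := nrmD (sharp (bi_remainder U U1 U2 s u) (delta1 X u t)
  + levy_id L t (deltaP3 U1 s u)) (id_levy_star L t (deltaP3 U2 s u)).
have := nrmD (sharp (bi_remainder U U1 U2 s u) (delta1 X u t)) (levy_id L t (deltaP3 U1 s u)).
(* The last bracket is the surplus that completes the actual bound to the symmetric form x y (x +
   y); it is nonnegative and is dropped. *)
have E : (NX + 2 * NL) * Q * (x * y * (x + y)) =
   NX * x * (Q * y ^+ 2) + 2 * (NL * x ^+ 2 * (Q * y)) +
   (NX * Q * (x ^+ 2 * y) + 2 * NL * Q * (x * y ^+ 2)) by ring.
have E0 : 0 <= NX * Q * (x ^+ 2 * y) + 2 * NL * Q * (x * y ^+ 2).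
  by rewrite addr_ge0// !mulr_ge0// exprn_ge0.
rewrite E; lra.
Qed.

End Interval.
End RoughIntegralTheory.

Section RoughPrimitive.
Context {R : realType} {A : vonNeumannAlgebra R} {X : R -> A}.
Context {P2 : forall t, tensor2 (filtration X t)}.
Context {P3 : forall t, tensor3 (filtration X t)}.
Variables (T gamma : R) (L : forall s t : R, P2 s -> A).
Arguments L : clear implicits.
Hypothesis T0 : 0 < T.
Hypothesis gamma3 : 3^-1 < gamma.
Hypothesis hX : holder_path T gamma X.
Hypothesis hL : product_levy_area T gamma L.
Variables (U : forall t, P2 t) (U1 U2 : forall t, P3 t).
Hypothesis hU : bicontrolled T gamma U U1 U2.

Let gamma0 : 0 < gamma. Proof. by apply: lt_trans gamma3; rewrite invr_gt0. Qed.
Let NX := fine (norm2 `[0%R, T] gamma (fun s t => nrm (delta1 X s t))).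
Let NL := fine (levy_norm T gamma L).
Let Q l1 l2 := fine (bicontrolled_norm gamma U U1 U2 `[l1, l2]).
Let M := germ L U U1 U2.
Let K := sew_const (3 * gamma).

Let NX0 : 0 <= NX. Proof. by rewrite fine_ge0// norm2_ge0. Qed.
Let NL0 : 0 <= NL. Proof. exact: fine_levy_norm_ge0. Qed.
Let K0 : 0 <= K. Proof. by apply: sew_const_ge0; have := gamma3; lra. Qed.
Let Q0 l1 l2 : 0 <= Q l1 l2. Proof. exact: fine_bicontrolled_norm_ge0. Qed.

(** N[U; Q(X)] contains no supremum of U itself; the bound comes from U_0 and the Hoelder norm on
    [0, T]. *)
Lemma bi_bounded : exists2 B, 0 <= B & forall s, 0 <= s <= T -> nrm (U s) <= B.
Proof.
exists (nrm (U 0) + Q 0 T * T `^ gamma).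
  by rewrite addr_ge0 ?nrm_ge0// mulr_ge0 ?powR_ge0.
move=> s /andP[s0 sT]; have [<-|sn] := eqVneq 0 s.
  by rewrite lerDl mulr_ge0// powR_ge0.
have sp : 0 < s by rewrite lt_neqAle sn.
have -> : U s = incl2 s (U 0) + deltaP2 U 0 s by rewrite /deltaP2 subrKC.
rewrite (le_trans (nrmD _ _))// lerD//.
  by have := (incl2P (P2 := P2) s0).1.2 (U 0); rewrite mul1r.
rewrite (le_trans (bi_increment_le hU (lexx 0) (lexx T) (lexx 0) sp sT))//.
apply: ler_wpM2l; first exact: Q0.
by apply: powR_le; rewrite ?subr0// ltW.
Qed.

Lemma germ_in s u t : 0 <= s -> s <= u -> u <= t -> t <= T -> filtration X t (M s u).
Proof.
move=> s0 su ut tT; have uT := le_trans ut tT.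
apply: (filtration_le ut).
have lB := subalgebra_lin (filtration_subalgebra X u).
have [<-|sn] := eqVneq s u.
  have sT : 0 <= s <= T by rewrite s0 (le_trans su).
  rewrite /M (germ_diag gamma3 hL U U1 U2 sT).
  exact: (subalgebra_lin (filtration_subalgebra X s)).1.
have su' : s < u by rewrite lt_neqAle sn.
have k0 : 0 <= NL * (u - s) `^ (2 * gamma) by rewrite mulr_ge0// powR_ge0.
have hl := levy_bounded_linear hL s0 su uT.
apply: (lin_subspaceD lB); first apply: (lin_subspaceD lB).
- by apply: sharp_in => //; exact: delta1_in.
- by apply: (levy_id_in _ k0 hl) => // V; exact: (levy_adapted hL).
- by apply: (id_levy_star_in _ k0 hl) => // V; exact: (levy_adapted hL).
Qed.

(** One process Z for all subintervals, each with the constant computed from the norm of U on that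
    subinterval. *)
Lemma rough_primitive : exists Z : R -> A,
  [/\ Z 0 = 0, adapted T X Z,
      sewn T (delta2 M) (fun s t => M s t - delta1 Z s t) &
      forall l1 l2, 0 <= l1 -> l2 <= T -> forall s t, l1 <= s -> s <= t -> t <= l2 ->
        nrm (delta1 Z s t - M s t) <=
        K * (2 * ((NX + 2 * NL) * Q l1 l2)) * (t - s) `^ (3 * gamma)].
Proof.
have [B B0 hB] := bi_bounded.
pose u12 := nrm (U1 0) + nrm (U2 0) + 2 * ((T - 0) `^ gamma * Q 0 T).
have u120 : 0 <= u12 by rewrite !addr_ge0 ?nrm_ge0// !mulr_ge0 ?powR_ge0.
have C0 l1 l2 : 0 <= (NX + 2 * NL) * Q l1 l2.
  by rewrite mulr_ge0// addr_ge0// mulr_ge0.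
pose C1 := NX * B + NL * u12 * T `^ gamma.
have C10 : 0 <= C1 by rewrite addr_ge0// !mulr_ge0// powR_ge0.
have MC l1 l2 : 0 <= l1 -> l2 <= T -> forall s u t, l1 <= s -> s <= u -> u <= t -> t <= l2 ->
   nrm (delta2 M s u t) <= (NX + 2 * NL) * Q l1 l2 * ((t - u) `^ gamma * (u - s) `^ gamma *
                                ((t - u) `^ gamma + (u - s) `^ gamma)).
  by move=> l10 l2T s u t ls su ut tl; exact: germ_delta_le.
have [t ht||Z [Z0 ZA Zb Zs]] := rough_sewing T0 gamma3 (C0 0 T) C10 _ _ (MC 0 T (lexx 0) (lexx T)).
- exact: (germ_diag gamma3 hL).
- move=> s t s0 st tT.
  have hs : 0 <= s <= T by rewrite s0 (le_trans st).
  rewrite /M /germ -addrA (le_trans (nrmD _ _))// mulrDl lerD//.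
    rewrite (le_trans (sharp_le hX (lexx 0) (lexx T) U s0 st tT))//.
    by rewrite ler_wpM2r ?powR_ge0// ler_wpM2l// hB.
  rewrite (le_trans (levy_terms_le gamma3 hL hU (lexx 0) (lexx T) s0 st tT))//.
  rewrite -/NL -/(Q 0 T) -/u12 powR_double// expr2 mulrA ler_wpM2r ?powR_ge0//.
  rewrite ler_wpM2l ?mulr_ge0// powR_le//; first exact: ltW.
    by rewrite subr_ge0.
  by rewrite lerBlDr (le_trans tT)// lerDl.
exists Z; split=> //.
- move=> t ht; apply: (ZA (filtration X)) => // [r|r|s u r].
  + exact: (subalgebra_lin (filtration_subalgebra X r)).
  + exact: (subalgebra_closed (filtration_subalgebra X r)).
  + exact: germ_in.
- by move=> l1 l2 l10 l2T s t ls st tl; apply: (Zb l1 l2) => //; exact: MC.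
Qed.

Section Primitive.
Variable Z : R -> A.
Hypothesis ZA : adapted T X Z.
Hypothesis Zs : sewn T (delta2 M) (fun s t => M s t - delta1 Z s t).
Hypothesis Zb : forall l1 l2, 0 <= l1 -> l2 <= T ->
  forall s t, l1 <= s -> s <= t -> t <= l2 ->
    nrm (delta1 Z s t - M s t) <=
    K * (2 * ((NX + 2 * NL) * Q l1 l2)) * (t - s) `^ (3 * gamma).

Lemma sewn_Lambda : sewn T (delta2 M) (Lambda T (delta2 M)).
Proof. exact: (xgetPex _ (ex_intro (sewn T (delta2 M)) _ Zs)). Qed.

(** [M - delta1 Z] is a sewn map, so by uniqueness it coincides on the simplex with the chosen
    [Lambda], and M cancels. *)
Lemma rough_integralE s t : simplex2 T (s, t) ->
  rough_integral T L U U1 U2 s t = delta1 Z s t.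
Proof.
move=> hst; rewrite /rough_integral (sewn_unique sewn_Lambda Zs hst).
by rewrite opprB addrC subrK.
Qed.

Section Bounds.
Variables l1 l2 : R.
Hypotheses (l10 : 0 <= l1) (l12 : l1 <= l2) (l2T : l2 <= T).
Let h := (l2 - l1) `^ gamma.
Let u12 := nrm (U1 l1) + nrm (U2 l1) + 2 * (h * Q l1 l2).
(** Hoelder constant of order 2 gamma of the remainder on I: the area terms, plus the sewing error
    after one of its three factors (t-s)^gamma is bounded by |I|^gamma. *)
Let N := NL * u12 + K * (2 * ((NX + 2 * NL) * (h * Q l1 l2))).

Let h0 : 0 <= h. Proof. exact: powR_ge0. Qed.
Let u120 : 0 <= u12.
Proof. by rewrite !addr_ge0 ?nrm_ge0// !mulr_ge0. Qed.

Lemma remainder_const_ge0 : 0 <= N.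
Proof.
have c0 : 0 <= NX + 2 * NL by rewrite addr_ge0// mulr_ge0.
have q0 : 0 <= h * Q l1 l2 by rewrite mulr_ge0.
by rewrite addr_ge0//; [exact: mulr_ge0|do 3! apply: mulr_ge0 => //].
Qed.

Lemma remainder_le s t : l1 <= s -> s <= t -> t <= l2 ->
  nrm (remainder Z U s t) <= N * (t - s) `^ (2 * gamma).
Proof.
move=> ls st tl.
have -> : remainder Z U s t = (delta1 Z s t - M s t) +
    (levy_id L t (U1 s) + id_levy_star L t (U2 s)).
  rewrite /remainder /M /germ; set a := sharp _ _; set b := levy_id _ _ _.
  by set c := id_levy_star _ _ _; rewrite -(addrA a) opprD (addrA (delta1 Z s t)) subrK.
rewrite (le_trans (nrmD _ _))// addrC /N mulrDl lerD//.
  exact: (levy_terms_le gamma3 hL hU l10 l2T).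
rewrite (le_trans (Zb l10 l2T ls st tl))//.
rewrite powR_triple// powR_double//.
have hd : (t - s) `^ gamma <= h.
  by apply: powR_le; [exact: ltW|by rewrite subr_ge0|by rewrite lerB].
have d0 := powR_ge0 (t - s) gamma; set d := (t - s) `^ gamma in hd d0 *.
have -> : K * (2 * ((NX + 2 * NL) * Q l1 l2)) * d ^+ 3 =
   K * (2 * ((NX + 2 * NL) * Q l1 l2)) * d ^+ 2 * d by ring.
have -> : K * (2 * ((NX + 2 * NL) * (h * Q l1 l2))) * d ^+ 2 =
   K * (2 * ((NX + 2 * NL) * Q l1 l2)) * d ^+ 2 * h by ring.
have c0 : 0 <= NX + 2 * NL by rewrite addr_ge0// mulr_ge0.
apply: ler_wpM2l => //; apply: mulr_ge0; last exact: exprn_ge0.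
by do 3! apply: mulr_ge0 => //.
Qed.

Lemma increment_le B s t : 0 <= B -> (forall s, l1 <= s <= l2 -> nrm (U s) <= B) ->
  l1 <= s -> s <= t -> t <= l2 ->
  nrm (delta1 Z s t) <= (NX * B + T `^ gamma * N) * (t - s) `^ gamma.
Proof.
move=> B0 hB ls st tl.
have -> : delta1 Z s t = sharp (U s) (delta1 X s t) + remainder Z U s t.
  by rewrite /remainder subrKC.
rewrite (le_trans (nrmD _ _))// mulrDl lerD//.
  rewrite (le_trans (sharp_le hX l10 l2T U ls st tl))// ler_wpM2r ?powR_ge0//.
  by rewrite ler_wpM2l// hB// ls (le_trans st).
rewrite (le_trans (remainder_le ls st tl))// powR_double// expr2.
rewrite mulrA (mulrC (T `^ gamma)) ler_wpM2r ?powR_ge0//.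
rewrite ler_wpM2l ?remainder_const_ge0// powR_le//; first exact: ltW.
  by rewrite subr_ge0.
rewrite lerBlDr (le_trans (le_trans tl l2T))// lerDl.
exact: le_trans ls.
Qed.

End Bounds.

Lemma primitive_C1_C2 :
  [/\ C1 T gamma Z, C2 T gamma (rough_integral T L U U1 U2) & C2 T (2 * gamma) (remainder Z U)].
Proof.
have [B B0 hB] := bi_bounded.
have := @increment_le 0 T (lexx 0) (lexx T) B _ _ B0 hB.
set C := (NX * B + _) => hZ.
have := @remainder_le 0 T (lexx 0) (lexx T).
have := @remainder_const_ge0 0 T; set N := (NL * _ + _) => N0 hR.
have C0 : 0 <= C by rewrite addr_ge0// ?mulr_ge0// powR_ge0.
have dJ s u t : delta2 (delta1 Z) s u t = 0.
  rewrite /delta2 /delta1; apply/eqP.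
  rewrite !(opprD, opprK) -[X in X == 0]add0r !addrA.
  by cancel (Z s); cancel (Z t); cancel (Z u).
split.
- split; first exact: (holder1_continuous gamma0 C0).
  rewrite (@le_lt_trans _ _ C%:E) ?ltry//; apply: norm2_le => // s t.
  rewrite /= !in_itv/= => /andP[s0 _] /andP[_ tT] st.
  by apply: hZ => //; exact: ltW.
- have E s t : 0 <= s -> s <= t -> t <= T ->
    rough_integral T L U U1 U2 s t = delta1 Z s t.
    by move=> s0 st tT; apply: rough_integralE; split.
  apply: (holder2_C2 gamma0 C0 C0).
  + by move=> s t s0 st tT; rewrite E// hZ.
  + move=> s u t s0 su ut tT.
    have -> : delta2 (rough_integral T L U U1 U2) s u t = delta2 (delta1 Z) s u t.
      rewrite /delta2 !E//; [exact: le_trans su|exact: le_trans tT|exact: le_trans ut].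
    by rewrite dJ nrm0; split; rewrite mulr_ge0// powR_ge0.
  + by move=> s t s0 st tT; rewrite E// hZ.
- pose D := N * T `^ gamma + NX * Q 0 T * T `^ gamma.
  have D1 : 0 <= N * T `^ gamma by rewrite mulr_ge0// powR_ge0.
  have D2 : 0 <= NX * Q 0 T * T `^ gamma by rewrite mulr_ge0 ?mulr_ge0// powR_ge0.
  have D0 : 0 <= D by rewrite addr_ge0.
  have Tg s t : 0 <= s -> s <= t -> t <= T -> (t - s) `^ gamma <= T `^ gamma.
    move=> s0 st tT; apply: powR_le; [exact: ltW|by rewrite subr_ge0|].
    by rewrite lerBlDr (le_trans tT)// lerDl.
  apply: (holder2_C2 gamma0 D0 N0) => // [s t s0 st tT|s u t s0 su ut tT].
    rewrite (le_trans (hR _ _ s0 st tT))// powR_double// expr2 mulrA.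
    rewrite ler_wpM2r ?powR_ge0// (@le_trans _ _ (N * T `^ gamma)) ?lerDl//.
    by rewrite ler_wpM2l// Tg.
  have u0 := le_trans s0 su; have uT := le_trans ut tT.
  (* delta of delta1 Z is zero, so only the variation of U against the increment of X is left; its
     two Hoelder factors give the continuity of the remainder. *)
  have -> : delta2 (remainder Z U) s u t = sharp (deltaP2 U s u) (delta1 X u t).
    rewrite /deltaP2 (blB (sharpP (P2 := P2) u _).1) sharp_incl//.
    rewrite /remainder /delta2.
    have -> : sharp (U s) (delta1 X s t) =
        sharp (U s) (delta1 X s u) + sharp (U s) (delta1 X u t).
      rewrite -[X in X + _]scale1r -sharpDr scale1r; congr (sharp _ _).
      by rewrite /delta1 [RHS]addrC addrA subrK.
    rewrite /delta1; set a := sharp (U s) _; set b := sharp (U s) _; set c := sharp _ _.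
    apply/eqP; rewrite -subr_eq0 !(opprD, opprK) -[X in X == 0]add0r !addrA.
    by cancel a; cancel b; cancel c; cancel (Z s); cancel (Z t); cancel (Z u).
  have hs : nrm (sharp (deltaP2 U s u) (delta1 X u t)) <=
      NX * (t - u) `^ gamma * (Q 0 T * (u - s) `^ gamma).
    rewrite (le_trans (nrm_sharp _ _))// ler_pM ?nrm_ge0//.
      exact: (nrm_delta1_path hX).
    move: su; rewrite le_eqVlt => /orP[/eqP<-|su].
      by rewrite /deltaP2 incl2_id subrr nrm0 mulr_ge0// powR_ge0.
    exact: (bi_increment_le hU (lexx 0) (lexx T)).
  have x0 := powR_ge0 (t - u) gamma; have y0 := powR_ge0 (u - s) gamma.
  split; rewrite (le_trans hs)//.
    have -> : NX * (t - u) `^ gamma * (Q 0 T * (u - s) `^ gamma) =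
       NX * Q 0 T * (u - s) `^ gamma * (t - u) `^ gamma by ring.
    rewrite ler_wpM2r// (le_trans (y := NX * Q 0 T * T `^ gamma)) ?lerDr//.
    by rewrite ler_wpM2l ?mulr_ge0// Tg.
  have -> : NX * (t - u) `^ gamma * (Q 0 T * (u - s) `^ gamma) =
     NX * Q 0 T * (t - u) `^ gamma * (u - s) `^ gamma by ring.
  rewrite ler_wpM2r// (le_trans (y := NX * Q 0 T * T `^ gamma)) ?lerDr//.
  by rewrite ler_wpM2l ?mulr_ge0// Tg.
Qed.

Lemma bi_norm0_fin l1 l2 : 0 <= l1 -> l2 <= T -> (bi_norm0 U `[l1, l2] < +oo)%E.
Proof.
move=> l10 l2T; have [B B0 hB] := bi_bounded.
rewrite (@le_lt_trans _ _ B%:E) ?ltry//; apply: norm0_le => // s.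
rewrite /= in_itv/= => /andP[ls sl].
by rewrite hB// (le_trans l10 ls) (le_trans sl).
Qed.

(** Origin of the constants, with S the last bracket and tau = T^gamma: B and h q are each at most
    S, which gives 2; NX B + NX u12 <= 3 NX S; the increment and the remainder contribute (1 + tau)
    N, where N <= (2 NL + 2 K (NX + 2 NL)) S. *)
Lemma controlled_norm_le l1 l2 : 0 <= l1 -> l1 <= l2 -> l2 <= T ->
  (controlled_norm gamma Z U `[l1, l2] <=
   (2%:E
    + (3 + 2 * K * (1 + T `^ gamma))%:E *
        norm2 `[0%R, T] gamma (fun s t => nrm (delta1 X s t))
    + ((1 + T `^ gamma) * (2 + 4 * K))%:E * levy_norm T gamma L) *
   (1 + bi_norm0 U `[l1, l2] + (nrm (U1 l1))%:E + (nrm (U2 l1))%:E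
    + ((l2 - l1) `^ gamma)%:E * bicontrolled_norm gamma U U1 U2 `[l1, l2]))%E.
Proof.
move=> l10 l12 l2T.
have EX : norm2 `[0%R, T] gamma (fun s t => nrm (delta1 X s t)) = NX%:E.
  by rewrite fineK// ge0_fin_numE ?norm2_ge0//; exact: hX.2.2.
have EL : levy_norm T gamma L = NL%:E.
  by rewrite fineK// ge0_fin_numE ?levy_norm_ge0//; exact: levy_finite hL.
have EQ : bicontrolled_norm gamma U U1 U2 `[l1, l2] = (Q l1 l2)%:E.
  rewrite fineK// ge0_fin_numE; first exact: (bicontrolled_norm_fin hU l10 l2T).
  by rewrite /bicontrolled_norm !adde_ge0// ?norm2_ge0// ?norm0_ge0.
pose B := fine (bi_norm0 U `[l1, l2]).
have EB : bi_norm0 U `[l1, l2] = B%:E.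
  by rewrite fineK// ge0_fin_numE ?norm0_ge0//; exact: bi_norm0_fin.
have B0 : 0 <= B by rewrite fine_ge0// norm0_ge0.
have hB s : l1 <= s <= l2 -> nrm (U s) <= B.
  move=> hs; apply: (norm0_bound (n := fun s => nrm (U s))).
    exact: bi_norm0_fin.
  by rewrite /= in_itv.
rewrite EX EL EQ EB.
set q := Q l1 l2; set h := (l2 - l1) `^ gamma; set tau := T `^ gamma.
set v1 := nrm (U1 l1); set v2 := nrm (U2 l1).
pose u12 := v1 + v2 + 2 * (h * q).
pose N := NL * u12 + K * (2 * ((NX + 2 * NL) * (h * q))).
have h0 : 0 <= h by exact: powR_ge0.
have tau0 : 0 <= tau by exact: powR_ge0.
have q0 : 0 <= q by exact: Q0.
have v10 : 0 <= v1 by exact: nrm_ge0.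
have v20 : 0 <= v2 by exact: nrm_ge0.
have hq0 : 0 <= h * q by rewrite mulr_ge0.
have N0 : 0 <= N by exact: remainder_const_ge0.
have u120 : 0 <= u12 by rewrite !addr_ge0// mulr_ge0.
have n1 : (norm2 `[l1, l2] gamma (fun s t => nrm (delta1 Z s t)) <= (NX * B + tau * N)%:E)%E.
  apply: norm2_le => [|s t].
    by rewrite addr_ge0// mulr_ge0.
  rewrite /= !in_itv/= => /andP[ls _] /andP[_ tl] st.
  by apply: (increment_le l10 l2T B0 hB) => //; exact: ltW.
have n2 : (bi_norm gamma U `[l1, l2] <= (NX * u12 + h * q)%:E)%E.
  apply: norm2_le => [|s t].
    by rewrite addr_ge0// mulr_ge0.
  rewrite /= !in_itv/= => /andP[ls _] /andP[_ tl] st.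
  exact: (bi_increment_controlled_le gamma3 hX hU l10 l2T).
have n3 : (norm2 `[l1, l2] (2 * gamma) (fun s t => nrm (remainder Z U s t)) <= N%:E)%E.
  apply: norm2_le => // s t.
  rewrite /= !in_itv/= => /andP[ls _] /andP[_ tl] st.
  by apply: (remainder_le l10 l2T) => //; exact: ltW.
rewrite /controlled_norm EB.
apply: (le_trans (leeD (leeD (leeD n1 (lexx _)) n2) n3)).
rewrite -!EFinM -!EFinD lee_fin.
pose S := 1 + B + v1 + v2 + h * q; rewrite -/S.
have S0 : 0 <= S by rewrite !addr_ge0.
have uS : u12 <= 2 * S by rewrite /u12 /S; lra.
have NS : N <= (2 * NL + K * (2 * (NX + 2 * NL))) * S.
  have a1 : NL * u12 <= NL * (2 * S) by rewrite ler_wpM2l.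
  have a2 : K * (2 * ((NX + 2 * NL) * (h * q))) <= K * (2 * ((NX + 2 * NL) * S)).
    rewrite ler_wpM2l// ler_wpM2l// ler_wpM2l ?addr_ge0 ?mulr_ge0//.
    by rewrite /S; lra.
  have -> : (2 * NL + K * (2 * (NX + 2 * NL))) * S =
    NL * (2 * S) + K * (2 * ((NX + 2 * NL) * S)) by ring.
  by rewrite lerD.
have k1 : NX * B <= NX * S by rewrite ler_wpM2l// /S; lra.
have k2 : NX * u12 <= NX * (2 * S) by rewrite ler_wpM2l.
have k3 : (1 + tau) * N <= (1 + tau) * ((2 * NL + K * (2 * (NX + 2 * NL))) * S).
  by rewrite ler_wpM2l// addr_ge0.
have k4 : B <= S by rewrite /S; lra.
have k5 : h * q <= S by rewrite /S; lra.
have -> : NX * B + tau * N + B + (NX * u12 + h * q) + N =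
   NX * B + (1 + tau) * N + B + NX * u12 + h * q by ring.
have -> : (2 + (3 + 2 * K * (1 + tau)) * NX + (1 + tau) * (2 + 4 * K) * NL) * S =
   NX * S + (1 + tau) * ((2 * NL + K * (2 * (NX + 2 * NL))) * S) + S + NX * (2 * S) + S.
  by ring.
lra.
Qed.

Lemma primitive_controlled : controlled T gamma Z U.
Proof.
have [h1 _ h3] := primitive_C1_C2; split=> //.
rewrite (le_lt_trans (controlled_norm_le (lexx 0) (ltW T0) (lexx T)))//.
have EX : norm2 `[0%R, T] gamma (fun s t => nrm (delta1 X s t)) = NX%:E.
  by rewrite fineK// ge0_fin_numE ?norm2_ge0//; exact: hX.2.2.
have EL : levy_norm T gamma L = NL%:E.
  by rewrite fineK// ge0_fin_numE ?levy_norm_ge0//; exact: levy_finite hL.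
have EQ : bicontrolled_norm gamma U U1 U2 `[0, T] = (Q 0 T)%:E.
  rewrite fineK// ge0_fin_numE; first exact: hU.
  by rewrite /bicontrolled_norm !adde_ge0// ?norm2_ge0// ?norm0_ge0.
have EB : bi_norm0 U `[0, T] = (fine (bi_norm0 U `[0, T]))%:E.
  by rewrite fineK// ge0_fin_numE ?norm0_ge0//; exact: bi_norm0_fin.
by rewrite EX EL EQ EB -!EFinM ltry.
Qed.

End Primitive.
End RoughPrimitive.

(** * The mean value inequality for the Bochner integral *)

Section IntegralMonotone.
Context d (T : measurableType d) (R : realType) (mu : {measure set T -> \bar R}).

(* The integral of a nonnegative function is a supremum over smaller simple
   functions, so monotonicity needs no measurability. *)
Lemma ge0_integral_le (D : set T) (f g : T -> \bar R) :
  (forall x, D x -> 0 <= f x)%E -> (forall x, D x -> f x <= g x)%E ->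
  (\int[mu]_(x in D) f x <= \int[mu]_(x in D) g x)%E.
Proof.
move=> f0 fg; have g0 x : D x -> (0 <= g x)%E.
  by move=> Dx; rewrite (le_trans (f0 x Dx))// fg.
rewrite !ge0_integralE//; apply: ereal_sup_le => _ [h /= hf <-].
exists h => //= x; rewrite (le_trans (hf x))//.
by rewrite /patch; case: ifPn => // /set_mem Dx; exact: fg.
Qed.

End IntegralMonotone.

Section RealIntegrals.
Context d (T : measurableType d) (R : realType) (mu : {measure set T -> \bar R}).
Variables (D : set T) (mD : measurable D).
Implicit Types f g : T -> R.

Lemma ge0_integral_addr f g : measurable_fun D f -> measurable_fun D g ->
  (forall x, D x -> 0 <= f x) -> (forall x, D x -> 0 <= g x) ->
  (\int[mu]_(x in D) (f x + g x)%:E =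
   \int[mu]_(x in D) (f x)%:E + \int[mu]_(x in D) (g x)%:E)%E.
Proof.
move=> mf mg f0 g0; under eq_integral do rewrite EFinD.
by apply: ge0_integralD => //; exact/measurable_EFinP.
Qed.

Lemma ge0_integral_mulr (k : R) f : measurable_fun D f ->
  (forall x, D x -> 0 <= f x) -> 0 <= k ->
  (\int[mu]_(x in D) (k * f x)%:E = k%:E * \int[mu]_(x in D) (f x)%:E)%E.
Proof.
move=> mf f0 k0; under eq_integral do rewrite EFinM.
by apply: ge0_integralZl => //; exact/measurable_EFinP.
Qed.

End RealIntegrals.

Section SimpleFunctions.
Context {R : realType} {V : normedModType R[i]}.
Local Notation mu := (@lebesgue_measure R).

Section FiniteSums.
Context {I : Type} (E : I -> set R) (c : I -> V).
Hypothesis mE : forall i, measurable (E i).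

(** [simple_fun] over a list: inductions remove one set E i at a time and split the domain along
    it. *)
Definition step_sum (r : seq I) (u : R) : V := \sum_(i <- r) (\1_(E i) u)%:C *: c i.

(** Measurability is available only for the real functions |f - x|. On D inside E i the vector c i
    is absorbed into x, outside it disappears; this is why x is generalized before the induction. *)
Lemma measurable_nrm_step_sum (f : R -> V) r (D : set R) : measurable D ->
  (forall x, measurable_fun D (fun u => nrm (f u - x))) ->
  measurable_fun D (fun u => nrm (f u - step_sum r u)).
Proof.
move=> mD hf; suff h x : measurable_fun D (fun u => nrm (f u - (x + step_sum r u))).
  by have := h 0; under eq_fun do rewrite add0r.
elim: r D mD hf x => [|i r IH] D mD hf x.
  under eq_fun do rewrite /step_sum big_nil addr0.
  exact: hf.
have h1 : D = (D `&` E i) `|` (D `\` E i) by rewrite setUIDK.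
have m1 : measurable (D `&` E i) by exact: measurableI.
have m2 : measurable (D `\` E i) by exact: measurableD.
rewrite h1; apply/measurable_funU => //; split.
- apply: (eq_measurable_fun (fun u => nrm (f u - (x + c i + step_sum r u)))).
    move=> u /set_mem[_ Eu]; congr (nrm (_ - _)).
    by rewrite /step_sum big_cons indicE mem_set//= scale1r addrA.
  by apply: IH => // y; apply: measurable_funS (hf y).
- apply: (eq_measurable_fun (fun u => nrm (f u - (x + step_sum r u)))).
    move=> u /set_mem[_ Eu]; congr (nrm (_ - _)).
    by rewrite /step_sum big_cons indicE memNset//= scale0r add0r.
  by apply: IH => // y; apply: measurable_funS (hf y).
Qed.

Lemma measurable_nrm_const_step_sum x r (D : set R) : measurable D ->
  measurable_fun D (fun u => nrm (x - step_sum r u)).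
Proof. by move=> mD; apply: (measurable_nrm_step_sum (f := fun=> x)) => // y; exact: measurable_cst. Qed.

(** The triangle inequality for the integral of a step function with values in V, by the same
    splitting of D along E i. *)
Lemma step_sum_integral_bound r x (D : set R) : measurable D -> (mu D < +oo)%E ->
  ((nrm ((fine (mu D))%:C *: x - \sum_(i <- r) (fine (mu (E i `&` D)))%:C *: c i))%:E
   <= \int[mu]_(u in D) (nrm (x - step_sum r u))%:E)%E.
Proof.
elim: r x D => [|i r IH] x D mD muD.
  rewrite big_nil subr0 nrmZr ger0_norm ?fine_ge0//.
  under eq_integral do rewrite /step_sum big_nil subr0.
  by rewrite integral_cst// muleC EFinM fineK// ge0_fin_numE.
set D1 := D `&` E i; set D2 := D `\` E i.
have m1 : measurable D1 by exact: measurableI.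
have m2 : measurable D2 by exact: measurableD.
have D12 : D = D1 `|` D2 by rewrite setUIDK.
have d12 : [disjoint D1 & D2].
  apply/disj_set2P; rewrite -subset0 => u [[_ h] [_ h']]; exact: h'.
have f1 : (mu D1 < +oo)%E by rewrite (le_lt_trans _ muD)// le_measure ?inE// => u [].
have f2 : (mu D2 < +oo)%E by rewrite (le_lt_trans _ muD)// le_measure ?inE// => u [].
have fin (B D' : set R) : measurable B -> measurable D' -> (mu D' < +oo)%E -> mu (B `&` D') \is a fin_num.
  move=> mB mD' h; rewrite ge0_fin_numE// (le_lt_trans _ h)// le_measure ?inE//.
    by exact: measurableI.
have split_mu (B : set R) : measurable B ->
    fine (mu (B `&` D)) = fine (mu (B `&` D1)) + fine (mu (B `&` D2)).
  move=> mB; rewrite -fineD ?fin//; congr fine.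
  rewrite D12 setIUr measureU//; [exact: measurableI|exact: measurableI|].
  by rewrite -subset0 => u [[_ [_ h]] [_ [_ h']]]; exact: h'.
have h1 := IH (x - c i) D1 m1 f1; have h2 := IH x D2 m2 f2.
have mf : measurable_fun (D1 `|` D2) (fun u => (nrm (x - step_sum (i :: r) u))%:E).
  by apply/measurable_EFinP; rewrite -D12; exact: measurable_nrm_const_step_sum.
have f0 u : (D1 `|` D2) u -> (0 <= (nrm (x - step_sum (i :: r) u))%:E)%E.
  by move=> _; rewrite lee_fin nrm_ge0.
rewrite [X in integral _ X]D12 (ge0_integral_setU mu m1 m2 mf f0 d12).
have -> : (\int[mu]_(u in D1) (nrm (x - step_sum (i :: r) u))%:E =
    \int[mu]_(u in D1) (nrm (x - c i - step_sum r u))%:E)%E.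
  apply: eq_integral => u /set_mem[_ Eu]; congr ((nrm _)%:E).
  by rewrite /step_sum big_cons indicE mem_set//= scale1r opprD addrA.
have -> : (\int[mu]_(u in D2) (nrm (x - step_sum (i :: r) u))%:E =
    \int[mu]_(u in D2) (nrm (x - step_sum r u))%:E)%E.
  apply: eq_integral => u /set_mem[_ Eu]; congr ((nrm _)%:E).
  by rewrite /step_sum big_cons indicE memNset//= scale0r add0r.
apply: le_trans (leeD h1 h2).
rewrite -EFinD lee_fin; apply: le_trans (nrmD _ _).
rewrite le_eqVlt; apply/orP; left; apply/eqP; congr nrm.
have E1 : fine (mu D) = fine (mu D1) + fine (mu D2).
  by have := split_mu setT (@measurableT _ _); rewrite !setTI.
have E2 : fine (mu (E i `&` D)) = fine (mu D1) by rewrite setIC.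
have E3 : \sum_(j <- r) (fine (mu (E j `&` D)))%:C *: c j =
    \sum_(j <- r) (fine (mu (E j `&` D1)))%:C *: c j +
    \sum_(j <- r) (fine (mu (E j `&` D2)))%:C *: c j.
  rewrite -big_split; apply: eq_bigr => j _ /=.
  by rewrite split_mu// rmorphD scalerDl.
rewrite big_cons E1 E2 E3 rmorphD /= scalerDl scalerBr.
set a := _ *: x; set b := _ *: x; set e := _ *: c i; set S1 := \sum_(j <- r) _.
set S2 := \sum_(j <- r) _.
apply/eqP; rewrite -subr_eq0 !(opprD, opprK) -[X in X == 0]add0r !addrA.
by cancel a; cancel b; cancel e; cancel S1; cancel S2.
Qed.

(** A measurable set is not open, but E i and its complement in D lie in open sets of slightly
    larger measure. Near a point of D the indicator can jump only on the excess W, which [w] pays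
    for. *)
Lemma step_sum_locally_constant_up_to r (D : set R) (e : R) : measurable D ->
  (mu D < +oo)%E -> 0 < e ->
  exists w : R -> R, [/\ measurable_fun setT w, forall u, 0 <= w u,
    (\int[mu]_(u in D) (w u)%:E <= e%:E)%E &
    forall t, D t -> \forall u \near t, D u -> nrm (step_sum r t - step_sum r u) <= w u].
Proof.
move=> mD muD; elim: r e => [|i r IH] e e0.
  exists (cst 0); split=> //.
    by rewrite integral0_eq// lee_fin ltW.
  by move=> t _; apply: filterE => u _; rewrite /step_sum !big_nil subrr nrm0.
have [w [mw w0 iw hw]] := IH _ (divr_gt0 e0 (ltr0Sn R 1)).
(* The excess has measure at most 2 d, so the new contribution 2 d |c i| is at most e / 2; the other
   half goes to the induction hypothesis. *)
pose d := e / (4 * (nrm (c i) + 1)).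
have n0 : 0 < nrm (c i) + 1 by rewrite ltr_wpDl// nrm_ge0.
have d0 : 0 < d by rewrite divr_gt0// mulr_gt0.
have m1 : measurable (D `&` E i) by exact: measurableI.
have m2 : measurable (D `\` E i) by exact: measurableD.
have f1 : (mu (D `&` E i) < +oo)%E by rewrite (le_lt_trans _ muD)// le_measure ?inE// => u [].
have f2 : (mu (D `\` E i) < +oo)%E by rewrite (le_lt_trans _ muD)// le_measure ?inE// => u [].
have [B1 [oB1 sB1 eB1]] := lebesgue_regularity_outer m1 f1 d0.
have [B2 [oB2 sB2 eB2]] := lebesgue_regularity_outer m2 f2 d0.
have mB1 : measurable (B1 `\` (D `&` E i)) by apply: measurableD => //; exact: open_measurable.
have mB2 : measurable (B2 `\` (D `\` E i)) by apply: measurableD => //; exact: open_measurable.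
pose W := (B1 `\` (D `&` E i)) `|` (B2 `\` (D `\` E i)).
have mW : measurable W by exact: measurableU.
have muW : (mu W <= (2 * d)%:E)%E.
  rewrite (le_trans (measureU2 _ _ _))// mulr_natl mulr2n EFinD.
  by rewrite leeD// ltW.
exists (fun u => w u + nrm (c i) * \1_W u); split.
- by apply: measurable_funD => //; apply: measurable_funM => //.
- by move=> u; rewrite addr_ge0// mulr_ge0 ?nrm_ge0.
- have mc : measurable_fun D (\1_W : R -> R) by exact: measurable_indic.
  rewrite ge0_integral_addr//; first last.
  + by move=> u _; rewrite mulr_ge0 ?nrm_ge0.
  + by apply: measurable_funM => //; exact: measurable_cst.
  + exact: measurable_funS mw.
  have E2 : (\int[mu]_(u in D) (nrm (c i) * \1_W u)%:E <= (e / 2)%:E)%E.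
    rewrite ge0_integral_mulr ?nrm_ge0//.
    rewrite integral_indic//.
    rewrite (@le_trans _ _ ((nrm (c i))%:E * (2 * d)%:E)%E)//.
      rewrite lee_wpmul2l ?lee_fin ?nrm_ge0// (le_trans _ muW)//.
      by rewrite le_measure ?inE//; exact: measurableI.
    rewrite -EFinM lee_fin /d.
    have -> : nrm (c i) * (2 * (e / (4 * (nrm (c i) + 1)))) =
       e / 2 * (nrm (c i) / (nrm (c i) + 1)) by field; rewrite gt_eqF.
    rewrite ler_piMr ?divr_ge0 ?(ltW e0)// ler_pdivrMr// mul1r lerDl//.
  rewrite (le_trans (leeD iw E2))// -EFinD -splitr//.
- move=> t Dt; have hw' := hw t Dt.
  have step : \forall u \near t, D u -> `|\1_(E i) t - \1_(E i) u| <= \1_W u :> R.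
    have [Et|Et] := pselect (E i t).
      have : \forall u \near t, B1 u by apply: open_nbhs_nbhs; split=> //; exact: sB1.
      apply: filterS => u O1u Du; rewrite !indicE (mem_set Et).
      have [Eu|Eu] := pselect (E i u); first by rewrite (mem_set Eu) subrr normr0.
      rewrite (memNset Eu) subr0 normr1 mem_set//.
      by left; split=> // -[_].
    have : \forall u \near t, B2 u by apply: open_nbhs_nbhs; split=> //; exact: sB2.
    apply: filterS => u O2u Du; rewrite !indicE (memNset Et).
    have [Eu|Eu] := pselect (E i u); last by rewrite (memNset Eu) subrr normr0.
    rewrite (mem_set Eu) sub0r normrN normr1 mem_set//.
    by right; split=> // -[_].
  move: hw' step; apply: filterS2 => u h1 h2 Du.
  rewrite /step_sum !big_cons opprD addrACA -scalerBl -rmorphB addrC.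
  rewrite (le_trans (nrmD _ _))// lerD ?h1// nrmZr mulrC ler_wpM2l ?nrm_ge0//.
  exact: h2.
Qed.

End FiniteSums.
End SimpleFunctions.

Section Majorant.
Context {R : realType}.
Local Notation mu := (@lebesgue_measure R).

(* Vitali-Caratheodory: cover the level sets of h by slightly larger open sets. *)
Lemma locally_dominating_majorant (h : R -> R) (D : set R) (e : R) :
  measurable D -> (mu D < +oo)%E -> measurable_fun D h -> (forall u, 0 <= h u) ->
  0 < e ->
  exists f : R -> \bar R, [/\ measurable_fun setT f, forall u, (0 <= f u)%E,
    (\int[mu]_(u in D) f u <= \int[mu]_(u in D) (h u)%:E + e%:E)%E &
    forall t, D t -> \forall u \near t, ((h t)%:E <= f u)%E].
Proof.
move=> mD muD mh h0 e0.
pose m := fine (mu D).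
have m0 : 0 <= m by rewrite fine_ge0.
have mE : mu D = m%:E by rewrite fineK// ge0_fin_numE.
(* Height of the levels: rounding h up to the next multiple of eta costs eta mu(D) <= e / 2. *)
pose eta := e / 2 / (m + 1).
have eta0 : 0 < eta by rewrite !divr_gt0// ltr_wpDl.
pose w (k : nat) : R := k.+1%:R * eta.
have w0 k : 0 < w k by rewrite mulr_gt0.
pose H (k : nat) := D `&` h @^-1` `[k%:R * eta, w k[%classic.
have mH k : measurable (H k) by exact: mh.
have HD k : H k `<=` D by move=> u [].
have fH k : (mu (H k) < +oo)%E.
  apply: le_lt_trans muD; apply: le_measure; rewrite ?inE; [exact: mH|exact: mD|exact: HD].
have DH : D = \bigcup_k H k.
  apply/seteqP; split=> [u Du|u [k _ /HD]//].
  exists (Num.truncn (h u / eta)) => //; split=> //=; rewrite in_itv/=.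
  have /andP[h1 h2] : (Num.truncn (h u / eta))%:R <= h u / eta < (Num.truncn (h u / eta)).+1%:R.
    by apply: truncn_itv; rewrite divr_ge0// ltW.
  by rewrite -ler_pdivlMr// h1 /w -ltr_pdivrMr.
have tH : trivIset setT H.
  apply/trivIsetP => i j _ _ ij; rewrite -subset0 => u [[_ /=]].
  rewrite in_itv/= => /andP[i1 i2] [_ /=]; rewrite in_itv/= => /andP[j1 j2].
  have lt1 : (i%:R : R) < j.+1%:R by rewrite -(ltr_pM2r eta0) (le_lt_trans i1).
  have lt2 : (j%:R : R) < i.+1%:R by rewrite -(ltr_pM2r eta0) (le_lt_trans j1).
  move: lt1 lt2; rewrite !ltr_nat !ltnS => h1 h2.
  by move: ij; rewrite eqn_leq h1 h2.
(* The costs of the open covers form a geometric series of sum e / 2; a cover with weight [w k] may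
   exceed [H k] by [d k / w k] in measure. *)
pose d (k : nat) : R := e / 2 / (2 ^ k.+1)%:R.
have d0 k : 0 < d k by rewrite !divr_gt0// ltr0n expn_gt0.
have /choice[G hG] k : exists B : set R,
    [/\ open B, H k `<=` B & (mu (B `\` H k) < (d k / w k)%:E)%E].
  by apply: lebesgue_regularity_outer; [exact: mH|exact: fH|rewrite divr_gt0].
have mG k : measurable (G k) by apply: open_measurable; have [] := hG k.
(* All terms are nonnegative, so at every point of the open set [G k] the sum is at least [w k],
   which exceeds h on [H k]. *)
pose f u : \bar R := (\sum_(k <oo) (w k * \1_(G k) u)%:E)%E.
have f0 k u : (0 <= (w k * \1_(G k) u)%:E)%E.
  by rewrite lee_fin mulr_ge0// ltW.
have mf k (B : set R) : measurable B -> measurable_fun B (fun u => (w k * \1_(G k) u)%:E).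
  move=> mB; apply/measurable_EFinP; apply: measurable_funM => //.
exists f; split.
- by apply: ge0_emeasurable_sum => // k _; exact: mf.
- by move=> u; apply: nneseries_ge0 => k _ _.
- rewrite integral_nneseries//; last by move=> k; exact: mf.
  have mh1 : measurable_fun D (fun u => h u + eta) by exact: measurable_funD.
  have bound k : (\int[mu]_(u in D) (w k * \1_(G k) u)%:E <=
      \int[mu]_(u in H k) (h u + eta)%:E + (d k)%:E)%E.
    have mi : measurable_fun D (\1_(G k) : R -> R) by exact: measurable_indic.
    rewrite ge0_integral_mulr//; last by rewrite ltW.
    rewrite integral_indic//; last exact: mG.
    have muO : (mu (G k `&` D) <= mu (H k) + (d k / w k)%:E)%E.
      have [Gopen HG muG] := hG k.
      have mGH : measurable (G k `\` H k) by apply: measurableD; [exact: mG|exact: mH].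
      apply: (@le_trans _ _ (mu (H k `|` (G k `\` H k)))).
        apply: le_measure; rewrite ?inE.
        - by apply: measurableI; [exact: mG|].
        - by apply: measurableU; [exact: mH|].
        - by move=> u [Gu _]; have [Hu|Hu] := pselect (H k u); [left|right].
      rewrite (le_trans (measureU2 _ _ _))//; first exact: mH.
      by rewrite leeD// ltW.
    rewrite (@le_trans _ _ ((w k)%:E * (mu (H k) + (d k / w k)%:E))%E)//.
      by rewrite lee_wpmul2l// lee_fin ltW.
    rewrite ge0_muleDr//; last by rewrite lee_fin ltW// divr_gt0.
    apply: leeD; last by rewrite -EFinM mulrC divfK// gt_eqF.
    rewrite -integral_cst; last exact: mH.
    apply: ge0_integral_le => u Hu; first by rewrite lee_fin ltW.
    have [_ /=] := Hu; rewrite in_itv/= => /andP[h1 _].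
    by rewrite lee_fin /w -natr1 mulrDl mul1r lerD2r.
  rewrite (@le_trans _ _ (\sum_(k <oo) (\int[mu]_(u in H k) (h u + eta)%:E + (d k)%:E))%E)//.
    apply: lee_nneseries => [k _ _|k _]; last exact: bound.
    by apply: integral_ge0 => u _; exact: f0.
  have e20 : 0 <= e / 2 by rewrite divr_ge0// ltW.
  have i0 k : (0 <= \int[mu]_(u in H k) (h u + eta)%:E)%E.
    by apply: integral_ge0 => u _; rewrite lee_fin addr_ge0// ltW.
  rewrite (le_trans (epsilon_trick xpredT i0 e20))//.
  have -> : (\sum_(k <oo) \int[mu]_(u in H k) (h u + eta)%:E =
      \int[mu]_(u in D) (h u + eta)%:E)%E.
    rewrite {1}DH ge0_integral_bigcup//.
      by rewrite -DH; exact/measurable_EFinP.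
    by move=> u _; rewrite lee_fin addr_ge0// ltW.
  rewrite ge0_integral_addr//; last by move=> *; exact: ltW.
  have ic : (\int[mu]_(_ in D) eta%:E = (eta * m)%:E)%E.
    by rewrite integral_cst// (EFinM eta m) -mE.
  rewrite ic -addeA leeD2l// -EFinD lee_fin.
  rewrite [leRHS](splitr e) lerD2r /eta.
  by rewrite mulrAC ler_pdivrMr ?ltr_wpDl// ler_wpM2l// lerDl.
- move=> t Dt; have : D t := Dt; rewrite DH => -[k _ Hk].
  have [Gopen HG _] := hG k.
  have : \forall u \near t, G k u by apply: open_nbhs_nbhs; split=> //; exact: HG.
  apply: filterS => u Gu.
  rewrite (@le_trans _ _ (w k * \1_(G k) u)%:E)//.
    rewrite indicE mem_set// mulr1 lee_fin.
    by have [_ /=] := Hk; rewrite in_itv/= => /andP[_ /ltW].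
  by rewrite /f (@nneseriesD1 _ _ k)// leeDl// nneseries_ge0.
Qed.
End Majorant.

Section MeanValue.
Context {R : realType} {V : normedModType R[i]}.
Local Notation mu := (@lebesgue_measure R).
Implicit Types (a b s t u v x y : R).

Lemma itvco_split a s t : a <= s -> s <= t ->
  `[a, t[%classic = `[a, s[%classic `|` `[s, t[%classic /\
  [disjoint `[a, s[%classic & `[s, t[%classic].
Proof.
move=> as' st; split.
  apply/seteqP; split=> x /=; rewrite !in_itv/=.
    by case: (ltP x s) => [xs /andP[-> _]|sx /andP[_ ->]]; [left|right].
  by case=> /andP[h1 h2]; [rewrite h1 (lt_le_trans h2)|rewrite h2 (le_trans as')].
apply/disj_set2P; rewrite -subset0 => x [] /=; rewrite !in_itv/= => /andP[_ h1] /andP[h2 _].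
by move: h1; rewrite ltNge h2.
Qed.

Lemma integral_itvco_split (psi : R -> \bar R) a s t : a <= s -> s <= t ->
  measurable_fun `[a, t[%classic psi -> (forall u, 0 <= psi u)%E ->
  (\int[mu]_(u in `[a, t[%classic) psi u =
   \int[mu]_(u in `[a, s[%classic) psi u + \int[mu]_(u in `[s, t[%classic) psi u)%E.
Proof.
move=> as' st mpsi psi0; have [E D] := itvco_split as' st.
rewrite E ge0_integral_setU//; by rewrite -E.
Qed.

(* The supremum of the points up to which the bound holds is b. *)
Lemma increment_le_integral (F : R -> V) (psi : R -> \bar R) a b : a <= b ->
  measurable_fun `[a, b[%classic psi -> (forall u, 0 <= psi u)%E ->
  (forall t e, a <= t <= b -> 0 < e -> exists2 d, 0 < d &
     forall u, a <= u <= t -> t - u < d -> nrm (F t - F u) < e) ->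
  (forall t, a <= t < b -> exists2 d, 0 < d &
     forall v, t < v -> v < t + d -> v <= b ->
       ((nrm (F v - F t))%:E <= \int[mu]_(u in `[t, v[%classic) psi u)%E) ->
  ((nrm (F b - F a))%:E <= \int[mu]_(u in `[a, b[%classic) psi u)%E.
Proof.
move=> ab mpsi psi0 cF step.
have mS c v : a <= c -> v <= b -> measurable_fun `[c, v[%classic psi.
  move=> ac vb; apply: measurable_funS mpsi => // u /=; rewrite !in_itv/= => /andP[h1 h2].
  by rewrite (le_trans ac)// (lt_le_trans h2).
pose P v := ((nrm (F v - F a))%:E <= \int[mu]_(u in `[a, v[%classic) psi u)%E.
pose S := [set v | a <= v <= b /\ P v].
have Sa : S a.
  split; first by rewrite lexx.
  by rewrite /P subrr nrm0; apply: integral_ge0.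
have Sb : has_sup S.
  by split; [exists a|exists b => v [/andP[]]].
pose c := sup S.
have ac : a <= c by apply: ub_le_sup => //; exact: Sb.2.
have cb : c <= b by apply: ge_sup; [exists a|move=> v [/andP[]]].
(* The bound passes to the supremum: F is left continuous and the integral of a nonnegative function
   grows with the interval. *)
have Pc : P c.
  apply/lee_addgt0Pr => e e0.
  have [|d d0 hd] := cF c e _ e0; first by rewrite ac.
  have [v [hv Pv] cv] := sup_adherent d0 Sb; have /andP[av vb] := hv.
  have vc : v <= c by apply: ub_le_sup => //; exact: Sb.2.
  rewrite (@le_trans _ _ ((nrm (F v - F a))%:E + e%:E)%E)//.
    rewrite -EFinD lee_fin (le_trans (nrm_triB _ (F v) _))// addrC lerD2l ltW//.
    by apply: hd; [rewrite av|rewrite ltrBlDr -ltrBlDl].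
  rewrite leeD2r// (le_trans Pv)//.
  rewrite (integral_itvco_split av vc)//; last exact: mS.
  by rewrite leeDl// integral_ge0.
suff -> : b = c by [].
apply/eqP; rewrite eq_le cb andbT leNgt; apply/negP => cb'.
have [|d d0 hd] := step c; first by rewrite ac.
pose v := Num.min b (c + d / 2).
have cv : c < v by rewrite lt_min cb' ltrDl divr_gt0.
have vb : v <= b by rewrite ge_min lexx.
have Sv : S v.
  split; first by rewrite (ltW (le_lt_trans ac cv)).
  rewrite /P (@le_trans _ _ ((nrm (F v - F c))%:E + (nrm (F c - F a))%:E)%E)//.
    by rewrite -EFinD lee_fin nrm_triB.
  rewrite (integral_itvco_split ac (ltW cv))//; last exact: mS.
  rewrite addeC leeD//; apply: hd => //.
  by rewrite gt_min; apply/orP; right; rewrite ltrD2l gtr_pMr// invf_lt1// ltr1n.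
have : v <= c by apply: ub_le_sup => //; exact: Sb.2.
by rewrite leNgt cv.
Qed.

Lemma mu_itvco a b : a <= b -> mu `[a, b[%classic = (b - a)%:E.
Proof.
move=> ab; rewrite lebesgue_measure_itv/= lte_fin.
case: ltP => // ba; have -> : a = b by apply/le_anti; rewrite ab.
by rewrite subrr.
Qed.

Section FundamentalTheorem.
Context {I : Type} (E : I -> set R) (c : I -> V) (r : seq I).
Hypothesis mE : forall i, measurable (E i).
Variables (X X' : R -> V) (a b : R).
Hypothesis ab : a <= b.
Hypothesis X_cont : forall t e, a <= t <= b -> 0 < e -> exists2 d, 0 < d &
  forall u, a <= u <= t -> t - u < d -> nrm (X t - X u) < e.
Hypothesis X_der : forall t e, a <= t < b -> 0 < e -> exists2 d, 0 < d &
  forall v, t < v -> v < t + d -> v <= b ->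
    nrm (X v - X t - (v - t)%:C *: X' t) <= e * (v - t).
Hypothesis mX' : forall x : V, measurable_fun `[a, b[%classic (fun u => nrm (X' u - x)).

Let I0 s t := \sum_(i <- r) (fine (mu (E i `&` `[s, t[)))%:C *: c i.

Let I0_split s t : a <= s -> s <= t -> I0 a t = I0 a s + I0 s t.
Proof.
move=> as' st; rewrite /I0 -big_split; apply: eq_bigr => i _ /=.
rewrite -scalerDl -rmorphD; congr (_%:C *: _).
have [D dis] := itvco_split as' st.
have fin s' t' : s' <= t' -> mu (E i `&` `[s', t'[) \is a fin_num.
  move=> st'; rewrite ge0_fin_numE//.
  rewrite (@le_lt_trans _ _ (mu `[s', t'[%classic))//; last by rewrite mu_itvco// ltry.
  apply: le_measure; rewrite ?inE; [|exact: measurable_itv|by move=> u []].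
  by apply: measurableI; [exact: mE|exact: measurable_itv].
rewrite -fineD ?fin// D setIUr measureU//; [apply: measurableI; [exact: mE|exact: measurable_itv]|apply: measurableI; [exact: mE|exact: measurable_itv]|].
rewrite -subset0 => u [[_ h1] [_ h2]].
by move/disj_set2P: dis; rewrite -subset0; apply.
Qed.

(** Near t the increment of X is (v - t) X'_t up to e (v - t), and X'_t must be compared with the
    step function at the other points u. The majorant [phi] handles X'_t - G_t and [w] the change
    from G_t to G_u. *)
Lemma increment_sub_step_sum_le :
  ((nrm (X b - X a - I0 a b))%:E <=
   \int[mu]_(u in `[a, b[%classic) (nrm (X' u - step_sum E c r u))%:E)%E.
Proof.
apply/lee_addgt0Pr => e0 e00.
have ba1 : 0 < b - a + 2 by rewrite ltr_wpDl// subr_ge0.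
(* The majorant, the jumps and the difference quotient cost e, e and e (b - a). *)
pose e := e0 / (b - a + 2).
have ep : 0 < e by rewrite divr_gt0.
have mD : measurable `[a, b[%classic by exact: measurable_itv.
have muD : (mu `[a, b[%classic < +oo)%E by rewrite mu_itvco// ltry.
have mh := measurable_nrm_step_sum c mE r mD mX'.
have [phi [mphi phi0 iphi hphi]] := locally_dominating_majorant mD muD mh
   (fun u => nrm_ge0 _) ep.
have [w [mw w0 iw hw]] := step_sum_locally_constant_up_to c mE r mD muD ep.
pose psi u : \bar R := (phi u + ((w u)%:E + e%:E))%E.
have mwe : measurable_fun setT (fun u => (w u)%:E + e%:E)%E.
  by apply/measurable_EFinP; apply: measurable_funD => //; exact: measurable_cst.
have mpsi : measurable_fun setT psi by exact: emeasurable_funD.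
have we0 u : (0 <= (w u)%:E + e%:E)%E by rewrite -EFinD lee_fin addr_ge0// ltW.
have psi0 u : (0 <= psi u)%E by rewrite adde_ge0.
pose F x := X x - X a - I0 a x.
have Fa : F a = 0.
  rewrite /F subrr sub0r /I0 big1 ?oppr0// => i _.
  by rewrite set_itvco0 setI0 measure0/= scale0r.
have FB s t : a <= s -> s <= t -> F t - F s = X t - X s - I0 s t.
  move=> as' st; rewrite /F (I0_split as' st).
  set x := I0 a s; set y := I0 s t.
  apply/eqP; rewrite -subr_eq0 !(opprD, opprK) -[X in X == 0]add0r !addrA.
  by cancel (X t); cancel (X s); cancel (X a); cancel x; cancel y.
have main : ((nrm (F b - F a))%:E <= \int[mu]_(u in `[a, b[%classic) psi u)%E.
  apply: increment_le_integral => //.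
  - exact: measurable_funS mpsi.
  - move=> t e1 htb e10.
    pose C := \sum_(i <- r) nrm (c i).
    have C0 : 0 <= C by rewrite sumr_ge0// => i _; exact: nrm_ge0.
    have [d d0 hd] := X_cont htb (divr_gt0 e10 (ltr0Sn R 1)).
    have C1 : 0 < C + 1 by rewrite ltr_wpDl.
    exists (Num.min d (e1 / 2 / (C + 1))); first by rewrite lt_min d0 !divr_gt0.
    move=> u /andP[au ut]; rewrite lt_min => /andP[h1 h2].
    rewrite (FB u t au ut) (le_lt_trans (nrmBD _ _))// (splitr e1) ltrD//.
      by rewrite hd// au.
    have tu0 : 0 <= t - u by rewrite subr_ge0.
    rewrite (@le_lt_trans _ _ ((t - u) * C))//; last first.
      move: h2; rewrite ltr_pdivlMr//; apply: le_lt_trans.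
      by rewrite ler_wpM2l// lerDl.
    rewrite /C mulr_sumr (le_trans (nrm_sum _ _ _))//; apply: ler_sum => i _.
    rewrite nrmZr ger0_norm ?fine_ge0// ler_wpM2r ?nrm_ge0//.
    rewrite -lee_fin fineK.
      rewrite -mu_itvco//; apply: le_measure; rewrite ?inE; [|exact: measurable_itv|by move=> x []].
      by apply: measurableI; [exact: mE|exact: measurable_itv].
    rewrite ge0_fin_numE//.
    rewrite (@le_lt_trans _ _ (mu `[u, t[%classic))//; last by rewrite mu_itvco// ltry.
    apply: le_measure; rewrite ?inE; [|exact: measurable_itv|by move=> x []].
    by apply: measurableI; [exact: mE|exact: measurable_itv].
  - move=> t htb; have /andP[at' tb] := htb.
    have Dt : `[a, b[%classic t by rewrite /= in_itv/= at'.
    have [d1 d10 hd1] := X_der htb ep.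
    have /nbhs_ballP[d2 /= d20 hd2] := hphi t Dt.
    have /nbhs_ballP[d3 /= d30 hd3] := hw t Dt.
    exists (Num.min d1 (Num.min d2 d3)); first by rewrite !lt_min d10 d20.
    move=> v tv; rewrite -ltrBlDl !lt_min => /and3P[vd1 vd2 vd3] vb.
    rewrite (FB t v at' (ltW tv)).
    have vt0 : 0 <= v - t by rewrite subr_ge0 ltW.
    have mtv : measurable `[t, v[%classic by exact: measurable_itv.
    have mutv : (mu `[t, v[%classic < +oo)%E by rewrite mu_itvco ?ltry// ltW.
    have sb := step_sum_integral_bound c mE r (X' t) mtv mutv.
    rewrite mu_itvco ?(ltW tv)// in sb.
    rewrite (@le_trans _ _ ((nrm (X v - X t - (v - t)%:C *: X' t))%:E +
       (nrm ((v - t)%:C *: X' t - I0 t v))%:E)%E)//.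
      by rewrite -EFinD lee_fin nrm_triB.
    rewrite (@le_trans _ _ ((e * (v - t))%:E + \int[mu]_(u in `[t, v[%classic) (nrm (X' t - step_sum E c r u))%:E)%E)//.
      by rewrite leeD// lee_fin hd1// -ltrBlDl.
    rewrite (@le_trans _ _ ((e * (v - t))%:E + \int[mu]_(u in `[t, v[%classic) (phi u + (w u)%:E))%E)//.
      rewrite leeD2l//; apply: ge0_integral_le => u; first by rewrite lee_fin nrm_ge0.
      rewrite /= in_itv/= => /andP[tu uv].
      have ut : u - t < v - t by rewrite ltrD2r.
      have hu1 : ((nrm (X' t - step_sum E c r t))%:E <= phi u)%E.
        by apply: hd2; rewrite /ball/= distrC ger0_norm ?subr_ge0// (lt_trans ut).
      have hu2 : `[a, b[%classic u -> nrm (step_sum E c r t - step_sum E c r u) <= w u.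
        by apply: hd3; rewrite /ball/= distrC ger0_norm ?subr_ge0// (lt_trans ut).
      have Du : `[a, b[%classic u.
        by rewrite /= in_itv/= (le_trans at')// (lt_le_trans uv).
      rewrite (@le_trans _ _ ((nrm (X' t - step_sum E c r t))%:E + (nrm (step_sum E c r t - step_sum E c r u))%:E)%E)//.
        by rewrite -EFinD lee_fin nrm_triB.
      by rewrite leeD// lee_fin hu2.
    rewrite le_eqVlt; apply/orP; left; apply/eqP.
    have -> : (e * (v - t))%:E = (\int[mu]_(u in `[t, v[%classic) cst e%:E u)%E.
      by rewrite integral_cst// EFinM -mu_itvco// ltW.
    rewrite -ge0_integralD//.
    + by apply: eq_integral => u _; rewrite /= /psi addeC addeA.
    + by move=> u _; rewrite lee_fin ltW.
    + by move=> u _; rewrite adde_ge0// lee_fin.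
    + apply: emeasurable_funD; first exact: measurable_funS mphi.
      by apply/measurable_EFinP; exact: measurable_funS mw.
rewrite Fa subr0 in main; rewrite (le_trans main)//.
rewrite ge0_integralD//; first last.
- exact: measurable_funS mwe.
- exact: measurable_funS mphi.
rewrite ge0_integral_addr//; first last.
- by move=> *; exact: ltW.
- exact: measurable_funS mw.
have ic : (\int[mu]_(_ in `[a, b[%classic) e%:E = (e * (b - a))%:E)%E.
  by rewrite integral_cst// (EFinM e) -mu_itvco.
rewrite ic.
apply: (le_trans (leeD iphi (leeD2r _ iw))).
rewrite -addeA leeD2l// -!EFinD lee_fin.
have -> : e + (e + e * (b - a)) = e * (b - a + 2) by ring.
by rewrite /e divfK// gt_eqF.
Qed.

End FundamentalTheorem.
End MeanValue.

(** * Difference quotients and measurability of the derivative *)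

Section Derivative.
Context {R : realType} {V : completeNormedModType R[i]}.
Variables (T gamma N : R) (X X' : R -> V).
Hypothesis gamma0 : 0 < gamma.
Hypothesis T0 : 0 < T.
Hypothesis N0 : 0 <= N.
Hypothesis XN : forall s t, 0 <= s -> s <= t -> t <= T ->
  nrm (X t - X s) <= N * (t - s) `^ gamma.
Hypothesis dX : is_derivative T X X'.

Lemma derivative_quotient t e : 0 <= t <= T -> 0 < e -> exists2 d : R, 0 < d &
  forall v, 0 <= v <= T -> v != t -> `|t - v| < d ->
    nrm (X' t - ((v - t)^-1)%:C *: (X v - X t)) < e.
Proof.
move=> ht e0; have /cvg_nrmP/(_ e e0) := dX ht.
rewrite near_withinE near_withinE => /nbhs_ballP[d /= d0 hd].
by exists d => // v hv vt tv; apply: hd => //.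
Qed.

Lemma derivative_right t e : 0 <= t <= T -> 0 < e -> exists2 d : R, 0 < d &
  forall v, t < v -> v < t + d -> v <= T ->
    nrm (X v - X t - (v - t)%:C *: X' t) <= e * (v - t).
Proof.
move=> ht e0; have [d d0 hd] := derivative_quotient ht e0.
exists d => // v tv vd vT.
have vt0 : 0 < v - t by rewrite subr_gt0.
have -> : X v - X t - (v - t)%:C *: X' t =
    - ((v - t)%:C *: (X' t - ((v - t)^-1)%:C *: (X v - X t))).
  rewrite scalerBr scalerA -rmorphM mulfV ?gt_eqF// rmorph1 scale1r.
  by rewrite opprB.
rewrite nrmN nrmZr gtr0_norm// mulrC; apply: ler_wpM2r; first exact: ltW.
apply/ltW/hd; last by rewrite distrC gtr0_norm// ltrBlDl.
  by case/andP: ht => t0 _; rewrite vT (le_trans t0)// ltW.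
by rewrite gt_eqF.
Qed.

Lemma left_continuous a t e : 0 <= a -> t <= T -> 0 < e -> exists2 d, 0 < d &
  forall u, a <= u <= t -> t - u < d -> nrm (X t - X u) < e.
Proof.
move=> a0 tT e0.
have N1 : 0 < N + 1 by rewrite ltr_wpDl.
have [d d0 hd] := powR_small gamma0 (divr_gt0 e0 N1).
exists d => // u /andP[au ut] tud; have tu0 : 0 <= t - u by rewrite subr_ge0.
have := hd _ tu0 tud; rewrite ltr_pdivlMr// => h.
rewrite (le_lt_trans (XN (le_trans a0 au) ut tT))// (le_lt_trans _ h)//.
by rewrite mulrC ler_wpM2l ?powR_ge0// lerDl.
Qed.

(** Composed with [clamp], the path becomes Hoelder on the whole line, so its forward difference
    quotients are continuous everywhere. *)
Let clamp u := Num.max 0 (Num.min T u).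
Let Y u := X (clamp u).

Let clamp_itv u : 0 <= clamp u <= T.
Proof.
apply/andP; split; first by rewrite le_max lexx.
by rewrite ge_max (ltW T0) ge_min lexx.
Qed.

Let clamp_id u : 0 <= u <= T -> clamp u = u.
Proof. by move=> /andP[u0 uT]; rewrite /clamp (min_idPr uT) (max_idPr u0). Qed.

Let clamp_dist u v : u <= v -> 0 <= clamp v - clamp u <= v - u.
Proof.
move=> uv; have := T0; rewrite /clamp.
case: (leP T u) => h1; case: (leP T v) => h2; case: (leP 0 T) => h3;
  case: (leP 0 u) => h4; case: (leP 0 v) => h5; lra.
Qed.

Let Y_mod u v : nrm (Y u - Y v) <= N * `|u - v| `^ gamma.
Proof.
wlog uv : u v / u <= v => [h|].
  by case: (leP u v) => [/h//|/ltW/h]; rewrite nrmB (distrC v).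
have /andP[h1 h2] := clamp_dist uv.
have /andP[u0 uT] := clamp_itv u; have /andP[v0 vT] := clamp_itv v.
have cuv : clamp u <= clamp v by rewrite -subr_ge0.
rewrite nrmB (le_trans (XN u0 cuv vT))// ler_wpM2l//.
apply: powR_le => //; first exact: ltW.
by rewrite (distrC u) ger0_norm// subr_ge0.
Qed.

Let quotient_continuous (x : V) (n : nat) :
  continuous (fun u : R => nrm (n.+1%:R *: (Y (u + n.+1%:R^-1) - Y u) - x)).
Proof.
move=> u; apply/cvgrPdist_lt => e e0.
pose C := n.+1%:R * (2 * N).
have C0 : 0 <= C by rewrite mulr_ge0// mulr_ge0.
have C1 : 0 < C + 1 by rewrite ltr_wpDl.
have [d d0 hd] := powR_small gamma0 (divr_gt0 e0 C1).
apply/nbhs_ballP; exists d => //= v uv.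
have := hd _ (normr_ge0 _) uv; rewrite ltr_pdivlMr// => h.
apply: le_lt_trans h.
have nrm_dist (y z : V) : `|nrm y - nrm z| <= nrm (y - z).
  rewrite ler_norml; have := nrm_triB y z 0; have := nrm_triB z y 0.
  by rewrite !subr0 (nrmB z); lra.
rewrite (le_trans (nrm_dist _ _))//.
have -> : n.+1%:R *: (Y (u + n.+1%:R^-1) - Y u) - x - (n.+1%:R *: (Y (v + n.+1%:R^-1) - Y v) - x) =
   n.+1%:R%:C *: ((Y (u + n.+1%:R^-1) - Y (v + n.+1%:R^-1)) - (Y u - Y v)).
  rewrite rmorph_nat opprB addrA subrK -scalerBr; congr (_ *: _).
  set a := Y (u + _); set b := Y (v + _).
  apply/eqP; rewrite -subr_eq0 !(opprD, opprK) -[X in X == 0]add0r !addrA.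
  by cancel a; cancel b; cancel (Y u); cancel (Y v).
rewrite nrmZr ger0_norm//.
have h1 := Y_mod (u + n.+1%:R^-1) (v + n.+1%:R^-1); have h2 := Y_mod u v.
have E : u + n.+1%:R^-1 - (v + n.+1%:R^-1) = u - v by ring.
rewrite E in h1; have h3 := nrmBD (Y (u + n.+1%:R^-1) - Y (v + n.+1%:R^-1)) (Y u - Y v).
have h4 : nrm (Y (u + n.+1%:R^-1) - Y (v + n.+1%:R^-1) - (Y u - Y v)) <= 2 * N * `|u - v| `^ gamma.
  by lra.
rewrite (le_trans (ler_wpM2l _ h4))// mulrA -/C mulrC ler_wpM2l ?powR_ge0//.
by rewrite lerDl.
Qed.

(** A pointwise limit of continuous functions built from forward difference quotients. The end point
    T is left out since the extended path is constant to its right; a single point is added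
    afterwards. *)
Lemma measurable_nrm_derivative_co (x : V) :
  measurable_fun `[0, T[%classic (fun u => nrm (X' u - x)).
Proof.
pose h (n : nat) (u : R) := nrm (n.+1%:R *: (Y (u + n.+1%:R^-1) - Y u) - x).
have mh n : measurable_fun `[0, T[%classic (h n).
  apply: (measurable_funS measurableT) => //.
  by apply: continuous_measurable_fun; exact: quotient_continuous.
suff ch u : `[0, T[%classic u -> h ^~ u @ \oo --> nrm (X' u - x).
  exact: measurable_fun_cvg mh ch.
rewrite /= in_itv/= => /andP[u0 uT].
have hu : 0 <= u <= T by rewrite u0 ltW.
apply/cvgrPdist_lt => e e0; have [d d0 hd] := derivative_quotient hu e0.
have m0 : 0 < Num.min d (T - u) by rewrite lt_min d0 subr_gt0.
(* From this index on, the step 1/(n+1) is below [d] and keeps u + 1/(n+1) inside [0, T], where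
   clamping has no effect. *)
exists (Num.truncn (Num.min d (T - u))^-1) => // n /= hn; rewrite /h.
have hn' : n.+1%:R^-1 < Num.min d (T - u).
  rewrite invf_plt ?posrE// (lt_le_trans (truncnS_gt _))// ler_nat ltnS//.
move: hn'; rewrite lt_min => /andP[n1 n2].
set v := u + n.+1%:R^-1; have nV : 0 < (n.+1%:R^-1 : R) by rewrite invr_gt0.
have hv : 0 <= v <= T by rewrite /v addr_ge0 ?(ltW nV)//= -lerBrDl ltW.
have nrm_dist (y z : V) : `|nrm y - nrm z| <= nrm (y - z).
  rewrite ler_norml; have := nrm_triB y z 0; have := nrm_triB z y 0.
  by rewrite !subr0 (nrmB z); lra.
rewrite (le_lt_trans (nrm_dist _ _))// opprB addrA subrK.
rewrite /Y !clamp_id//.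
have := hd v hv; have -> : v - u = n.+1%:R^-1 by rewrite /v; ring.
rewrite invrK rmorph_nat; apply.
  by rewrite gt_eqF// /v ltrDl.
by rewrite distrC /v addrC addKr gtr0_norm.
Qed.

Lemma measurable_nrm_derivative (x : V) :
  measurable_fun `[0, T]%classic (fun u => nrm (X' u - x)).
Proof. by apply/measurable_fun_itv_bndo_bndcP; exact: measurable_nrm_derivative_co. Qed.

End Derivative.

(** * Norm bounds for the Bochner integral and finite index types *)

Section BochnerIntegral.
Context {R : realType} {V : completeNormedModType R[i]}.
Local Notation mu := (@lebesgue_measure R).

Lemma simple_funE n (E : 'I_n -> set R) (c : 'I_n -> V) u :
  simple_fun E c u = step_sum E c (index_enum 'I_n) u.
Proof. by []. Qed.

Lemma is_integral_nrm_le (D : set R) (f : R -> V) (v : V) (psi : R -> R) :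
  measurable D -> (mu D < +oo)%E -> measurable_fun D psi ->
  (forall u, D u -> nrm (f u) <= psi u) -> is_integral D f v ->
  ((nrm v)%:E <= \int[mu]_(u in D) (psi u)%:E)%E.
Proof.
move=> mD muD mpsi fpsi [n [E [c [mE fE _ L1 vlim]]]].
have psi0 u : D u -> 0 <= psi u by move=> Du; rewrite (le_trans (nrm_ge0 _) (fpsi u Du)).
apply/lee_addgt0Pr => e e0.
have e20 : 0 < e / 2 by rewrite divr_gt0.
have /cvg_nrm_seqP/(_ _ e20)[N1 hN1] := vlim.
have L1' : \forall k \near \oo, (\int[mu]_(u in D) (nrm (f u - simple_fun (E k) (c k) u))%:E <= (e / 2)%:E)%E.
  move/fine_cvgP : L1 => [fin /cvgrPdist_le/(_ _ e20) h].
  move: fin h; apply: filterS2 => k /= fk.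
  rewrite sub0r normrN => h; rewrite -(fineK fk) lee_fin.
  by rewrite (le_trans _ h)// ler_norm.
have [N2 _ hN2] := L1'.
pose k := maxn N1 N2.
have h1 := hN1 k (leq_maxl _ _); have h2 := hN2 k (leq_maxr _ _).
pose vk := \sum_(i < n k) (fine (mu (E k i)))%:C *: c k i.
pose g := step_sum (E k) (c k) (index_enum 'I_(n k)).
have mEk i : measurable (E k i) by have [] := mE k i.
have nvk : ((nrm vk)%:E <= \int[mu]_(u in D) (nrm (g u))%:E)%E.
  have := step_sum_integral_bound (c k) mEk (index_enum 'I_(n k)) 0 mD muD.
  rewrite scaler0 sub0r nrmN.
  under eq_integral do rewrite sub0r nrmN.
  congr ((nrm _)%:E <= _)%E; apply: eq_bigr => i _.
  by have [_ ED] := mE k i; rewrite (setIidl ED).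
have mg : measurable_fun D (fun u => nrm (g u)).
  have := measurable_nrm_const_step_sum (c k) mEk 0 (index_enum 'I_(n k)) mD.
  by under eq_fun do rewrite sub0r nrmN.
(* |g| <= psi + p and p <= |f - g|. Additivity of the integral is applied to the measurable
   functions psi and p only; |f - g| enters through monotonicity. *)
pose p u := Num.max (nrm (g u) - psi u) 0.
have mp : measurable_fun D p by apply: measurable_maxr => //; exact: measurable_funB.
have gp : (\int[mu]_(u in D) (nrm (g u))%:E <=
   \int[mu]_(u in D) (psi u)%:E + \int[mu]_(u in D) (p u)%:E)%E.
  rewrite -ge0_integral_addr//; last by move=> u _; rewrite le_max lexx orbT.
  apply: ge0_integral_le => u Du; rewrite lee_fin ?nrm_ge0//.
  by rewrite -lerBlDl le_max lexx.
have pe : (\int[mu]_(u in D) (p u)%:E <= (e / 2)%:E)%E.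
  apply: le_trans h2; apply: ge0_integral_le => u Du; rewrite lee_fin.
    by rewrite le_max lexx orbT.
  rewrite ge_max nrm_ge0 andbT simple_funE -/g.
  have := fpsi u Du; have := nrmBD (f u) (f u - g u).
  have -> : f u - (f u - g u) = g u by rewrite opprB addrC subrK.
  by lra.
rewrite (@le_trans _ _ ((nrm vk)%:E + (e / 2)%:E)%E)//.
  rewrite -EFinD lee_fin; have := nrmD (v - vk) vk; rewrite subrK.
  by move: h1; rewrite -/vk; lra.
rewrite [in leRHS](splitr e) EFinD addeA leeD2r//.
by rewrite (le_trans nvk)// (le_trans gp)// leeD2l.
Qed.

End BochnerIntegral.

Lemma cvg_mesh_powR (R : realType) (T a : R) : 0 < T -> 0 < a ->
  (fun k : nat => (T / k.+1%:R) `^ a) @ \oo --> (0 : R).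
Proof.
move=> T0 a0; apply/cvgrPdist_lt => e e0.
have [d d0 hd] := powR_small a0 e0.
exists (Num.truncn (T / d)) => // k /= hk.
rewrite sub0r normrN ger0_norm ?powR_ge0//; apply: hd; first by rewrite divr_ge0// ltW.
rewrite ltr_pdivrMr// mulrC -ltr_pdivrMr//.
by rewrite (lt_le_trans (truncnS_gt _))// ler_nat ltnS.
Qed.

(** The definition of [is_integral] indexes simple functions by ordinals; here the index may be a
    pair (piece of the step function, cell of the mesh). *)
Lemma is_integral_finType (R : realType) (V : completeNormedModType R[i])
  (D : set R) (f : R -> V) (v : V) (I : nat -> finType)
  (E : forall k, I k -> set R) (c : forall k, I k -> V) :
  let g k u := \sum_(i : I k) (\1_(E k i) u)%:C *: c k i in
  (forall k i, measurable (E k i) /\ E k i `<=` D) ->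
  (forall k i, (lebesgue_measure (E k i) < +oo)%E) ->
  {ae (@lebesgue_measure R), forall u, D u -> g k u @[k --> \oo] --> f u} ->
  ((\int[@lebesgue_measure R]_(u in D) (nrm (f u - g k u))%:E)%E @[k --> \oo] --> 0%E) ->
  (\sum_(i : I k) (fine (lebesgue_measure (E k i)))%:C *: c k i @[k --> \oo] --> v) ->
  is_integral D f v.
Proof.
move=> g h1 h2 h3 h4 h5.
pose ev k := @enum_val (I k) predT.
exists (fun k => #|(predT : pred (I k))|), (fun k i => E k (ev k i)),
  (fun k i => c k (ev k i)).
have sumE k (F : I k -> V) : \sum_(i < #|(predT : pred (I k))|) F (ev k i) = \sum_(i : I k) F i.
  by rewrite -(big_enum_val (A := predT) F); apply: eq_bigl.
have gE k u : simple_fun (fun i => E k (ev k i)) (fun i => c k (ev k i)) u = g k u.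
  exact: (sumE k (fun i => (\1_(E k i) u)%:C *: c k i)).
have gEf : (fun k => simple_fun (fun i => E k (ev k i)) (fun i => c k (ev k i))) = g.
  by apply/funext => k; apply/funext => u; exact: gE.
rewrite gEf; split => //.
- have <- // : (fun k => \sum_(i : I k) (fine (lebesgue_measure (E k i)))%:C *: c k i) =
    (fun k => \sum_(i < #|(predT : pred (I k))|) (fine (lebesgue_measure (E k (ev k i))))%:C *: c k (ev k i)).
  apply/funext => k; apply/esym.
  exact: (sumE k (fun i => (fine (lebesgue_measure (E k i)))%:C *: c k i)).
Qed.

Section RealIntervalIntegrals.
Context {R : realType} (T : R) (psi : R -> R).
Local Notation mu := (@lebesgue_measure R).
Hypothesis mpsi : measurable_fun `[0, T]%classic psi.
Hypothesis psi0 : forall u, 0 <= psi u.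
Hypothesis ipsi : (\int[mu]_(u in `[0%R, T]%classic) (psi u)%:E < +oo)%E.

Definition itv_integral a b := fine (\int[mu]_(u in `[a, b[%classic) (psi u)%:E).

Let sub a b : 0 <= a -> b <= T -> `[a, b[%classic `<=` `[0, T]%classic.
Proof.
by move=> a0 bT u /=; rewrite !in_itv/= => /andP[h1 h2]; rewrite (le_trans a0)// (le_trans (ltW h2)).
Qed.

Let mE : measurable_fun `[0, T]%classic (fun u => (psi u)%:E).
Proof. exact/measurable_EFinP. Qed.

Let le_T a b : 0 <= a -> b <= T ->
  (\int[mu]_(u in `[a, b[%classic) (psi u)%:E <= \int[mu]_(u in `[0%R, T]%classic) (psi u)%:E)%E.
Proof.
move=> a0 bT; apply: ge0_subset_integral => //; last exact: sub.
by move=> u _; rewrite lee_fin.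
Qed.

Let ge0 (D : set R) : (0 <= \int[mu]_(u in D) (psi u)%:E)%E.
Proof. by apply: integral_ge0 => u _; rewrite lee_fin. Qed.

Lemma itv_integralE a b : 0 <= a -> b <= T ->
  (\int[mu]_(u in `[a, b[%classic) (psi u)%:E = (itv_integral a b)%:E)%E.
Proof.
move=> a0 bT; rewrite /itv_integral fineK// ge0_fin_numE//.
by rewrite (le_lt_trans (le_T a0 bT)).
Qed.

Lemma itv_integral_ge0 a b : 0 <= itv_integral a b.
Proof. by rewrite fine_ge0. Qed.

Lemma itv_integral_le a b : 0 <= a -> b <= T ->
  itv_integral a b <= fine (\int[mu]_(u in `[0%R, T]%classic) (psi u)%:E).
Proof.
by move=> a0 bT; rewrite -lee_fin -itv_integralE// fineK ?ge0_fin_numE//; exact: le_T.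
Qed.

Lemma itv_integral_cc a b : 0 <= a -> b <= T ->
  (\int[mu]_(u in `[a, b]%classic) (psi u)%:E = (itv_integral a b)%:E)%E.
Proof.
move=> a0 bT; rewrite -itv_integralE// -integral_itv_bndo_bndc//.
by apply/measurable_EFinP; apply: measurable_funS mpsi => //; exact: sub.
Qed.

Lemma itv_integral_sum (q : nat -> R) m : 0 <= q 0%N ->
  {homo q : i j / (i <= j)%N >-> i <= j} -> q m <= T ->
  \sum_(j < m) itv_integral (q j) (q j.+1) = itv_integral (q 0%N) (q m).
Proof.
move=> q0 qm; elim: m => [|m IH] qT.
  by rewrite big_ord0 /itv_integral set_itvco0 integral_set0.
have h1 := qm _ _ (leq0n m); have h2 := qm _ _ (leqnSn m).
rewrite big_ord_recr/= IH; last exact: le_trans qT.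
apply: EFin_inj; rewrite EFinD -!itv_integralE//; [|exact: le_trans h1|exact: le_trans qT].
rewrite (integral_itvco_split h1 h2)//.
  by apply: measurable_funS mE => //; exact: sub.
Qed.

End RealIntervalIntegrals.

(** * Comparison with the Bochner integral *)

Section ClassicalIntegral.
Context {R : realType} {A : vonNeumannAlgebra R} {X : R -> A}.
Context {P2 : forall t, tensor2 (filtration X t)}.
Context {P3 : forall t, tensor3 (filtration X t)}.
Variables (T gamma : R) (L : forall s t : R, P2 s -> A).
Arguments L : clear implicits.
Hypothesis T0 : 0 < T.
Hypothesis gamma3 : 3^-1 < gamma.
Hypothesis hX : holder_path T gamma X.
Hypothesis hL : product_levy_area T gamma L.
Variables (U : forall t, P2 t) (U1 U2 : forall t, P3 t).
Hypothesis hU : bicontrolled T gamma U U1 U2.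
Variables (X' : R -> A).
Hypothesis dX : is_derivative T X X'.
Hypothesis hLint : forall s t (V : P2 s), 0 <= s -> s < t -> t <= T ->
  is_integral `[s, t] (fun u => sharp V (delta1 X s u) ** X' u) (L s t V).
Local Notation mu := (@lebesgue_measure R).

Let gamma0 : 0 < gamma. Proof. by apply: lt_trans gamma3; rewrite invr_gt0. Qed.
Let N := fine (norm2 `[0%R, T] gamma (fun s t => nrm (delta1 X s t))).
Let Q := fine (bicontrolled_norm gamma U U1 U2 `[0, T]).
Let M := germ L U U1 U2.

Let N0 : 0 <= N. Proof. by rewrite fine_ge0// norm2_ge0. Qed.
Let Q0 : 0 <= Q. Proof. exact: fine_bicontrolled_norm_ge0. Qed.

Let XN s t : 0 <= s -> s <= t -> t <= T -> nrm (X t - X s) <= N * (t - s) `^ gamma.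
Proof. exact: (nrm_delta1_path hX). Qed.

Let mX' x : measurable_fun `[0, T]%classic (fun u => nrm (X' u - x)).
Proof. exact: (measurable_nrm_derivative gamma0 T0 N0 XN dX). Qed.

Let nX' u := nrm (X' u).

Let mnX' : measurable_fun `[0, T]%classic nX'.
Proof.
have -> : nX' = (fun u => nrm (X' u - 0)) by apply/funext => u; rewrite subr0.
exact: mX'.
Qed.

Let subT a b : 0 <= a -> b <= T -> `[a, b]%classic `<=` `[0, T]%classic.
Proof.
by move=> a0 bT u /=; rewrite !in_itv/= => /andP[h1 h2]; rewrite (le_trans a0)// (le_trans h2).
Qed.

Lemma integrable_nrm_fin v : is_integral `[0, T]%classic X' v ->
  (\int[mu]_(u in `[0%R, T]%classic) (nX' u)%:E < +oo)%E.
Proof.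
move=> [n [E [c [mE _ _ L1 _]]]].
have mD : measurable `[0, T]%classic by exact: measurable_itv.
(* One index with finite L^1 error is enough: X' is then at finite distance from a bounded function
   on a bounded interval. *)
have /fine_cvgP[[k0 _ /(_ k0 (leqnn _))/= fk] _] := L1.
have mEk i : measurable (E k0 i) by have [] := mE k0 i.
pose g := step_sum (E k0) (c k0) (index_enum 'I_(n k0)).
pose C := \sum_(i < n k0) nrm (c k0 i).
have gC u : nrm (g u) <= C.
  rewrite (le_trans (nrm_sum _ _ _))//; apply: ler_sum => i _.
  rewrite nrmZr ler_piMl ?nrm_ge0// indicE ger0_norm//.
  by case: (_ \in _).
have C0 : 0 <= C by rewrite sumr_ge0// => i _; exact: nrm_ge0.
apply: (@le_lt_trans _ _ (\int[mu]_(u in `[0%R, T]%classic) (nrm (X' u - g u) + C)%:E)%E).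
  apply: ge0_integral_le => u _; rewrite lee_fin ?nrm_ge0//.
  by have := nrmD (X' u - g u) (g u); rewrite subrK; have := gC u; rewrite /nX'; lra.
rewrite ge0_integral_addr//; first last.
- by move=> u _; exact: nrm_ge0.
- exact: measurable_nrm_step_sum.
apply: lte_add_pinfty; first by rewrite ltey_eq fk.
rewrite (_ : (\int[mu]_(u in `[0%R, T]%classic) C%:E = C%:E * mu `[0%R, T]%classic)%E).
  by rewrite lebesgue_measure_itv/= lte_fin T0 -EFinB -EFinM ltry.
by rewrite integral_cst.
Qed.

Hypothesis finX' : (\int[mu]_(u in `[0%R, T]%classic) (nX' u)%:E < +oo)%E.

Let W := itv_integral nX'.

(** [W] is additive over adjacent intervals, so over a mesh these constants sum to at most N
    (mesh)^gamma W(0, T), which tends to 0 for every gamma > 0. *)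
Lemma levy_integral_bounded_linear a b : 0 <= a -> a <= b -> b <= T ->
  bounded_linear (L a b) (N * (b - a) `^ gamma * W a b).
Proof.
move=> a0 ab bT; have W0 : 0 <= W a b by apply: itv_integral_ge0 => u; exact: nrm_ge0.
split; first exact: (levy_bounded_linear hL a0 ab bT).1.
move=> V.
have rhs0 : 0 <= N * (b - a) `^ gamma * W a b * nrm V.
  by rewrite mulr_ge0 ?nrm_ge0// mulr_ge0// mulr_ge0// powR_ge0.
move: ab; rewrite le_eqVlt => /orP[/eqP ab|ab].
  by move: rhs0; rewrite -ab (levy_diag hL) nrm0.
pose k := N * (b - a) `^ gamma * nrm V.
have k0 : 0 <= k by rewrite mulr_ge0 ?nrm_ge0// mulr_ge0// powR_ge0.
have mab : measurable_fun `[a, b]%classic nX'.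
  by apply: measurable_funS mnX' => //; exact: subT.
have := @is_integral_nrm_le _ _ `[a, b]%classic _ _ (fun u => k * nX' u) _ _ _ _ (hLint V a0 ab bT).
rewrite ge0_integral_mulr//; last by move=> u _; exact: nrm_ge0.
rewrite (itv_integral_cc mnX' _ finX')//; last by move=> u; exact: nrm_ge0.
rewrite -EFinM lee_fin => h.
have -> : N * (b - a) `^ gamma * W a b * nrm V = k * W a b by rewrite /k; ring.
apply: h => //.
- by rewrite lebesgue_measure_itv/=; case: ifP => _; rewrite ltry.
- by apply: measurable_funM => //; exact: measurable_cst.
- move=> u; rewrite /= in_itv/= => /andP[au ub].
  rewrite (le_trans (nrm_mul _ _))// ler_wpM2r ?nrm_ge0//.
  rewrite (le_trans (nrm_sharp _ _))// ler_wpM2r ?nrm_ge0//.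
  rewrite (le_trans (XN a0 au (le_trans ub bT)))// ler_wpM2l// powR_le//.
  + exact: ltW.
  + by rewrite subr_ge0.
  + by rewrite lerD2r.
Qed.

(** [Y] will be the integral over [a, b[ of a step function approximating X'. *)
Lemma germ_sub_sharp_le B B12 a b (Y : A) : 0 <= a -> a <= b -> b <= T ->
  nrm (U a) <= B -> nrm (U1 a) + nrm (U2 a) <= B12 ->
  nrm (M a b - sharp (U a) Y) <=
  B * nrm (delta1 X a b - Y) + N * (b - a) `^ gamma * W a b * B12.
Proof.
move=> a0 ab bT hB hB12.
have k0 : 0 <= N * (b - a) `^ gamma * W a b.
  apply: mulr_ge0; first by rewrite mulr_ge0// powR_ge0.
  by apply: itv_integral_ge0 => u; exact: nrm_ge0.
have hl := levy_integral_bounded_linear a0 ab bT.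
have h1 := (levy_idP (P3 := P3) k0 hl).1.2 (U1 a).
have h2 := (id_levy_starP (P3 := P3) k0 hl).1.2 (U2 a).
have -> : M a b - sharp (U a) Y = sharp (U a) (delta1 X a b - Y) +
    (levy_id L b (U1 a) + id_levy_star L b (U2 a)).
  rewrite sharpBr /M /germ; set x := sharp _ _; set y := levy_id _ _ _.
  set z := id_levy_star _ _ _; set w := sharp _ Y.
  apply/eqP; rewrite -subr_eq0 !(opprD, opprK) -[X in X == 0]add0r !addrA.
  by cancel x; cancel y; cancel z; cancel w.
rewrite (le_trans (nrmD _ _))// lerD//.
  by rewrite (le_trans (nrm_sharp _ _))// mulrC ler_wpM2r// nrm_ge0.
rewrite (le_trans (nrmD _ _))// (le_trans (lerD h1 h2))// -mulrDr.
by rewrite ler_wpM2l.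
Qed.

Section StepApproximation.
Context {I : Type} (E : I -> set R) (c : I -> A) (r : seq I).
Hypothesis mE : forall i, measurable (E i).
Let G := step_sum E c r.
Let hG u := nrm (X' u - G u).
Hypothesis finG : (\int[mu]_(u in `[0%R, T]%classic) (hG u)%:E < +oo)%E.

Lemma measurable_step_error : measurable_fun `[0, T]%classic hG.
Proof. exact: measurable_nrm_step_sum. Qed.

Lemma path_sub_step_sum_le a b : 0 <= a -> a <= b -> b <= T ->
  nrm (delta1 X a b - \sum_(i <- r) (fine (mu (E i `&` `[a, b[%classic)))%:C *: c i)
  <= itv_integral hG a b.
Proof.
move=> a0 ab bT; rewrite -lee_fin -(itv_integralE measurable_step_error _ finG)//; last first.
  by move=> u; exact: nrm_ge0.
refine (@increment_sub_step_sum_le R A I E c r mE X X' a b ab _ _ _).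
- move=> t e /andP[at' tb] e0.
  have tT := le_trans tb bT.
  exact: (left_continuous gamma0 N0 XN a0 tT e0).
- move=> t e /andP[at' tb] e0.
  have ht : 0 <= t <= T by rewrite (le_trans a0)// (le_trans (ltW tb)).
  have [d d0 hd] := derivative_right dX ht e0.
  by exists d => // v tv vd vb; apply: hd => //; exact: le_trans bT.
- move=> x; apply: measurable_funS (mX' x) => // u /=; rewrite !in_itv/= => /andP[h1 h2].
  by rewrite (le_trans a0)// (le_trans (ltW h2)).
Qed.

Lemma sharp_sum (J : Type) (l : seq J) (a : J -> R[i]) (x : J -> A) s (V : P2 s) :
  sharp V (\sum_(j <- l) a j *: x j) = \sum_(j <- l) a j *: sharp V (x j).
Proof.
elim: l => [|j l IH]; first by rewrite !big_nil sharp0r.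
by rewrite !big_cons sharpDr IH.
Qed.

Lemma sharp_step_error B a u : 0 <= a -> a <= u -> u <= T -> nrm (U u) <= B ->
  nrm (sharp (U u) (X' u) - sharp (U a) (G u)) <=
  (B + Q * (u - a) `^ gamma) * hG u + Q * (u - a) `^ gamma * nX' u.
Proof.
move=> a0 au uT hB.
have h1 : nrm (deltaP2 U a u) <= Q * (u - a) `^ gamma.
  move: au; rewrite le_eqVlt => /orP[/eqP <-|au].
    by rewrite /deltaP2 incl2_id subrr nrm0 mulr_ge0// powR_ge0.
  exact: (bi_increment_le hU (lexx 0) (lexx T)).
have -> : sharp (U u) (X' u) - sharp (U a) (G u) =
    sharp (U u) (X' u - G u) + sharp (deltaP2 U a u) (G u).
  rewrite sharpBr /deltaP2 (blB (sharpP (P2 := P2) u _).1) sharp_incl//.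
  by rewrite addrA subrK.
have h2 := nrm_sharp (U u) (X' u - G u).
have h3 := nrm_sharp (deltaP2 U a u) (G u).
(* The step functions are not uniformly bounded along the approximation; this replaces G by X' and
   the error, whose integrals are controlled. *)
have h4 : nrm (G u) <= nX' u + hG u.
  have := nrmBD (X' u) (X' u - G u).
  by have -> : X' u - (X' u - G u) = G u by rewrite opprB addrC subrK.
have h5 : nrm (X' u - G u) * nrm (U u) <= hG u * B by rewrite ler_wpM2l// nrm_ge0.
have h6 : nrm (G u) * nrm (deltaP2 U a u) <= (nX' u + hG u) * (Q * (u - a) `^ gamma).
  by rewrite ler_pM ?nrm_ge0.
have := nrmD (sharp (U u) (X' u - G u)) (sharp (deltaP2 U a u) (G u)).
move: h2 h3 h4 h5 h6; set p := Q * _; lra.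
Qed.

End StepApproximation.

Section Partition.
Variables (s t : R) (k : nat).
Hypotheses (s0 : 0 <= s) (st : s <= t) (tT : t <= T).
(** Clipping at [t] makes the cells beyond [t] empty, so the number of cells and their maximal width
    depend on [k] and T alone. *)
Definition mesh_point (j : nat) : R := Num.min t (s + j%:R * (T / k.+1%:R)).
Local Notation q := mesh_point.
Definition mesh_cell (j : nat) : set R := `[q j, q j.+1[%classic.
Local Notation C := mesh_cell.

Let dp : 0 < T / k.+1%:R. Proof. by rewrite divr_gt0. Qed.

Lemma mesh_point_homo : {homo q : i j / (i <= j)%N >-> i <= j}.
Proof.
move=> i j ij; rewrite /q le_min !ge_min lexx/=; apply/orP; right.
by rewrite lerD2l; apply: ler_wpM2r; [exact: ltW|rewrite ler_nat].
Qed.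

Lemma mesh_point0 : q 0 = s.
Proof. by rewrite /q mul0r addr0 (min_idPr st). Qed.

Lemma mesh_point_last : q k.+2 = t.
Proof.
rewrite /q (min_idPl _)//.
have h : T <= k.+2%:R * (T / k.+1%:R).
  by rewrite mulrCA ler_peMr ?(ltW T0)// ler_pdivlMr// mul1r ler_nat.
by rewrite (le_trans tT)// (le_trans h)// lerDr.
Qed.

Lemma mesh_point_itv j : 0 <= q j <= T.
Proof.
rewrite /q le_min (le_trans s0 st)/= addr_ge0//=; last by rewrite mulr_ge0// ltW.
by rewrite ge_min tT.
Qed.

Lemma mesh_point_ge j : s <= q j.
Proof. by rewrite -mesh_point0; exact: mesh_point_homo. Qed.

Lemma mesh_point_le j : q j <= t.
Proof. by rewrite ge_min lexx. Qed.

Lemma mesh_step j : q j.+1 - q j <= T / k.+1%:R.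
Proof.
have -> : T / k.+1%:R = s + j.+1%:R * (T / k.+1%:R) - (s + j%:R * (T / k.+1%:R)).
  by rewrite -natr1; ring.
have h : s + j%:R * (T / k.+1%:R) <= s + j.+1%:R * (T / k.+1%:R).
  by rewrite lerD2l; apply: ler_wpM2r; [exact: ltW|rewrite ler_nat].
by rewrite /q; move: h; set a := s + _; set b := s + _; case: (leP t a); case: (leP t b); lra.
Qed.

Lemma mesh_cellP u : s <= u < t -> exists j : 'I_k.+2, C j u.
Proof.
move=> /andP[su ut].
suff [j jk hj] : exists2 j, (j < k.+2)%N & C j u by exists (Ordinal jk).
have : u < q k.+2 by rewrite mesh_point_last.
elim: k.+2 => [|m IH]; first by rewrite mesh_point0 ltNge su.
have [um _|qu um] := ltP u (q m).
  by have [j jm hj] := IH um; exists j => //; exact: leqW.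
by exists m => //; rewrite /C/= in_itv/= qu.
Qed.

Lemma mesh_cell_inj i j u : C i u -> C j u -> i = j.
Proof.
rewrite /C /= !in_itv/= => /andP[i1 i2] /andP[j1 j2].
have [ij|ji|//] := ltngtP i j.
  by have := le_lt_trans (le_trans (mesh_point_homo ij) j1) i2; rewrite ltxx.
by have := le_lt_trans (le_trans (mesh_point_homo ji) i1) j2; rewrite ltxx.
Qed.

Lemma mesh_cell_sub j : C j `<=` `[s, t]%classic.
Proof.
move=> u; rewrite /C/= !in_itv/= => /andP[h1 h2].
by rewrite (le_trans (mesh_point_ge j) h1)/= (le_trans (ltW h2))// mesh_point_le.
Qed.

End Partition.
(** U is frozen at the left end of each cell and X' replaced by step functions, both refined with
    the same index k. Only the order 3 gamma > 1 of delta Z - M is needed to identify the value of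
    the integral. *)
Lemma is_integral_sharp (Z : R -> A) (Kc : R) v0 s t : 0 <= Kc ->
  (forall a b, 0 <= a -> a <= b -> b <= T ->
     nrm (delta1 Z a b - M a b) <= Kc * (b - a) `^ (3 * gamma)) ->
  is_integral `[0, T]%classic X' v0 -> 0 <= s -> s <= t -> t <= T ->
  is_integral `[s, t]%classic (fun u => sharp (U u) (X' u)) (delta1 Z s t).
Proof.
move=> Kc0 hZ [n [E [c [mE fE aeE L1 _]]]] s0 st tT.
have [B B0 hB] := bi_bounded gamma3 hU.
pose B12 := nrm (U1 0) + nrm (U2 0) + 2 * ((T - 0) `^ gamma * Q).
have hB12 a : 0 <= a -> a <= T -> nrm (U1 a) + nrm (U2 a) <= B12.
  exact: (tri_sum_le gamma3 hU (lexx 0) (lexx T)).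
have B120 : 0 <= B12.
  by rewrite (le_trans _ (hB12 0 (lexx 0) (ltW T0)))// addr_ge0 ?nrm_ge0.
pose g k := step_sum (E k) (c k) (index_enum 'I_(n k)).
pose dk (k : nat) := T / k.+1%:R.
pose eps k := Q * dk k `^ gamma.
pose q k := mesh_point s t k.
pose C k := mesh_cell s t k.
pose h k u := nrm (X' u - g k u).
have eps0 k : 0 <= eps k by rewrite mulr_ge0// powR_ge0.
have mEk k i : measurable (E k i) by have [] := mE k i.
have mC k j : measurable (C k j) by exact: measurable_itv.
have mh k : measurable_fun `[0, T]%classic (h k) by exact: measurable_step_error.
have eps_cvg : eps @ \oo --> (0 : R).
  by rewrite -(mulr0 Q); apply: cvgMr; exact: cvg_mesh_powR.
pose f u := sharp (U u) (X' u).
(* On the cell with left end q this is U_q # g_k(u), written as a simple function over intersections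
   of the sets E with the cells. *)
pose g' k u := \sum_(p : 'I_(n k) * 'I_k.+2)
  (\1_(E k p.1 `&` C k p.2) u)%:C *: sharp (U (q k p.2)) (c k p.1).
have g'E k u (j : 'I_k.+2) : C k j u -> g' k u = sharp (U (q k j)) (g k u).
  move=> Cj; rewrite /g' -(pair_bigA _ (fun (i : 'I_(n k)) (l : 'I_k.+2) =>
    (\1_(E k i `&` C k l) u)%:C *: sharp (U (q k l)) (c k i)))/=.
  rewrite /g /step_sum sharp_sum; apply: eq_bigr => i _.
  rewrite (bigD1 j)//= big1 ?addr0 => [|l lj].
    by rewrite indicI/= (_ : \1_(C k j) u = 1) ?mulr1// indicE mem_set.
  rewrite indicI/= (_ : \1_(C k l) u = 0) ?mulr0 ?scale0r//.
  rewrite indicE memNset// => Cl; move/eqP: lj; apply; apply: val_inj => /=.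
  exact: (mesh_cell_inj Cl Cj).
have PW k u : s <= u < t -> nrm (f u - g' k u) <= (B + eps k) * h k u + eps k * nX' u.
  move=> hu; have [j Cj] := mesh_cellP k s0 st tT hu.
  have uT : u <= T by case/andP: hu => _ /ltW /le_trans; apply.
  have u0 : 0 <= u by case/andP: hu => /(le_trans s0).
  have [qj0 _] := andP (mesh_point_itv k s0 st tT j).
  have := Cj; rewrite /C /mesh_cell /= in_itv/= => /andP[qu uq].
  have hBu : nrm (U u) <= B by rewrite hB// u0.
  rewrite (g'E k u j Cj) (le_trans (sharp_step_error _ _ _ qj0 qu uT hBu))//.
  have hd : (u - q k j) `^ gamma <= dk k `^ gamma.
    apply: powR_le; [exact: ltW|by rewrite subr_ge0|].
    by rewrite (le_trans _ (mesh_step s t k j))// lerD2r ltW.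
  have hd' : Q * (u - q k j) `^ gamma <= eps k by rewrite ler_wpM2l.
  by rewrite lerD// ler_wpM2r ?nrm_ge0// lerD2l.
pose w := fine (\int[mu]_(u in `[0%R, T]%classic) (nX' u)%:E).
have wE : (\int[mu]_(u in `[0%R, T]%classic) (nX' u)%:E = w%:E)%E.
  by rewrite /w fineK// ge0_fin_numE// integral_ge0// => u _; rewrite lee_fin nrm_ge0.
have w0 : 0 <= w by rewrite fine_ge0// integral_ge0// => u _; rewrite lee_fin nrm_ge0.
pose rk k := fine (\int[mu]_(u in `[0%R, T]%classic) (h k u)%:E).
have [rfin rcvg] : (\forall k \near \oo, \int[mu]_(u in `[0%R, T]%classic) (h k u)%:E \is a fin_num)%E /\
    rk @ \oo --> (0 : R).
  by move/fine_cvgP : L1.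
have rk0 k : 0 <= rk k.
  by rewrite fine_ge0// integral_ge0// => u _; rewrite lee_fin nrm_ge0.
have sT : `[s, t]%classic `<=` `[0, T]%classic by exact: subT.
apply: (@is_integral_finType _ _ _ _ _ (fun k => ('I_(n k) * 'I_k.+2)%type)
  (fun k p => E k p.1 `&` C k p.2) (fun k p => sharp (U (q k p.2)) (c k p.1))).
- move=> k [i j] /=; split; first exact: measurableI.
  by move=> u [_ Cu]; exact: (mesh_cell_sub st Cu).
- move=> k [i j] /=; apply: le_lt_trans (fE k i).
  by apply: le_measure; [exact: (mem_set (measurableI _ _ (mEk k i) (mC k j)))|exact: (mem_set (mEk k i))|move=> u []].
- have FF : Filter (almost_everywhere mu) by exact: ae_filter_ringOfSetsType.
  (* The half-open cells miss the end point [t], where g' vanishes; this null set is discarded here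
     and is carried by an indicator in the L^1 estimate below. *)
  have aet : {ae mu, forall u, u != t}.
    exists [set t]; split; [exact: measurable_set1|exact: lebesgue_measure_set1|].
    by move=> u /= /negP; rewrite negbK => /eqP.
  apply: (@filterS2 _ _ FF _ _ _ _ aeE aet) => u hu ut.
  rewrite /= in_itv/= => /andP[su ut'].
  have hust : s <= u < t by rewrite su lt_neqAle ut.
  have hu0T : `[0, T]%classic u by apply: sT; rewrite /= in_itv/= su.
  have hcvg : (fun k => h k u) @ \oo --> (0 : R).
    by have /cvg_nrm0P := hu hu0T.
  apply/cvg_nrm0P.
  apply: (squeeze_cvgr (f := fun=> 0) (h := fun k => (B + eps k) * h k u + eps k * nX' u)).
  + by apply: nearW => k; rewrite nrm_ge0/=; exact: PW.
  + exact: cvg_cst.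
  + rewrite -[X in _ --> X](_ : (B + 0) * 0 + 0 * nX' u = 0); last by rewrite mulr0 mul0r addr0.
    apply: cvgD; last by apply: cvgMl.
    by apply: cvgM => //; apply: cvgD => //; exact: cvg_cst.
- pose b k : \bar R := ((B + eps k) * rk k + eps k * w)%:E.
  have bcvg : b @ \oo --> 0%E.
    apply/fine_cvgP; split; first by apply: nearW => k.
    rewrite /= -[X in _ --> X](_ : (B + 0) * 0 + 0 * w = 0); last by rewrite mulr0 mul0r addr0.
    apply: cvgD; last by apply: cvgMl.
    by apply: cvgM => //; apply: cvgD => //; exact: cvg_cst.
  apply: (squeeze_cvge (f := fun=> 0%E) (h := b)) => //; last exact: cvg_cst.
  move: rfin; apply: filterS => k fk.
  rewrite integral_ge0/=; last by move=> u _; rewrite lee_fin nrm_ge0.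
  pose psi u := ((B + eps k) * h k u + eps k * nX' u) + nrm (f t) * \1_[set t] u.
  have Be0 : 0 <= B + eps k by rewrite addr_ge0.
  have m1 : measurable_fun `[s, t]%classic (fun u => (B + eps k) * h k u).
    apply: measurable_funM; first exact: measurable_cst.
    exact: measurable_funS (mh k).
  have m2 : measurable_fun `[s, t]%classic (fun u => eps k * nX' u).
    apply: measurable_funM; first exact: measurable_cst.
    exact: measurable_funS mnX'.
  have m3 : measurable_fun `[s, t]%classic (\1_[set t] : R -> R).
    by apply: measurable_indic; exact: measurable_set1.
  have h0 u : 0 <= h k u by exact: nrm_ge0.
  have nX0 u : 0 <= nX' u by exact: nrm_ge0.
  apply: (@le_trans _ _ (\int[mu]_(u in `[s, t]%classic) (psi u)%:E)%E).
    apply: ge0_integral_le => u; first by rewrite lee_fin nrm_ge0.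
    rewrite /= in_itv/= => /andP[su ut]; rewrite lee_fin /psi.
    have p0 : 0 <= (B + eps k) * h k u + eps k * nX' u by rewrite addr_ge0// mulr_ge0.
    have [->|ut'] := eqVneq u t; last first.
      rewrite (le_trans (PW k u _))//; first by rewrite su lt_neqAle ut'.
      by rewrite lerDl mulr_ge0 ?nrm_ge0.
    rewrite indicE mem_set// mulr1.
    rewrite -/(g' k t) (_ : g' k t = 0); last first.
      rewrite /g' big1// => -[i j] _ /=; rewrite indicE memNset ?scale0r// => -[_].
      by rewrite /C /mesh_cell/= in_itv/= => /andP[_]; rewrite ltNge mesh_point_le.
    by rewrite subr0 lerDr addr_ge0// mulr_ge0.
  rewrite ge0_integral_addr//; first last.
  + by move=> u _; rewrite mulr_ge0 ?nrm_ge0.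
  + by move=> u _; rewrite addr_ge0// mulr_ge0.
  + by apply: measurable_funM => //; exact: measurable_cst.
  + exact: measurable_funD.
  rewrite ge0_integral_mulr ?nrm_ge0//.
  have -> : (\int[mu]_(u in `[s, t]%classic) (\1_[set t] u)%:E = 0)%E.
    rewrite integral_indic//; apply/eqP; rewrite -measure_le0 -(lebesgue_measure_set1 t).
    apply: le_measure; last by move=> u [].
      by apply: mem_set; apply: measurableI; [exact: measurable_set1|exact: measurable_itv].
    by apply: mem_set; exact: measurable_set1.
  rewrite mule0 adde0 ge0_integral_addr//; [|by move=> u _; rewrite mulr_ge0..].
  rewrite !ge0_integral_mulr//; [|exact: measurable_funS mnX'|exact: measurable_funS (mh k)].
  rewrite /b (EFinD ((B + eps k) * rk k)) !EFinM; apply: leeD; apply: lee_wpmul2l; rewrite ?lee_fin//.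
  + rewrite /rk fineK//; apply: ge0_subset_integral => //.
      by apply/measurable_EFinP; exact: mh.
    by move=> u _; rewrite lee_fin.
  + exact: eps0.
  + rewrite -wE; apply: ge0_subset_integral => //.
      by apply/measurable_EFinP; exact: mnX'.
    by move=> u _; rewrite lee_fin.
- pose Y k j := \sum_(i <- index_enum 'I_(n k)) (fine (mu (E k i `&` C k j)))%:C *: c k i.
  have vE k : \sum_(p : 'I_(n k) * 'I_k.+2) (fine (mu (E k p.1 `&` C k p.2)))%:C *: sharp (U (q k p.2)) (c k p.1)
     = \sum_(j < k.+2) sharp (U (q k j)) (Y k j).
    rewrite -(pair_bigA _ (fun (i : 'I_(n k)) (j : 'I_k.+2) =>
      (fine (mu (E k i `&` C k j)))%:C *: sharp (U (q k j)) (c k i)))/=.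
    by rewrite exchange_big; apply: eq_bigr => j _; rewrite /Y sharp_sum.
  have dZ k : delta1 Z s t = \sum_(j < k.+2) delta1 Z (q k j) (q k j.+1).
    rewrite /delta1 -(big_mkord xpredT (fun j => Z (q k j.+1) - Z (q k j))) telescope_sumr//.
    by rewrite /q mesh_point_last// mesh_point0.
  pose a1 : R := 3 * gamma - 1.
  have a10 : 0 < a1 by have := gamma3; rewrite /a1; lra.
  (* The three errors summed over the cells: sewing, with one factor of length kept to sum to at
     most T; path increments against step functions; area terms. *)
  pose bd k := Kc * dk k `^ a1 * T + B * rk k + N * dk k `^ gamma * w * B12.
  apply/cvg_nrm0P; apply: (squeeze_cvgr (f := fun=> 0) (h := bd)); last 2 first.
  + exact: cvg_cst.
  + rewrite -[X in _ --> X](_ : Kc * 0 * T + B * 0 + N * 0 * w * B12 = 0); last by ring.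
    apply: cvgD; first apply: cvgD.
    * by apply: cvgMl; apply: cvgMr; exact: cvg_mesh_powR.
    * exact: cvgMr.
    * by do 2! apply: cvgMl; apply: cvgMr; exact: cvg_mesh_powR.
  move: rfin; apply: filterS => k fk; rewrite nrm_ge0/= vE (dZ k) -sumrB.
  have dk0 : 0 <= dk k by rewrite divr_ge0// ltW.
  have finh : (\int[mu]_(u in `[0%R, T]%classic) (h k u)%:E < +oo)%E by rewrite ltey_eq fk.
  have h0 u : 0 <= h k u by exact: nrm_ge0.
  have nX0 u : 0 <= nX' u by exact: nrm_ge0.
  pose W' := itv_integral (h k).
  have qmono : {homo q k : i j / (i <= j)%N >-> i <= j} by move=> i j; exact: mesh_point_homo.
  have step j : nrm (delta1 Z (q k j) (q k j.+1) - sharp (U (q k j)) (Y k j)) <=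
     Kc * dk k `^ a1 * (q k j.+1 - q k j) + B * W' (q k j) (q k j.+1) +
     N * dk k `^ gamma * B12 * W (q k j) (q k j.+1).
    have [qj0 qjT] := andP (mesh_point_itv k s0 st tT j).
    have [_ qj1T] := andP (mesh_point_itv k s0 st tT j.+1).
    have qjj : q k j <= q k j.+1 by exact: qmono.
    have d0 : 0 <= q k j.+1 - q k j by rewrite subr_ge0.
    have dd : q k j.+1 - q k j <= dk k by exact: mesh_step.
    have hBj : nrm (U (q k j)) <= B by rewrite hB// qj0.
    have k1 := hZ _ _ qj0 qjj qj1T.
    have k2 := germ_sub_sharp_le (Y k j) qj0 qjj qj1T hBj (hB12 _ qj0 qjT).
    have k3 := path_sub_step_sum_le (c := c k) (r := index_enum 'I_(n k)) (mEk k) finh qj0 qjj qj1T.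
    apply: (le_trans (nrm_triB _ (M (q k j) (q k j.+1)) _)).
    apply: (le_trans (lerD k1 k2)); rewrite -[leRHS]addrA; apply: lerD.
      rewrite -mulrA ler_wpM2l//.
      (* The mesh width takes the place of the time horizon: d^(3 gamma) <= dk^(3 gamma - 1) d for d
         <= dk. *)
      have := @powR_interval_le R (dk k) 1 (3 * gamma) _ ler01 _ d0 dd.
      by rewrite powRr1//; apply; rewrite -subr_ge0 ltW.
    rewrite lerD//; first by rewrite ler_wpM2l.
    rewrite (mulrAC _ B12) ler_wpM2r//.
    rewrite ler_wpM2r//; first by apply: itv_integral_ge0.
    by rewrite ler_wpM2l// powR_le// ltW.
  rewrite (le_trans (nrm_sum _ _ _))//.
  rewrite (le_trans (ler_sum _ (fun (j : 'I_k.+2) _ => step j)))//.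
  rewrite !big_split/= -!mulr_sumr.
  have q0 : 0 <= q k 0%N by have [] := andP (mesh_point_itv k s0 st tT 0).
  have qT : q k k.+2 <= T by have [] := andP (mesh_point_itv k s0 st tT k.+2).
  rewrite (itv_integral_sum (mh k) h0 finh q0 qmono qT).
  rewrite (itv_integral_sum mnX' nX0 finX' q0 qmono qT).
  have -> : \sum_(j < k.+2) (q k j.+1 - q k j) = t - s.
    rewrite -(big_mkord xpredT (fun j => q k j.+1 - q k j)) telescope_sumr//.
    by rewrite /q mesh_point_last// mesh_point0.
  rewrite /bd; apply: lerD; first apply: lerD.
  + rewrite ler_wpM2l//; first by rewrite mulr_ge0// powR_ge0.
    by rewrite lerBlDr (le_trans tT)// lerDl.
  + by rewrite ler_wpM2l// itv_integral_le.
  + rewrite [leRHS]mulrAC ler_wpM2l//; last by rewrite itv_integral_le.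
    by rewrite mulr_ge0// mulr_ge0// powR_ge0.
Qed.

End ClassicalIntegral.

(** The constants are chosen before the algebra, the path and the area, so they depend on gamma and
    T alone and the factor in (iv) is affine in the two norms. [Lambda] being a choice,
    well-definedness is existence of a sewn map and uniqueness on the simplex. If a lies outside A_0
    then Z is not adapted at time 0; membership in Q(X) is therefore stated for Z - a, and for Z
    itself when a lies in A_0. The norm in (iv) depends on Z through its increments only, so the
    bound concerns Z in both cases. *)
Theorem proposition4p12 (R : realType) (gamma T : R) :
  3^-1 < gamma -> 0 < T ->
  exists c0 c1 c2 : R,
  forall (A : ncProbSpace R) (X : R -> A)
    (P2 : forall t, tensor2 (filtration X t))
    (P3 : forall t, tensor3 (filtration X t))
    (L : forall s t : R, P2 s -> A),
  holder_path T gamma X -> product_levy_area T gamma L ->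
  forall (U : forall t, P2 t) (U1 U2 : forall t, P3 t),
  bicontrolled T gamma U U1 U2 ->
  let M := germ L U U1 U2 in
  let J := rough_integral T L U U1 U2 in
  [/\ (* (i) *)
      [/\ sewn T (delta2 M) (Lambda T (delta2 M)),
          forall h, sewn T (delta2 M) h ->
            forall s t, simplex2 T (s, t) -> h s t = Lambda T (delta2 M) s t &
          C2 T gamma J],
      (* (ii) *)
      forall X' : R -> A, is_derivative T X X' ->
        (exists v, is_integral `[0, T] X' v) ->
        (forall s t (V : P2 s), 0 <= s -> s < t -> t <= T ->
          is_integral `[s, t] (fun u => sharp V (delta1 X s u) ** X' u)
            (L s t V)) ->
        forall s t, simplex2 T (s, t) ->
          is_integral `[s, t] (fun u => sharp (U u) (X' u)) (J s t) &
      (* (iii), (iv) *)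
      forall a : A, exists Z : R -> A,
        [/\ Z 0 = a /\
            (forall s t, simplex2 T (s, t) -> delta1 Z s t = J s t),
            controlled T gamma (fun t => Z t - a) U,
            filtration X 0 a -> controlled T gamma Z U,
            forall Z' : R -> A, Z' 0 = a ->
              (forall s t, simplex2 T (s, t) -> delta1 Z' s t = J s t) ->
              forall t, 0 <= t <= T -> Z' t = Z t &
            forall l1 l2, 0 <= l1 -> l1 <= l2 -> l2 <= T ->
              (controlled_norm gamma Z U `[l1, l2] <=
               (c0%:E
                + c1%:E * norm2 `[0%R, T] gamma (fun s t => nrm (delta1 X s t))
                + c2%:E * levy_norm T gamma L) *
               (1 + bi_norm0 U `[l1, l2] + (nrm (U1 l1))%:E + (nrm (U2 l1))%:E
                + ((l2 - l1) `^ gamma)%:E *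
                  bicontrolled_norm gamma U U1 U2 `[l1, l2]))%E]].
Proof.
move=> gamma3 T0; set K := sew_const (3 * gamma).
exists 2, (3 + 2 * K * (1 + T `^ gamma)), ((1 + T `^ gamma) * (2 + 4 * K)).
move=> A X P2 P3 L hX hL U U1 U2 hU M J.
have [Z0 [Z00 Z0A Z0s Z0b]] := rough_primitive T0 gamma3 hX hL hU.
have ZE s t : simplex2 T (s, t) -> J s t = delta1 Z0 s t.
  exact: rough_integralE.
split.
- split.
  + exact: (sewn_Lambda Z0s).
  + by move=> h hs; exact: (sewn_unique hs (sewn_Lambda Z0s)).
  + by have [] := primitive_C1_C2 gamma3 hX hL hU Z0s Z0b.
- move=> X' dX [v hv] hLint s t hst; rewrite ZE//; case: hst => /= s0 st tT.
  have finX' := integrable_nrm_fin T0 gamma3 hX dX hv.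
  apply: (is_integral_sharp T0 gamma3 hX hL hU dX hLint finX' _ _ hv s0 st tT).
    2: by move=> a b a0 ab bT; exact: (Z0b 0 T (lexx 0) (lexx T)).
  have K0 : 0 <= K by apply: sew_const_ge0; lra.
  have NX0 : 0 <= fine (norm2 `[0%R, T] gamma (fun s t => nrm (delta1 X s t))).
    by rewrite fine_ge0// norm2_ge0.
  apply: mulr_ge0 => //; apply: mulr_ge0 => //; apply: mulr_ge0.
    by rewrite addr_ge0// mulr_ge0// fine_levy_norm_ge0.
  exact: fine_bicontrolled_norm_ge0.
(* A translation of the primitive from 0: the increments, hence the sewn map and all estimates, are
   unchanged. *)
- move=> a; pose Z t := a + Z0 t; exists Z.
  have dE : delta1 Z = delta1 Z0.
    by apply/funext => s; apply/funext => t; rewrite /delta1 /Z opprD addrACA subrr add0r.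
  have Zs : sewn T (delta2 M) (fun s t => M s t - delta1 Z s t) by rewrite dE.
  have Z0a : Z 0 = a by rewrite /Z Z00 addr0.
  split.
  + by split=> // s t hst; rewrite ZE// dE.
  + rewrite (_ : (fun t => Z t - a) = Z0); last by apply/funext => t; rewrite /Z addrC addKr.
    exact: (primitive_controlled T0 gamma3 hX hL hU Z0A Z0s Z0b).
  + move=> Aa; apply: (primitive_controlled T0 gamma3 hX hL hU _ Zs).
      move=> t ht; apply: (lin_subspaceD (subalgebra_lin (filtration_subalgebra X t))).
        by apply: filtration_le Aa; case/andP: ht.
      exact: Z0A.
    by rewrite dE.
  + move=> Z' Z'0 dZ' t /andP[t0 tT].
    have hst : simplex2 T (0, t) by split.
    have := dZ' 0 t hst; rewrite ZE// /delta1 Z'0 Z00 subr0 => /eqP.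
    by rewrite subr_eq addrC => /eqP.
  + have Zb := Z0b; rewrite -dE in Zb.
    exact: (controlled_norm_le gamma3 hX hL hU Zb).
Qed.
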